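(* Let $d \ge 1$ and let $P \subset \mathbb{R}^d$ be a $d$-dimensional normalized locally anti-blocking polytope. Then $P$ has at least $2^d \cdot d!$ flags, and $P$ has exactly $2^d \cdot d!$ flags if and only if $P$ is a Hanner polytope.
   Context: A coordinate subspace of $\mathbb{R}^d$ is a linear span of a subset of the standard basis vectors $e_1,\dots,e_d$. A polytope $P \subset \mathbb{R}^d$ is locally anti-blocking if for every coordinate subspace $H$ of $\mathbb{R}^d$ one has $\mathrm{proj}_H P = P \cap H$, where $\mathrm{proj}_H$ is the orthogonal projection onto $H$. A locally anti-blocking polytope $P$ is normalized if its support function $h_P(v) = \max_{x \in P}\langle x,v\rangle$ satisfies $h_P(e_i) = h_P(-e_i) = 1$ for every $i \in \{1,\dots,d\}$. Flags: the faces of a $d$-dimensional polytope $P$ include the empty face (of dimension $-1$) and $P$ itself. A flag of $P$ is a sequence $(F_{-1},F_0,\dots,F_d)$ where $F_i$ is an $i$-dimensional face of $P$ and $F_i \subsetneq F_j$ for $i<j$. Hanner polytopes are defined recursively: (1) the segment $[-1,1] \subset \mathbb{R}^1$ is a Hanner polytope; (2) the polar dual $P^\circ = \{x : \langle x,y\rangle \le 1 \text{ for all } y \in P\}$ of a Hanner polytope $P$ is a Hanner polytope; (3) the convex hull $P \vee Q$ of two lower-dimensional Hanner polytopes $P$ and $Q$, of dimensions $k$ and $l$, embedded in two orthogonal subspaces (of dimensions $k$ and $l$) of $\mathbb{R}^{k+l}$, is a Hanner polytope. *)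

(* Defs.v *)
From mathcomp Require Import all_boot all_order all_algebra.
From mathcomp Require Import boolp classical_sets functions cardinality reals.

Set Implicit Arguments.
Unset Strict Implicit.
Unset Printing Implicit Defensive.

Import Order.TTheory GRing.Theory Num.Theory.

Local Open Scope classical_set_scope.
Local Open Scope ring_scope.

Section Euclidean.
Context {R : realType} {d : nat}.
Implicit Types (A F P : set 'rV[R]_d) (U : {vspace 'rV[R]_d}).

Definition dotp (x y : 'rV[R]_d) : R := \sum_i x 0 i * y 0 i.

Definition convex_hull A : set 'rV[R]_d :=
  [set x | exists n (p : 'I_n -> 'rV[R]_d) (w : 'I_n -> R),
    [/\ forall i, A (p i), forall i, 0 <= w i, \sum_i w i = 1
      & x = \sum_i w i *: p i]].

Definition affine_hull A : set 'rV[R]_d :=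
  [set x | exists n (p : 'I_n -> 'rV[R]_d) (w : 'I_n -> R),
    [/\ forall i, A (p i), \sum_i w i = 1 & x = \sum_i w i *: p i]].

(* The empty set has dimension -1; the second disjunct forces A to be
   nonempty, so that k is determined by A. *)
Definition has_dim A (k : int) : Prop :=
  (A = set0 /\ k = -1) \/
  (exists (x : 'rV[R]_d) U, affine_hull A = [set x + u | u in [set` U]]
               /\ k = (\dim U)%:Z).

Definition polytope P : Prop :=
  exists s : seq 'rV[R]_d, P = convex_hull [set` s].

Definition face P F : Prop :=
  F = set0 \/
  exists v, F = [set x | P x /\ forall y, P y -> dotp y v <= dotp x v].

(* A flag (F_{-1}, ..., F_d) is indexed by 'I_d.+2 with the index shifted by
   one: the entry at i is the face F_{i-1}.  The length is that of the flags
   of a full-dimensional P. *)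
Definition flags P : set ('I_d.+2 -> set 'rV[R]_d) :=
  [set F | [/\ forall i : 'I_d.+2, face P (F i),
               forall i : 'I_d.+2, has_dim (F i) ((i : nat)%:Z - 1)
             & forall i j : 'I_d.+2, (i < j)%N -> F i `<` F j]].

Definition coord_subspace (I : {set 'I_d}) : {vspace 'rV[R]_d} :=
  <<[seq delta_mx 0%R i | i in I]>>%VS.

Definition orth_proj U A : set 'rV[R]_d :=
  [set y | y \in U /\
           exists2 x, A x & forall u, u \in U -> dotp (x - y) u = 0].

Definition locally_anti_blocking P : Prop :=
  polytope P /\
  forall I : {set 'I_d},
    orth_proj (coord_subspace I) P = P `&` [set` coord_subspace I].

(* On a nonempty polytope this supremum is a maximum. *)
Definition support_fun P (v : 'rV[R]_d) : R := sup [set dotp x v | x in P].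

Definition normalized P : Prop :=
  forall i : 'I_d, support_fun P (delta_mx 0 i) = 1 /\
                   support_fun P (- delta_mx 0 i) = 1.

Definition polar P : set 'rV[R]_d :=
  [set x | forall y, P y -> dotp x y <= 1].

End Euclidean.

(* In hanner_join the two summands are placed in orthogonal subspaces of
   R^(k + l) by arbitrary linear isometries f and g; the subspaces need not
   be coordinate subspaces. *)
Inductive hanner (R : realType) : forall d, set 'rV[R]_d -> Prop :=
| hanner_segment : @hanner R 1 [set x : 'rV[R]_1 | -1 <= x 0 0 <= 1]
| hanner_polar d (P : set 'rV[R]_d) : hanner P -> hanner (polar P)
| hanner_join k l (P : set 'rV[R]_k) (Q : set 'rV[R]_l)
    (f : {linear 'rV[R]_k -> 'rV[R]_(k + l)})
    (g : {linear 'rV[R]_l -> 'rV[R]_(k + l)}) :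
    hanner P -> hanner Q ->
    (forall x y : 'rV[R]_k, dotp (f x) (f y) = dotp x y) ->
    (forall x y : 'rV[R]_l, dotp (g x) (g y) = dotp x y) ->
    (forall (x : 'rV[R]_k) (y : 'rV[R]_l), dotp (f x) (g y) = 0) ->
    hanner (convex_hull (f @` P `|` g @` Q)).

(* Main.v *)
(** The lower bound is first proved for a polytope P which is invariant under all coordinate
reflections.  A flag of such a P passes, between its vertex and its facet, through at most one
of the 2d faces on which a signed coordinate is maximal.  Each of these faces splits P into two
intervals of the same unconditional kind, of sizes i and d - 1 - i.  If x < X < y are faces, each
maximal chain of [x, X] can be shuffled with each one of [X, y], so that [x, y] has at least
C(rk y - rk x, rk X - rk x) times the product of their numbers of maximal chains.
As 2d C(d-1, i) (2^i i!) (2^(d-1-i) (d-1-i)!) = 2^d d!, the bound follows by induction.  If it is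
attained, the faces X above are modular in the intervals [x, y].  This forces the vertices to have
coordinates 0, 1, -1, makes P the hull of the signed stable sets of a graph, and excludes induced
paths on four vertices from the graph.  By Seinsche's theorem such a graph or its complement is
disconnected; as the complementary graph describes the polar of P, and joins of graphs describe
joins of polytopes, P is a Hanner polytope.

A locally anti-blocking P is symmetrised one coordinate l at a time: P+ and P- are obtained by
reflecting the halves of P in x_l >= 0 and x_l <= 0.  Unfolding the faces of P+ maps those flags of
P+ which do not end up in x_l <= 0, that is half of them, injectively to flags of P, so P has at
least as many flags as P+ and P- have on average.  If P attains the bound, so do P+ and P-, and
their graphs agree, since an edge i l present in only one of them would give a flag
of P through {x_i = 1, x_l = 0} and {x_i = 1} that is not an unfolding.

Conversely, polarity reverses face lattices and the flags of a join are shuffles of flags of the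
two summands, so every Hanner polytope has exactly 2^d d! flags. *)

Require Import Defs.
From mathcomp Require Import all_boot all_order all_algebra.
From mathcomp Require Import zify lra ring.
From mathcomp Require Import boolp.

Set Implicit Arguments.
Unset Strict Implicit.
Unset Printing Implicit Defensive.

Import Order.TTheory GRing.Theory Num.Theory.

(** * Maximal chains in graded families of sets *)

(** A face is encoded by the set of all generators of the cone over the polytope that lie in it:
    dimensions become ranks, the empty face has rank 0, and ranks are bounded by exhibiting
    independent functionals. The shuffle inequality uses intersections, ranks and relative
    complements only; its engine is the diamond property, by which the maximal chains of [x, X] can
    be traded for at least as many that run to a cover of X and leave X at their first step. The
    lattice above a face {x_j = 1} is not given as that of an unconditional polytope, so the
    induction runs over intervals [A, B] with a set K of coordinates in which B may be reflected.
    Below the face those coordinates survive that are not identically zero on it, above it those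
    that are, and j is used up; this gives i and d - 1 - i. An induced path a b c z contradicts the
    modularity of {x_a = 1} by a count of dimensions in which z is counted twice. For the converse
    and for the recognition of Hanner polytopes, a polytope is never separated from its polar: a
    pair of lists of points, or a graph with its complement, is carried along. *)

Ltac arith :=
  repeat match goal with
  | h : is_true (leq _ _) |- _ => revert h
  | h : @eq nat _ _ |- _ => revert h
  end; clear; intros; lia.

Section Chains.
Variables (T : finType) (F : pred {set T}).
Implicit Types A B C X Y x y : {set T}.

Definition cov A C :=
  [&& F C, A \proper C & [forall E : {set T}, F E && (A \proper E) ==> ~~ (E \proper C)]].

Fixpoint chn n A B : nat :=
  if A == B then 1
  else if n is m.+1 then \sum_(C | cov A C && (C \subset B)) chn m C B else 0.

(* The number of maximal chains of F from A to B, for which #|B| is enough fuel. *)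
Definition ch A B := chn #|B| A B.

Lemma covF A C : cov A C -> F C. Proof. by case/and3P. Qed.
Lemma cov_proper A C : cov A C -> A \proper C. Proof. by case/and3P. Qed.
Lemma cov_sub A C : cov A C -> A \subset C.
Proof. by move/cov_proper/proper_sub. Qed.
Lemma covN A C E : cov A C -> F E -> A \proper E -> ~~ (E \proper C).
Proof. by case/and3P=> _ _ /forallP/(_ E) /implyP h FE AE; apply: h; rewrite FE. Qed.

Lemma cov_eq A C E : cov A C -> F E -> A \proper E -> E \subset C -> E = C.
Proof.
move=> c FE AE EC; move: (covN c FE AE); rewrite properE EC /= negbK => CE.
by apply/eqP; rewrite eqEsubset EC.
Qed.

Lemma covI A C : F C -> A \proper C ->
  (forall E, F E -> A \proper E -> E \proper C -> False) -> cov A C.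
Proof.
move=> FC AC h; apply/and3P; split=> //; apply/forallP=> E; apply/implyP=> /andP[FE AE].
by apply/negP; exact: h.
Qed.

Lemma chn_fuel n m A B : A \subset B -> #|B| <= #|A| + n -> #|B| <= #|A| + m ->
  chn n A B = chn m A B.
Proof.
elim: n m A => [|n IH] [|m] A sAB hn hm.
- by [].
- rewrite /=; case: eqP => // nAB; case: nAB.
  by apply/eqP; rewrite eqEcard sAB; arith.
- rewrite /=; case: eqP => // nAB; case: nAB.
  by apply/eqP; rewrite eqEcard sAB; arith.
- rewrite /=; case: eqP => // nAB; apply: eq_bigr => C /andP[c sCB].
  have := proper_card (cov_proper c) => h.
  by apply: IH => //; arith.
Qed.

Lemma ch_refl A : ch A A = 1.
Proof. by rewrite /ch; case: #|A| => [|n] /=; rewrite eqxx. Qed.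

Lemma ch_step A B : A \proper B ->
  ch A B = \sum_(C | cov A C && (C \subset B)) ch C B.
Proof.
move=> pAB; have := proper_card pAB; rewrite /ch.
have nAB : A == B = false by apply/negbTE; move: pAB; rewrite properEneq => /andP[].
case e : #|B| => [|n] // h; rewrite [LHS]/= nAB; apply: eq_bigr => C /andP[c sCB].
have := proper_card (cov_proper c) => h'.
by apply: chn_fuel => //; arith.
Qed.

Lemma cov_ch A B : cov A B -> ch A B = 1.
Proof.
move=> c; rewrite ch_step ?cov_proper // (big_pred1 B) ?ch_refl // => C /=.
apply/andP/eqP => [[c' sCB]|->]; last by rewrite c.
exact: (cov_eq c (covF c') (cov_proper c')).
Qed.

(** [ch] is defined by its first step. This recursion on the last step follows by induction,
    exchanging the sums over first and last steps. *)
Lemma ch_last A B : F A -> F B -> A \proper B ->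
  ch A B = \sum_(C | [&& F C, A \subset C & cov C B]) ch A C.
Proof.
move=> FA FB pAB; have [m hm] : exists m, #|B| <= #|A| + m by exists #|B|; arith.
elim: m A FA pAB hm => [|m IH] A FA pAB hm.
  by have := proper_card pAB; arith.
case cAB : (cov A B).
  rewrite cov_ch // (big_pred1 A) ?ch_refl // => C /=.
  apply/and3P/eqP => [[FC sAC cCB]|->]; last by rewrite FA subxx cAB.
  apply/eqP/negPn/negP => nCA.
  have pAC : A \proper C by rewrite properEneq eq_sym nCA sAC.
  by have := covN cAB FC pAC; rewrite (cov_proper cCB).
rewrite ch_step //.
have h C : cov A C && (C \subset B) -> C \proper B.
  case/andP=> c s; rewrite properEneq s andbT; apply/eqP => e.
  by move: cAB; rewrite -e c.
transitivity (\sum_(C | cov A C && (C \subset B))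
   \sum_(y | [&& F y, C \subset y & cov y B]) ch C y).
  apply: eq_bigr => C hC; apply: IH; first by case/andP: hC => /covF.
    exact: h.
  by case/andP: hC => /cov_proper/proper_card; arith.
rewrite (exchange_big_dep (fun y => [&& F y, A \subset y & cov y B])) /=; last first.
  by move=> C y /andP[c _] /and3P[-> s ->]; rewrite (subset_trans (cov_sub c) s).
apply: eq_bigr => y /and3P[Fy sAy cyB].
have pAy : A \proper y.
  by rewrite properEneq sAy andbT; apply/eqP => e; move: cAB; rewrite e cyB.
rewrite (ch_step pAy); apply: eq_bigl => C.
rewrite Fy cyB andbT /=; case c : (cov A C) => //=.
case s : (C \subset y) => //=; last by rewrite andbF.
by rewrite (subset_trans s (cov_sub cyB)).
Qed.

End Chains.

(** What is used of a face lattice. [graded_mid] makes the covers exactly the steps of rank one.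
    [graded_compl] gives a second middle element in an interval of length two, which is half of the
    diamond property. *)
Record graded (T : finType) (F : pred {set T}) (rk : {set T} -> nat) : Prop := Graded {
  gradedI : forall A B, F A -> F B -> F (A :&: B);
  graded_rk : forall A B, F A -> F B -> A \proper B -> rk A < rk B;
  graded_mid : forall A B, F A -> F B -> A \proper B -> (rk A).+1 < rk B ->
    exists C, [/\ F C, A \proper C & C \proper B];
  graded_compl : forall A B C, F A -> F B -> F C -> A \proper C -> C \proper B ->
    exists D, [/\ F D, A \proper D, D \proper B & C :&: D = A] }.

(** * Shuffles of maximal chains, and modular elements *)

Section Graded.
Variables (T : finType) (F : pred {set T}) (rk : {set T} -> nat).
Hypothesis H : graded F rk.
Implicit Types A B C X Y x y : {set T}.

Local Notation cov := (cov F).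
Local Notation ch := (ch F).

Lemma rk_sub_eq A B : F A -> F B -> A \subset B -> rk B <= rk A -> A = B.
Proof.
move=> FA FB; rewrite subEproper => /orP[/eqP->//|/(graded_rk H FA FB)]; arith.
Qed.

Lemma cov_rk A C : F A -> cov A C -> rk C = (rk A).+1.
Proof.
move=> FA c; have h := graded_rk H FA (covF c) (cov_proper c).
apply/eqP; rewrite eqn_leq h andbT leqNgt; apply/negP => h2.
have [D [FD AD DC]] := graded_mid H FA (covF c) (cov_proper c) h2.
by have := covN c FD AD; rewrite DC.
Qed.

Lemma rk_cov A C : F A -> F C -> A \proper C -> rk C <= (rk A).+1 -> cov A C.
Proof.
move=> FA FC pAC h; apply: covI => // E FE pAE pEC.
by have := graded_rk H FA FE pAE; have := graded_rk H FE FC pEC; arith.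
Qed.

Lemma cov_ex A B : F A -> F B -> A \proper B -> exists2 C, cov A C & C \subset B.
Proof.
move=> FA; move: {-1}(rk B) (leqnn (rk B)) => n.
elim: n B => [|n IH] B hn FB pAB.
  by have := graded_rk H FA FB pAB; arith.
case: (leqP (rk B) (rk A).+1) => h.
  by exists B => //; apply: rk_cov.
have [D [FD AD DB]] := graded_mid H FA FB pAB h.
have h2 := graded_rk H FD FB DB.
have [|C c s] := IH D _ FD AD; first by arith.
by exists C => //; apply: subset_trans s (proper_sub DB).
Qed.

Lemma covl_ex A B : F A -> F B -> A \proper B ->
  exists C, [/\ F C, A \subset C & cov C B].
Proof.
move=> FA FB; have : rk B <= rk A + rk B by arith.
move: {2}(rk B) => n; elim: n A FA => [|n IH] A FA hn pAB.
  by have := graded_rk H FA FB pAB; arith.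
case: (leqP (rk B) (rk A).+1) => h.
  by exists A; split=> //; apply: rk_cov.
have [D [FD AD DB]] := graded_mid H FA FB pAB h.
have h2 := graded_rk H FA FD AD.
have [|C [FC s c]] := IH D FD _ DB; first by arith.
by exists C; split=> //; apply: subset_trans (proper_sub AD) s.
Qed.

Lemma ch_gt0 A B : F A -> F B -> A \subset B -> 0 < ch A B.
Proof.
move=> FA FB; have : rk B <= rk A + rk B by arith.
move: {2}(rk B) => n; elim: n A FA => [|n IH] A FA hn.
  by move=> s; rewrite (rk_sub_eq FA FB s) ?ch_refl //; arith.
rewrite subEproper => /orP[/eqP->|p]; first by rewrite ch_refl.
have [C c s] := cov_ex FA FB p.
rewrite ch_step // (bigD1 C) /=; last by rewrite c s.
by rewrite addn_gt0 IH ?(covF c) //; rewrite (cov_rk FA c); arith.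
Qed.

(* The diamond property enters only here: of the elements strictly between
   x and x2, at most one lies below X, and at least two exist. *)
Lemma diamond_swap x x2 X : F x -> F x2 -> F X -> x \proper x2 -> rk x2 = (rk x).+2 ->
  ~~ (x2 \subset X) -> x \subset X ->
  #|[set z | cov x z && cov z x2 & z \subset X]| <= #|[set z | cov x z && cov z x2 & ~~ (z \subset X)]|
  /\ (0 < #|[set z | cov x z && cov z x2 & ~~ (z \subset X)]| ->
      #|[set z | cov x z && cov z x2 & ~~ (z \subset X)]| <= #|[set z | cov x z && cov z x2 & z \subset X]| ->
      cov x (x2 :&: X)).
Proof.
move=> Fx Fx2 FX pxx2 rk2 nX sxX.
have one z : z \in [set z | cov x z && cov z x2 & z \subset X] -> z = x2 :&: X.
  rewrite inE => /andP[/andP[c1 c2] sz].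
  have FI := gradedI H Fx2 FX.
  have s : z \subset x2 :&: X by rewrite subsetI (cov_sub c2).
  apply: (rk_sub_eq (covF c1) FI s); rewrite (cov_rk Fx c1).
  have p : x2 :&: X \proper x2.
    by rewrite properE subsetIl /= subsetI subxx.
  by have := graded_rk H FI Fx2 p; arith.
have le1 : #|[set z | cov x z && cov z x2 & z \subset X]| <= 1.
  rewrite -(cards1 (x2 :&: X)); apply: subset_leq_card; apply/subsetP => z /one ->.
  by rewrite inE.
split; last first.
  move=> g0 g1; have : 0 < #|[set z | cov x z && cov z x2 & z \subset X]| by arith.
  by case/card_gt0P=> z zin; rewrite -(one z zin); move: zin; rewrite inE => /andP[/andP[]].
case: (posnP #|[set z | cov x z && cov z x2 & z \subset X]|) => [->//|].
case/card_gt0P=> z zin; apply: leq_trans le1 _; apply/card_gt0P.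
have ez := one z zin; move: zin; rewrite inE => /andP[/andP[c1 c2] sz].
have [D [FD pxD pDx2 zD]] := graded_compl H Fx Fx2 (covF c1) (cov_proper c1) (cov_proper c2).
have r1 := graded_rk H Fx FD pxD; have r2 := graded_rk H FD Fx2 pDx2.
exists D; rewrite inE !rk_cov //=; try arith.
apply/negP => sDX; have : D \subset z by rewrite ez subsetI sDX proper_sub.
by move/setIidPr; rewrite zD => e; move: pxD; rewrite e properxx.
Qed.

(** Two-step chains from [x] are grouped by their end [x2], and only the number of their middle
    elements remains. *)
Lemma sum_cov_swap (G : {set T} -> nat) (P Q : pred {set T}) x :
  \sum_(x1 | cov x x1 && P x1) \sum_(x2 | cov x1 x2 && Q x2) G x2 =
  \sum_(x2 | [exists z, cov x z && cov z x2] && Q x2)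
    #|[set z | cov x z && cov z x2 & P z]| * G x2.
Proof.
rewrite (exchange_big_dep (fun x2 => [exists z, cov x z && cov z x2] && Q x2)) /=; last first.
  by move=> z x2 /andP[c _] /andP[c2 ->]; rewrite andbT; apply/existsP; exists z; rewrite c c2.
apply: eq_bigr => x2 /andP[_ q]; rewrite sum_nat_const; congr (_ * _).
apply: eq_card => z; rewrite inE unfold_in /= q andbT.
by case: (P z); rewrite ?andbT ?andbF. 
Qed.

(** Counts the maximal chains from [x] to [X'] whose first step leaves [X]. *)
Definition zsum x X X' := \sum_(x' | [&& cov x x', x' \subset X' & ~~ (x' \subset X)]) ch x' X'.

Lemma zsum_top X X' : cov X X' -> zsum X X X' = 1.
Proof.
move=> cX; rewrite /zsum (big_pred1 X') ?ch_refl // => C /=.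
apply/and3P/eqP => [[c s n]|->]; first exact: (cov_eq cX (covF c) (cov_proper c) s).
by rewrite cX subxx; have := cov_proper cX; rewrite properE => /andP[].
Qed.

(** The possible second elements of a chain from [x] to [X'] that has left [X] by then. *)
Definition zidx x X X' x2 :=
  [exists z, cov x z && cov z x2] && ((x2 \subset X') && ~~ (x2 \subset X)).

(** Both sums are expanded down to the second element [x2], where they can be compared by the
    diamond property: in one of them the first step leaves [X], in the other one the second step
    does. *)
Lemma zsum_split x X X' : F x -> F X -> x \proper X -> cov X X' ->
  zsum x X X' = \sum_(x2 | zidx x X X' x2)
      #|[set z | cov x z && cov z x2 & ~~ (z \subset X)]| * ch x2 X' /\
  \sum_(x1 | cov x x1 && (x1 \subset X)) zsum x1 X X' = \sum_(x2 | zidx x X X' x2)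
      #|[set z | cov x z && cov z x2 & z \subset X]| * ch x2 X'.
Proof.
move=> Fx FX p cX; pose Q x2 := (x2 \subset X') && ~~ (x2 \subset X); split; last first.
  rewrite -(sum_cov_swap (fun x2 => ch x2 X') (fun z => z \subset X) Q).
  by apply: eq_bigr => x1 _.
rewrite -(sum_cov_swap (fun x2 => ch x2 X') (fun z => ~~ (z \subset X)) Q) /zsum.
have rX' := cov_rk FX cX; have rx := graded_rk H Fx FX p.
rewrite [RHS](bigID (fun x1 => x1 \subset X')) /= [X in _ = _ + X]big1 ?addn0; last first.
  move=> z /andP[/andP[c n] n'] /=; apply: big_pred0 => x2.
  apply/negP => /andP[c2 /andP[s2 _]]; case/negP: n'.
  exact: subset_trans (cov_sub c2) s2.
apply: eq_big => [z|z /and3P[c s n]]; first by rewrite -!andbA [_ && (z \subset X')]andbC.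
have rz := cov_rk Fx c.
rewrite ch_step; last first.
  by rewrite properEneq s andbT; apply/eqP => e; move: rX' rx; rewrite -e rz; arith.
apply: eq_bigl => x2; case c2 : (cov z x2) => //=; rewrite /Q.
case s2 : (x2 \subset X') => //=; apply/esym/negP => s3; case/negP: n.
exact: subset_trans (cov_sub c2) s3.
Qed.

Lemma zidxP x X X' x2 : F x -> zidx x X X' x2 ->
  [/\ F x2, x \proper x2, rk x2 = (rk x).+2, x2 \subset X' & ~~ (x2 \subset X)].
Proof.
move=> Fx /andP[/existsP[z /andP[c1 c2]] /andP[s n]]; split=> //; first exact: covF c2.
  exact: proper_sub_trans (cov_proper c1) (cov_sub c2).
by rewrite (cov_rk (covF c1) c2) (cov_rk Fx c1).
Qed.

Lemma zidx_le x X X' x2 : F x -> F X -> x \proper X -> zidx x X X' x2 ->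
  #|[set z | cov x z && cov z x2 & z \subset X]| * ch x2 X' <=
  #|[set z | cov x z && cov z x2 & ~~ (z \subset X)]| * ch x2 X'.
Proof.
move=> Fx FX p h; have [F2 p2 r2 _ n2] := zidxP Fx h.
rewrite leq_mul2r; apply/orP; right.
by case: (diamond_swap Fx F2 FX p2 r2 n2 (proper_sub p)).
Qed.

(** Induction on the corank of [x] in [X]: chains below [X] are traded for chains that take one step
    inside [X] and then leave it, and by [diamond_swap] at least as many leave with the first
    step. *)
Lemma zsum_ge x X X' : F x -> F X -> x \subset X -> cov X X' -> ch x X <= zsum x X X'.
Proof.
move=> Fx FX sxX cX; have [n hn] : exists n, rk X <= rk x + n by exists (rk X); lia.
elim: n x Fx sxX hn => [|n IH] x Fx sxX hn.
  have -> : x = X by apply: rk_sub_eq => //; arith.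
  by rewrite ch_refl zsum_top.
move: sxX; rewrite subEproper => /orP[/eqP e|p]; first by rewrite e ch_refl zsum_top.
rewrite ch_step //.
apply: (@leq_trans (\sum_(x1 | cov x x1 && (x1 \subset X)) zsum x1 X X')).
  apply: leq_sum => x1 /andP[c s]; apply: IH => //; first exact: covF c.
  by rewrite (cov_rk Fx c); arith.
have [-> ->] := zsum_split Fx FX p cX.
by apply: leq_sum => x2 h; apply: zidx_le.
Qed.

(** Equality makes each estimate in [zsum_ge] sharp. It passes to the atoms of [x, X], and a second
    element [x2] outside [X] then meets [X] in a cover of [x]. Climbing through such intersections
    below [W] leads to an element that is covered by [W]. *)
Lemma zsum_eq x X X' W : F x -> F X -> x \subset X -> cov X X' -> zsum x X X' = ch x X ->
  F W -> x \subset W -> W \subset X' -> ~~ (W \subset X) -> rk W = (rk (W :&: X)).+1.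
Proof.
move=> Fx FX sxX cX + FW; have [n hn] : exists n, rk X <= rk x + n by exists (rk X); lia.
have top y : y = X -> y \subset W -> W \subset X' -> ~~ (W \subset X) ->
    rk W = (rk (W :&: X)).+1.
  move=> e syW sWX' nW; have pXW : X \proper W by rewrite properE nW -e syW.
  by rewrite (cov_eq cX FW pXW sWX') (cov_rk FX cX) (setIidPr (cov_sub cX)).
elim: n x Fx sxX hn => [|n IH] x Fx sxX hn z sxW sWX' nW.
  by apply: (top x) => //; apply: rk_sub_eq => //; arith.
move: sxX; rewrite subEproper => /orP[/eqP e|p]; first exact: (top x).
have [h1 h2] := zsum_split Fx FX p cX.
have cnt x2 : zidx x X X' x2 -> 
    #|[set z | cov x z && cov z x2 & z \subset X]| * ch x2 X' <=
    #|[set z | cov x z && cov z x2 & ~~ (z \subset X)]| * ch x2 X' ?= iff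
    (#|[set z | cov x z && cov z x2 & z \subset X]| * ch x2 X' ==
    #|[set z | cov x z && cov z x2 & ~~ (z \subset X)]| * ch x2 X').
  by move=> h; split=> //; apply: zidx_le.
have ge x1 : cov x x1 && (x1 \subset X) -> ch x1 X <= zsum x1 X X' ?= iff (ch x1 X == zsum x1 X X').
  by move=> /andP[c s]; split => //; apply: zsum_ge => //; exact: covF c.
have [s1 s1e] := leqif_sum cnt; have [s2 s2e] := leqif_sum ge.
move: z; rewrite ch_step // => z.
have /eqP q1 : \sum_(x1 | cov x x1 && (x1 \subset X)) ch x1 X ==
   \sum_(x1 | cov x x1 && (x1 \subset X)) zsum x1 X X' by rewrite eqn_leq s2 /= h2 -z h1.
move: s1e s2e; rewrite -h1 -h2 z q1 !eqxx => /esym/forallP s1e /esym/forallP s2e.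
have zW : F (W :&: X) by exact: (gradedI H).
have pWX : W :&: X \proper W by rewrite properE subsetIl subsetI subxx.
have sxWX : x \subset W :&: X by rewrite subsetI sxW proper_sub.
(* An atom of [x, W] outside [X] is wanted. One outside a coatom [D] of [W] above the intersection
   with [X] will do, and [zsum_ge] for [D] and [W] shows that it exists. *)
have [D [FD sD cD]] := covl_ex zW FW pWX.
have sxD : x \subset D by apply: subset_trans sD.
have [x' /and3P[c' s' n']] : exists x', [&& cov x x', x' \subset W & ~~ (x' \subset D)].
  have : 0 < zsum x D W by apply: leq_trans (zsum_ge Fx FD sxD cD); apply: ch_gt0.
  case: (pickP (fun x' => [&& cov x x', x' \subset W & ~~ (x' \subset D)])) => [x' h _|h0].
    by exists x'.
  by rewrite /zsum big_pred0.
have nX : ~~ (x' \subset X).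
  by apply: contra n' => s; apply: subset_trans sD; rewrite subsetI s' s.
have Fx' := covF c'.
have [e|nx'] := eqVneq x' W.
  have -> : W :&: X = x.
    apply/esym/rk_sub_eq => //.
    by have := graded_rk H zW FW pWX; rewrite -{2}e (cov_rk Fx c'); arith.
  by rewrite -e (cov_rk Fx c').
have [|x2 c2 s2'] := cov_ex Fx' FW (_ : x' \proper W); first by rewrite properEneq nx'.
have F2 := covF c2.
have n2 : ~~ (x2 \subset X) by apply: contra nX; apply: subset_trans (cov_sub c2).
have i2 : zidx x X X' x2.
  rewrite /zidx n2 (subset_trans s2' sWX') !andbT.
  by apply/existsP; exists x'; rewrite c'.
have [_ p2 r2 _ _] := zidxP Fx i2.
have := s1e x2; rewrite i2 /= eqn_mul2r => /orP[/eqP e0|/eqP e0].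
  by have := ch_gt0 F2 (covF cX) (subset_trans s2' sWX'); rewrite e0.
have [_ dia] := diamond_swap Fx F2 FX p2 r2 n2 (proper_sub p).
have c1 : cov x (x2 :&: X).
  by apply: dia; rewrite ?e0 //; apply/card_gt0P; exists x'; rewrite inE c' c2.
have := s2e (x2 :&: X); rewrite c1 subsetIr /= => /eqP e1.
apply: (IH (x2 :&: X)) => //; first exact: covF c1.
- exact: subsetIr.
- by rewrite (cov_rk Fx c1); arith.
- exact: subset_trans (subsetIl _ _) s2'.
Qed.


Definition shuffles x X y := 'C(rk y - rk x, rk X - rk x) * ch x X * ch X y.

(** A first step outside [X] determines the cover of [X] it belongs to, so that the sums over the
    covers [X'] are disjoint. *)
Lemma lift_uniq X X1 X2 x1 : F X -> cov X X1 -> cov X X2 -> F x1 ->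
  x1 \subset X1 -> x1 \subset X2 -> ~~ (x1 \subset X) -> X1 = X2.
Proof.
move=> FX c1 c2 F1 s1 s2 n.
have FI := gradedI H (covF c1) (covF c2).
have pI : X \proper X1 :&: X2.
  rewrite properE subsetI (cov_sub c1) (cov_sub c2) /=; apply: contra n => s.
  by apply: subset_trans s; rewrite subsetI s1 s2.
by rewrite -(cov_eq c1 FI pI (subsetIl _ _)) {2}(esym (cov_eq c2 FI pI (subsetIr _ _))).
Qed.

(** First steps lie below [X], or below a cover of [X] inside [y], or below neither. The last kind
    is given away in the inequality and must be absent in the case of equality. *)
Lemma ch_shuffle_split x X y : F x -> F X -> F y -> x \proper X -> X \proper y ->
  ch x y = \sum_(x1 | cov x x1 && (x1 \subset X)) ch x1 y +
   (\sum_(X' | cov X X' && (X' \subset y))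
      \sum_(x1 | [&& cov x x1, x1 \subset X' & ~~ (x1 \subset X)]) ch x1 y +
    \sum_(x1 | [&& cov x x1, x1 \subset y, ~~ (x1 \subset X)
       & ~~ [exists X', [&& cov X X', X' \subset y & x1 \subset X']]]) ch x1 y).
Proof.
move=> Fx FX Fy p1 p2; rewrite ch_step ?(proper_trans p1) //.
rewrite (bigID (fun x1 => x1 \subset X)) /=; congr (_ + _).
  apply: eq_bigl => x1; rewrite -andbA; congr (_ && _).
  case s : (x1 \subset X); rewrite ?andbF //.
  by rewrite (subset_trans s (proper_sub p2)).
rewrite (bigID (fun x1 => [exists X', [&& cov X X', X' \subset y & x1 \subset X']])) /=.
congr (_ + _); last by apply: eq_bigl => x1; rewrite -!andbA.
symmetry; rewrite (exchange_big_dep (fun x1 => cov x x1 && (x1 \subset y) && ~~ (x1 \subset X) &&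
   [exists X', [&& cov X X', X' \subset y & x1 \subset X']])) /=; last first.
  move=> X' x1 /andP[c s] /and3P[c1 s1 n]; rewrite c1 n (subset_trans s1 s) /=.
  by apply/existsP; exists X'; rewrite c s s1.
apply: eq_bigr => x1 /andP[/andP[/andP[c1 s1] n] /existsP[X' /and3P[c s s']]].
rewrite (big_pred1 X') // => X2 /=; rewrite c1 n andbT /=.
apply/idP/eqP => [/andP[/andP[c2 _] s2]|->]; last by rewrite c s s'.
exact: (lift_uniq FX c2 c (covF c1)).
Qed.

Lemma bin_proper a b c : a < b < c ->
  'C(c - a, b - a) = 'C(c - a.+1, b - a.+1) + 'C(c - a.+1, b.+1 - a.+1).
Proof.
move=> /andP[h1 h2]; have -> : c - a = (c - a.+1).+1 by arith.
have -> : b - a = (b - a.+1).+1 by arith.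
by rewrite binS addnC; congr ('C(_, _) + 'C(_, _)); arith.
Qed.

(** Pascal's rule: a shuffle begins with a step of its chain in [x, X] or with one of its chain in
    [X, y]. *)
Lemma shuffles_split x X y : F x -> F X -> F y -> x \proper X -> X \proper y ->
  shuffles x X y = \sum_(x1 | cov x x1 && (x1 \subset X)) shuffles x1 X y +
   \sum_(X' | cov X X' && (X' \subset y))
      'C(rk y - (rk x).+1, (rk X).+1 - (rk x).+1) * (ch x X * ch X' y).
Proof.
move=> Fx FX Fy p1 p2; have r1 := graded_rk H Fx FX p1; have r2 := graded_rk H FX Fy p2.
rewrite /shuffles bin_proper ?r1 // !mulnDl; congr (_ + _).
  rewrite (ch_step F p1) big_distrr big_distrl /=; apply: eq_bigr => x1 /andP[c s].
  by rewrite (cov_rk Fx c).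
rewrite (ch_step F p2) big_distrr /=; apply: eq_bigr => X' _.
by rewrite mulnA.
Qed.

Lemma zsum_shuffles x X y : F x -> F X -> F y -> x \proper X -> X \proper y ->
  \sum_(X' | cov X X' && (X' \subset y))
      \sum_(x1 | [&& cov x x1, x1 \subset X' & ~~ (x1 \subset X)]) shuffles x1 X' y =
  \sum_(X' | cov X X' && (X' \subset y))
      'C(rk y - (rk x).+1, (rk X).+1 - (rk x).+1) * (zsum x X X' * ch X' y).
Proof.
move=> Fx FX Fy p1 p2; apply: eq_bigr => X' /andP[c s].
rewrite /zsum big_distrl big_distrr /=; apply: eq_bigr => x1 /andP[c1 _].
by rewrite /shuffles (cov_rk Fx c1) (cov_rk FX c) mulnA.
Qed.

Lemma shuffles_triv x X y : x \subset X -> X \subset y -> (x == X) || (X == y) ->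
  shuffles x X y = ch x y.
Proof.
rewrite /shuffles => _ _ /orP[/eqP->|/eqP->]; rewrite ch_refl.
  by rewrite subnn bin0 !mul1n.
by rewrite binn mul1n muln1.
Qed.

(** Induction upwards from [x]. Shuffles beginning in [x, X] are bounded at the new bottom [x1];
    those beginning with a step from [X] to [X'] are charged, by [zsum_ge], to chains whose first
    step is below [X'] but not below [X]. *)
Lemma shuffles_le x X y : F x -> F X -> F y -> x \subset X -> X \subset y ->
  shuffles x X y <= ch x y.
Proof.
move=> Fx; have [n hn] : exists n, rk y <= rk x + n by exists (rk y); lia.
elim: n x X Fx hn => [|n IH] x X Fx hn FX Fy s1 s2.
  have e : x = y.
    by apply: rk_sub_eq => //; [exact: subset_trans s1 s2 | arith].
  by rewrite shuffles_triv // e (_ : X = y) ?eqxx //; apply/eqP; rewrite eqEsubset s2 -{1}e.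
case: (boolP ((x == X) || (X == y))) => [|]; first by move/(shuffles_triv s1 s2)->.
rewrite negb_or => /andP[n1 n2].
have p1 : x \proper X by rewrite properEneq n1.
have p2 : X \proper y by rewrite properEneq n2.
rewrite (shuffles_split Fx FX Fy p1 p2) (ch_shuffle_split Fx FX Fy p1 p2).
have IH1 x1 X1 : cov x x1 -> F X1 -> x1 \subset X1 -> X1 \subset y -> shuffles x1 X1 y <= ch x1 y.
  by move=> c FX1 s s'; apply: IH => //; [exact: covF c | rewrite (cov_rk Fx c); arith].
apply: leq_add.
  by apply: leq_sum => x1 /andP[c s]; apply: IH1.
apply: leq_trans (leq_addr _ _).
apply: (@leq_trans (\sum_(X' | cov X X' && (X' \subset y))
      'C(rk y - (rk x).+1, (rk X).+1 - (rk x).+1) * (zsum x X X' * ch X' y))).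
  apply: leq_sum => X' /andP[c s]; rewrite leq_mul // leq_mul //.
  by apply: zsum_ge.
rewrite -zsum_shuffles //; apply: leq_sum => X' /andP[c s].
by apply: leq_sum => x1 /and3P[c1 sx n']; apply: IH1 => //; exact: covF c.
Qed.

Lemma leq_sum_eq (I : finType) (P : pred I) (a b : I -> nat) :
  (forall i, P i -> a i <= b i) -> \sum_(i | P i) a i = \sum_(i | P i) b i ->
  forall i, P i -> a i = b i.
Proof.
move=> h /eqP e i Pi.
have h' j : P j -> a j <= b j ?= iff (a j == b j) by move=> Pj; split; first exact: h.
by have [_] := leqif_sum h'; rewrite e => /esym/forallP/(_ i); rewrite Pi => /eqP.
Qed.

Lemma shuffles_eq x X y : F x -> F X -> F y -> x \proper X -> X \proper y ->
  shuffles x X y = ch x y ->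
  [/\ forall x1, cov x x1 -> x1 \subset X -> shuffles x1 X y = ch x1 y,
      forall x1, cov x x1 -> x1 \subset y -> ~~ (x1 \subset X) ->
        exists X', [/\ cov X X', X' \subset y, x1 \subset X' & shuffles x1 X' y = ch x1 y]
    & forall X', cov X X' -> X' \subset y -> zsum x X X' = ch x X].
Proof.
move=> Fx FX Fy p1 p2.
rewrite (shuffles_split Fx FX Fy p1 p2) (ch_shuffle_split Fx FX Fy p1 p2).
have l1 x1 : cov x x1 && (x1 \subset X) -> shuffles x1 X y <= ch x1 y.
  move=> /andP[c s]; apply: shuffles_le => //; [exact: covF c | exact: proper_sub].
have l2 X' : cov X X' && (X' \subset y) ->
    'C(rk y - (rk x).+1, (rk X).+1 - (rk x).+1) * (ch x X * ch X' y) <=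
    'C(rk y - (rk x).+1, (rk X).+1 - (rk x).+1) * (zsum x X X' * ch X' y).
  move=> /andP[c s]; rewrite leq_mul // leq_mul //.
  by apply: zsum_ge => //; exact: proper_sub.
have l4 X' : cov X X' && (X' \subset y) -> forall x1,
    [&& cov x x1, x1 \subset X' & ~~ (x1 \subset X)] -> shuffles x1 X' y <= ch x1 y.
  move=> /andP[c s] x1 /and3P[c1 sx n']; apply: shuffles_le => //; [exact: covF c1 | exact: covF c].
have l3 X' : cov X X' && (X' \subset y) ->
      \sum_(x1 | [&& cov x x1, x1 \subset X' & ~~ (x1 \subset X)]) shuffles x1 X' y <=
      \sum_(x1 | [&& cov x x1, x1 \subset X' & ~~ (x1 \subset X)]) ch x1 y.
  by move=> h; apply: leq_sum => x1; apply: l4.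
have L1 := leq_sum (index_enum _) l1; have L2 := leq_sum (index_enum _) l2; have L3 := leq_sum (index_enum _) l3.
move=> e.
rewrite -(zsum_shuffles Fx FX Fy p1 p2) in L2.
have ar a b c d e1 f : a <= b -> c <= d -> d <= e1 -> a + c = b + (e1 + f) ->
   [/\ a = b, c = d, d = e1 & f = 0] by clear; split; lia.
have {ar} [E1 E2 E3 E4] := ar _ _ _ _ _ _ L1 L2 L3 e.
have M1 := leq_sum_eq l1 E1; have M3 := leq_sum_eq l3 E3.
rewrite (zsum_shuffles Fx FX Fy p1 p2) in E2; have M2 := leq_sum_eq l2 E2.
split=> [x1 c s|x1 c s n|X' c s]; first by rewrite M1 ?c.
  case: (boolP [exists X', [&& cov X X', X' \subset y & x1 \subset X']]) => [/existsP[X' /and3P[c1 s1 s2]]|nex].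
    exists X'; split=> //; have q : cov X X' && (X' \subset y) by rewrite c1.
    by apply: (leq_sum_eq (l4 _ q) (M3 _ q)); rewrite c s2.
  move/eqP: E4; rewrite sum_nat_eq0 => /forallP/(_ x1); rewrite c s n nex /= => /eqP e0.
  by have := ch_gt0 (covF c) Fy s; rewrite e0.
have := M2 X'; rewrite c s => /(_ isT) /eqP.
have r1 := graded_rk H Fx FX p1; have r2 := graded_rk H FX Fy p2.
rewrite eqn_mul2l -leqn0 leqNgt bin_gt0 leq_sub2r //= eqn_mul2r -leqn0 leqNgt.
by rewrite ch_gt0 ?(covF c) //= => /eqP.
Qed.

(** [x] moves up inside [W]. While it is strictly below the intersection of [W] and [X], an atom
    below both is taken. Otherwise an atom [x1] below [W] is taken and [X] is replaced by the cover
    [X'] containing [x1]; [zsum_eq] says that [W] and [X'] meet exactly in [x1]. *)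
Lemma shuffles_modular x X y W : F x -> F X -> F y -> x \subset X -> X \subset y ->
  shuffles x X y = ch x y -> F W -> x \subset W -> W \subset y ->
  exists V, [/\ F V, W :|: X \subset V, rk V + rk (W :&: X) = rk W + rk X &
    forall U, F U -> W :|: X \subset U -> V \subset U].
Proof.
move=> Fx FX Fy sxX sXy e FW sxW sWy.
have [n hn] : exists n, rk y <= rk x + n by exists (rk y); lia.
have triv x' X' : W \subset X' -> F X' -> exists V, [/\ F V, W :|: X' \subset V, rk V + rk (W :&: X') = rk W + rk X' &
    forall U, F U -> W :|: X' \subset U -> V \subset U].
  move=> s FX'; exists X'; split=> //; first by rewrite subUset s subxx.
    by rewrite (setIidPl s) addnC.
  by move=> U _; rewrite subUset => /andP[].
elim: n x X Fx hn FX sxX sXy e sxW => [|n IH] x X Fx hn FX sxX sXy e sxW.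
  apply: (triv x) => //; have exy : x = y by apply: rk_sub_eq => //; [exact: subset_trans sXy | arith].
  by rewrite -(_ : y = X) //; apply/eqP; rewrite eqEsubset sXy -exy sxX.
case: (boolP (W \subset X)) => [s|nWX]; first exact: (triv x).
have [exX|nxX] := eqVneq x X.
  exists W; rewrite -exX; split=> //; first by rewrite subUset subxx sxW.
    by rewrite (setIidPr sxW).
  by move=> U _; rewrite subUset => /andP[].
have [eXy|nXy] := eqVneq X y; first by move: nWX; rewrite eXy sWy.
have pxX : x \proper X by rewrite properEneq nxX.
have pXy : X \proper y by rewrite properEneq nXy.
have [h1 h2 h3] := shuffles_eq Fx FX Fy pxX pXy e.
have FI := gradedI H FW FX.
have sxI : x \subset W :&: X by rewrite subsetI sxW.
move: (sxI); rewrite subEproper => /orP[/eqP exI|pxI].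
  have [x1 c1 s1] : exists2 x1, cov x x1 & x1 \subset W.
    by apply: cov_ex => //; rewrite properEneq sxW andbT; apply: contraNneq nWX => <-.
  have F1 := covF c1.
  have n1 : ~~ (x1 \subset X).
    apply/negP => s; have := cov_proper c1; rewrite properE => /andP[_ /negP]; apply.
    by rewrite exI subsetI s1.
  have [X' [cX' sX'y s1' e1]] := h2 _ c1 (subset_trans s1 sWy) n1.
  have FX' := covF cX'.
  have I' : W :&: X' = x1.
    have FI' := gradedI H FW FX'.
    apply/esym/(rk_sub_eq F1 FI'); first by rewrite subsetI s1.
    have nI' : ~~ (W :&: X' \subset X).
      by apply: contra n1; apply: subset_trans; rewrite subsetI s1.
    have := zsum_eq Fx FX sxX cX' (h3 _ cX' sX'y) FI' _ (subsetIr _ _) nI'.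
    rewrite -setIA (setIidPr (cov_sub cX')) -exI (cov_rk Fx c1) => -> //.
    by rewrite subsetI sxW (subset_trans sxX (cov_sub cX')).
  have [|V [FV sV rV mV]] := IH x1 X' F1 _ FX' s1' sX'y e1 s1.
    by rewrite (cov_rk Fx c1); arith.
  exists V; split=> //.
  - by move: sV; rewrite !subUset => /andP[-> s]; rewrite (subset_trans (cov_sub cX')).
  - by move: rV; rewrite I' -exI (cov_rk Fx c1) (cov_rk FX cX'); arith.
  - move=> U FU; rewrite subUset => /andP[sWU sXU]; apply: mV => //; rewrite subUset sWU /=.
    have FUX := gradedI H FU FX'.
    have p : X \proper U :&: X'.
      rewrite properE subsetI sXU (cov_sub cX') /=; apply: contra n1; apply: subset_trans.
      by rewrite subsetI s1' (subset_trans s1).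
    by rewrite -(cov_eq cX' FUX p (subsetIr _ _)) subsetIl.
have [x1 c1 s1] := cov_ex Fx FI pxI.
have sX1 : x1 \subset X by exact: subset_trans s1 (subsetIr _ _).
have hn1 : rk y <= rk x1 + n by rewrite (cov_rk Fx c1); arith.
exact: (IH x1 X (covF c1) hn1 FX sX1 sXy (h1 _ c1 sX1) (subset_trans s1 (subsetIl _ _))).
Qed.

Lemma ch_atom_coatom A B : F A -> F B -> A \proper B -> (rk A).+1 < rk B ->
  ch A B = \sum_(x | cov A x) \sum_(y | [&& F y, x \subset y & cov y B]) ch x y.
Proof.
move=> FA FB p r; rewrite ch_step // [RHS](bigID (fun x => x \subset B)) /=.
rewrite [X in _ = _ + X]big1 ?addn0.
  apply: eq_bigr => x /andP[c s]; apply: ch_last => //; first exact: covF c.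
  by rewrite properEneq s andbT; apply/eqP => e; move: r; rewrite -e (cov_rk FA c) ltnn.
move=> x /andP[c n]; apply: big1 => y /and3P[_ s1 c1].
by case/negP: n; apply: subset_trans s1 (cov_sub c1).
Qed.

(** Counts the maximal chains from [A] to [B] whose atom is below [X] and whose coatom is above [X];
    such a chain may avoid [X] itself. *)
Definition through A X B :=
  \sum_(x | cov A x && (x \subset X)) \sum_(y | [&& F y, X \subset y & cov y B]) ch x y.

(** [shuffles_le] is applied between an atom and a coatom, an interval of length rk B - rk A - 2;
    this is the origin of the binomial coefficient. *)
Lemma through_ge A X B : F A -> F X -> F B -> A \proper X -> X \proper B ->
  'C(rk B - (rk A).+2, rk X - (rk A).+1) * ch A X * ch X B <= through A X B
  ?= iff [forall x : {set T}, forall y : {set T},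
     (cov A x && (x \subset X)) ==> ([&& F y, X \subset y & cov y B]) ==> (shuffles x X y == ch x y)].
Proof.
move=> FA FX FB p1 p2; rewrite (ch_step F p1) (ch_last FX FB p2).
rewrite -mulnA big_distrl big_distrr /= /through.
have -> : [forall x : {set T}, forall y : {set T},
     (cov A x && (x \subset X)) ==> ([&& F y, X \subset y & cov y B]) ==> (shuffles x X y == ch x y)]
   = [forall (x | cov A x && (x \subset X)), [forall (y | [&& F y, X \subset y & cov y B]), (shuffles x X y == ch x y)]].
  apply/eq_forallb => x; case: (cov A x && _) => /=; last by apply/forallP.
  by [].
apply: leqif_sum => x /andP[c s]; rewrite mulnCA big_distrr /=.
rewrite mulnC big_distrl /=.
apply: leqif_sum => y /and3P[Fy s' c'].
have -> : 'C(rk B - (rk A).+2, rk X - (rk A).+1) * ch X y * ch x X = shuffles x X y.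
  by rewrite /shuffles (cov_rk FA c) (cov_rk Fy c') subSS mulnAC.
by split=> //; apply: shuffles_le => //; exact: covF c.
Qed.

(* Flags of [A, B] are separated by their atom and their coatom, so the
   contributions of the X i add up. *)
Lemma ch_ge_through (I : finType) (P : pred I) (X : I -> {set T}) A B :
  F A -> F B -> A \proper B -> (rk A).+1 < rk B ->
  (forall x y i j, P i -> P j -> cov A x -> F y -> cov y B ->
     x \subset X i -> X i \subset y -> x \subset X j -> X j \subset y -> i = j) ->
  \sum_(i | P i) through A (X i) B <= ch A B ?= iff
   [forall x : {set T}, forall y : {set T}, [&& cov A x, F y, cov y B & x \subset y] ==>
     [exists i, [&& P i, x \subset X i & X i \subset y]]].
Proof.
move=> FA FB p r dis; rewrite ch_atom_coatom // /through.
rewrite (exchange_big_dep (cov A)) /=; last by move=> i x _ /andP[].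
under eq_bigr => x c.
  rewrite (exchange_big_dep (fun y => [&& F y, x \subset y & cov y B])) /=; last first.
    move=> i y /and3P[_ _ s] /and3P[-> s' ->].
    by rewrite (subset_trans s s').
  over.
have -> : [forall x : {set T}, forall y : {set T}, [&& cov A x, F y, cov y B & x \subset y] ==>
     [exists i, [&& P i, x \subset X i & X i \subset y]]] =
   [forall (x | cov A x), [forall (y | [&& F y, x \subset y & cov y B]), [exists i, [&& P i, x \subset X i & X i \subset y]]]].
  apply: eq_forallb => x; case: (cov A x) => /=; last by apply/forallP.
  apply: eq_forallb => y; by rewrite [(x \subset y) && _]andbC.
apply: leqif_sum => x c; apply: leqif_sum => y /and3P[Fy s c'].
case: (boolP [exists i, _]) => [/existsP[i /and3P[Pi s1 s2]]|nex].
  rewrite (big_pred1 i); first by apply/leqif_refl.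
  move=> j /=; rewrite c Fy c' /= !andbT; apply/idP/eqP => [/andP[/andP[Pj t1] t2]|->]; last by rewrite Pi s1 s2.
  exact: (dis x y).
rewrite big_pred0; first by apply/leqifP; rewrite ch_gt0 ?(covF c).
move=> j /=; rewrite c Fy c' /= !andbT; apply/negP => /andP[/andP[Pj t1] t2].
by case/existsP: nex; exists j; rewrite Pj t1 t2.
Qed.

(** A largest [y] that avoids [t] is a coatom: an element strictly between [y] and the top would
    contain [t], and so would its relative complement, although they meet in [y]. *)
Lemma graded_separate A t : F A -> t \notin A -> F setT ->
  exists y, [/\ F y, A \subset y, t \notin y & cov y setT].
Proof.
move=> FA tA FT.
pose P (y : {set T}) := F y && (A \subset y) && (t \notin y).
have hA : P A by rewrite /P FA subxx.
case: (arg_maxnP (P := P) (fun y : {set T} => #|y|) hA) => y /andP[/andP[Fy sAy] ty] ymax.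
exists y; split=> //; apply: covI => //.
  by rewrite properT; apply: contraNneq ty => ->.
move=> C FC pyC pCT.
have [D [FD pD _ eD]] := graded_compl H Fy FT FC pyC pCT.
have big E : F E -> y \proper E -> t \in E.
  move=> FE p; apply/negPn/negP => tE.
  have := ymax E; rewrite /P FE tE (subset_trans sAy (proper_sub p)) => /(_ isT).
  by apply/negP; rewrite -ltnNge; exact: proper_card.
by case/negP: ty; rewrite -eD inE !big.
Qed.
End Graded.

Local Open Scope ring_scope.

(** * Index faces of a cone *)

Lemma col_mulmx (R : pzSemiRingType) m n p (A : 'M[R]_(m, n)) (B : 'M_(n, p)) j :
  col j (A *m B) = A *m col j B.
Proof. by apply/matrixP => a b; rewrite !mxE; apply: eq_bigr => k _; rewrite mxE. Qed.

Section IndexFaces.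
Variables (R : realFieldType) (n : nat) (T : finType) (v : T -> 'rV[R]_n).
Implicit Types (A B C I : {set T}) (w f : 'cV[R]_n).

Definition ev w i : R := (v i *m w) 0 0.

Lemma evD w f i : ev (w + f) i = ev w i + ev f i.
Proof. by rewrite /ev mulmxDr mxE. Qed.
Lemma evZ a w i : ev (a *: w) i = a * ev w i.
Proof. by rewrite /ev -scalemxAr mxE. Qed.
Lemma evN w i : ev (- w) i = - ev w i.
Proof. by rewrite /ev mulmxN mxE. Qed.
Lemma evB w f i : ev (w - f) i = ev w i - ev f i.
Proof. by rewrite evD evN. Qed.
Lemma ev0 i : ev 0 i = 0.
Proof. by rewrite /ev mulmx0 mxE. Qed.
Lemma ev_mulmx w i : ev w i = (v i *m w) 0 0. Proof. by []. Qed.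
Lemma evE w i : ev w i = \sum_j v i 0 j * w j 0.
Proof. by rewrite /ev mxE. Qed.

Definition nonneg w := forall i, 0 <= ev w i.
Definition zeros w : {set T} := [set i | ev w i == 0].

(* A face of the cone generated by v is encoded by the set of all generators it contains. *)
Definition isface : pred {set T} := fun I => `[< exists2 w, nonneg w & I = zeros w >].

Lemma isfaceP I : reflect (exists2 w, nonneg w & I = zeros w) (isface I).
Proof. exact: asboolP. Qed.

Definition span I : 'M[R]_n := (\sum_(i in I) <<v i>>)%MS.
Definition rk I := \rank (span I).

Lemma rk_leq I : (rk I <= n)%N. Proof. exact: rank_leq_row. Qed.

Lemma span_sup I i : i \in I -> (v i <= span I)%MS.
Proof. by move=> iI; apply: (sumsmx_sup i) => //; rewrite genmxE. Qed.

Lemma span_sub I (m : nat) (U : 'M[R]_(m, n)) : (forall i, i \in I -> (v i <= U)%MS) -> (span I <= U)%MS.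
Proof. by move=> h; apply/sumsmx_subP => i /h; rewrite genmxE. Qed.

Lemma spanS A B : A \subset B -> (span A <= span B)%MS.
Proof. by move/subsetP => s; apply: span_sub => i /s /span_sup. Qed.

Lemma rkS A B : A \subset B -> (rk A <= rk B)%N.
Proof. by move/spanS/mxrankS. Qed.

Lemma ev_eq0 w i : (ev w i == 0) = (v i *m w == 0).
Proof.
apply/eqP/eqP => [h|h]; last by rewrite /ev h mxE.
by apply/matrixP => a b; rewrite !ord1 [RHS]mxE.
Qed.

Lemma ev_kill (m : nat) (U : 'M[R]_(m, n)) w i : (v i <= U)%MS -> U *m w = 0 -> ev w i = 0.
Proof. by case/submxP => D e h; rewrite /ev e -mulmxA h mulmx0 mxE. Qed.

Lemma span_kill I w : (forall i, i \in I -> ev w i = 0) -> span I *m w = 0.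
Proof.
move=> h; apply/eqP; rewrite -sub_kermx; apply: span_sub => i /h/eqP.
by rewrite ev_eq0 sub_kermx.
Qed.

Lemma ev_separate (m : nat) (U : 'M[R]_(m, n)) (x : 'rV[R]_n) : ~~ (x <= U)%MS ->
  exists2 w : 'cV[R]_n, U *m w = 0 & 0 < (x *m w) 0 0.
Proof.
rewrite submxE => /rV0Pn[j jn].
have [w hU hn] : exists2 w : 'cV[R]_n, U *m w = 0 & (x *m w) 0 0 != 0.
  exists (col j (cokermx U)); first by rewrite -col_mulmx mulmx_coker; apply/matrixP => a b; rewrite !mxE.
  by rewrite -col_mulmx mxE.
case: (ltgtP 0 ((x *m w) 0 0)) => h; [by exists w | | by rewrite -h eqxx in hn].
by exists (- w); rewrite mulmxN ?hU ?oppr0 // mxE oppr_gt0.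
Qed.

Lemma isface_setT : isface setT.
Proof.
apply/isfaceP; exists 0; first by move=> i; rewrite ev0.
by apply/setP => i; rewrite !inE ev0 eqxx.
Qed.

Lemma isfaceI A B : isface A -> isface B -> isface (A :&: B).
Proof.
move=> /isfaceP[w hw ->] /isfaceP[f hf ->]; apply/isfaceP; exists (w + f).
  by move=> i; rewrite evD addr_ge0.
by apply/setP => i; rewrite !inE evD paddr_eq0.
Qed.

Lemma isface_pos A : isface A -> exists2 w,
  (forall i, i \in A -> ev w i = 0) & (forall i, i \notin A -> 0 < ev w i).
Proof.
move=> /isfaceP[w hw ->]; exists w => i; rewrite inE; first by move/eqP.
by move=> h; rewrite lt_def h hw.
Qed.

(** A face of a face is a face: [w] is controlled on [B] only, and a large multiple of a functional
    vanishing exactly on [B] repairs it elsewhere. *)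
Lemma isface_in B C w : isface B -> (forall i, i \in B -> 0 <= ev w i) ->
  (forall i, (i \in C) = (i \in B) && (ev w i == 0)) -> isface C.
Proof.
move=> /isface_pos[f f0 f1] hw hC.
(* Each summand is the multiple needed at one index; the 1 makes the values outside [B] strictly
   positive. *)
pose M := 1 + \sum_(i | i \notin B) `|ev w i| / ev f i.
have big i : i \notin B -> 0 < ev w i + M * ev f i.
  move=> iB; have p := f1 i iB; rewrite /M (bigD1 i) //=.
  have s0 : 0 <= \sum_(j | (j \notin B) && (j != i)) `|ev w j| / ev f j.
    by apply: sumr_ge0 => j /andP[jB _]; rewrite divr_ge0 // ltW // f1.
  set s := (X in _ + (_ + X)) in s0 *.
  have -> : ev w i + (1 + (`|ev w i| / ev f i + s)) * ev f i =
     (ev w i + `|ev w i|) + (1 + s) * ev f i.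
    by rewrite addrCA mulrDl divfK ?gt_eqF //; ring.
  have := ler_norm (- ev w i); rewrite normrN => h.
  have : 0 < (1 + s) * ev f i by rewrite mulr_gt0 // addrC ltr_wpDl.
  lra.
apply/isfaceP; exists (w + M *: f) => [i|].
  rewrite evD evZ; case: (boolP (i \in B)) => iB; last exact/ltW/big.
  by rewrite f0 // mulr0 addr0 hw.
apply/setP => i; rewrite hC inE evD evZ; case: (boolP (i \in B)) => iB /=.
  by rewrite f0 // mulr0 addr0.
by rewrite gt_eqF // big.
Qed.

(* Moving from w in direction - f until a point with f > 0 becomes tight. *)
Lemma push B w f t : (forall i, i \in B -> 0 <= ev w i) -> t \in B -> 0 < ev f t ->
  exists tau t', [/\ forall i, i \in B -> 0 <= ev (w - tau *: f) i, t' \in B, 0 < ev f t'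
    & ev (w - tau *: f) t' = 0].
Proof.
move=> hw tB ft.
pose P i := (i \in B) && (0 < ev f i).
have hP : P t by rewrite /P tB.
case: (arg_minP (P := P) (fun i => ev w i / ev f i) hP) => t' /andP[t'B ft'] hmin.
exists (ev w t' / ev f t'), t'; split=> //; last first.
  by rewrite evB evZ divfK ?subrr // gt_eqF.
move=> i iB; rewrite evB evZ; have tau0 : 0 <= ev w t' / ev f t'.
  by rewrite divr_ge0 ?hw // ltW.
case: (lerP (ev f i) 0) => h.
  by rewrite subr_ge0 (le_trans _ (hw i iB)) // mulr_ge0_le0.
have := hmin i; rewrite /P iB h => /(_ isT).
by rewrite ler_pdivlMr // subr_ge0.
Qed.

Lemma rk_strict A B : isface A -> A \proper B -> (rk A < rk B)%N.
Proof.
move=> /isface_pos[w w0 w1] /properP[s [i iB iA]].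
rewrite /rk (ltn_leqif (mxrank_leqif_sup (spanS s))); apply/negP => h.
have := ev_kill (submx_trans (span_sup iB) h) (span_kill w0).
by apply/eqP; rewrite gt_eqF // w1.
Qed.

Lemma rk_setU1 A t : (rk (t |: A) <= (rk A).+1)%N.
Proof.
have -> : rk (t |: A) = \rank (span A + v t)%MS.
  apply/eqmx_rank/andP; split.
    apply: span_sub => i; rewrite !inE => /orP[/eqP->|iA]; first exact: addsmxSr.
    exact: submx_trans (span_sup iA) (addsmxSl _ _).
  rewrite addsmx_sub spanS ?subsetUr //= span_sup // !inE eqxx //.
apply: leq_trans (mxrank_adds_leqif _ _) _.
by have := rank_leq_row (v t); rewrite -/(rk A); arith.
Qed.

(** The functional exposing [A] is pushed along an [f] that vanishes on [A] and at one more index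
    [t] of [B], but not on all of [B]; such an [f] exists because the rank gap exceeds one. A new
    zero in [B] is gained while the value at [t] stays positive. *)
Lemma isface_mid A B : isface A -> isface B -> A \proper B -> ((rk A).+1 < rk B)%N ->
  exists C, [/\ isface C, A \proper C & C \proper B].
Proof.
move=> FA FB /properP[sAB [t tB tA]] hr.
have [w w0 w1] := isface_pos FA.
have [t1 t1B nt1] : exists2 t1, t1 \in B & ~~ (v t1 <= span (t |: A))%MS.
  case: (pickP (fun t1 => (t1 \in B) && ~~ (v t1 <= span (t |: A))%MS)) => [t1 /andP[]|h].
    by exists t1.
  have : (span B <= span (t |: A))%MS.
    by apply: span_sub => i iB; move: (h i); rewrite iB => /negbFE.
  by move/mxrankS => h2; have := leq_trans h2 (rk_setU1 A t); rewrite leqNgt hr.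
have [f fU ft1] := ev_separate nt1.
have f0 i : i \in t |: A -> ev f i = 0 by move=> iA; apply: ev_kill fU; apply: span_sup.
have hw i : i \in B -> 0 <= ev w i.
  by move=> _; case: (boolP (i \in A)) => [/w0->//|/w1/ltW].
have [tau [t' [h1 t'B ft' e]]] := push hw t1B ft1.
pose C := [set i in B | ev (w - tau *: f) i == 0]; exists C; split.
- by apply: (isface_in FB h1) => i; rewrite inE.
- apply/properP; split; last exists t'; first 1 last.
  + by rewrite inE t'B e eqxx.
  + by apply/negP => h; move: ft'; rewrite f0 ?ltxx // inE h orbT.
  + apply/subsetP => i iA; rewrite inE (subsetP sAB) // evB evZ w0 // f0 ?inE ?iA ?orbT //.
    by rewrite mulr0 subr0 eqxx.
- apply/properP; split; first by apply/subsetP => i; rewrite inE => /andP[].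
  exists t => //; rewrite inE tB evB evZ f0 ?inE ?eqxx //= mulr0 subr0.
  by rewrite gt_eqF // w1.
Qed.

(** The functional exposing [A] is pushed along the one exposing [C]. Nothing changes on [C], so all
    new zeros lie outside [C]. *)
Lemma isface_compl A B C : isface A -> isface B -> isface C -> A \proper C -> C \proper B ->
  exists D, [/\ isface D, A \proper D, D \proper B & C :&: D = A].
Proof.
move=> FA FB FC /properP[sAC [p pC pA]] /properP[sCB [q qB qC]].
have [w w0 w1] := isface_pos FA; have [f f0 f1] := isface_pos FC.
have hf i : 0 <= ev f i by case: (boolP (i \in C)) => [/f0->//|/f1/ltW].
have hw i : 0 <= ev w i by case: (boolP (i \in A)) => [/w0->//|/w1/ltW].
have nA i : i \notin C -> i \notin A by apply: contra; apply/subsetP.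
have [||tau [t' [h1 t'B ft' e]]] := @push B w f q _ qB; [by move=> i _ | exact: f1 |].
have t'C : t' \notin C by apply/negP => /f0 h; rewrite h ltxx in ft'.
pose D := [set i in B | ev (w - tau *: f) i == 0]; exists D; split.
- by apply: (isface_in FB h1) => i; rewrite inE.
- apply/properP; split; last by exists t'; [rewrite inE t'B e eqxx | apply: nA].
  apply/subsetP => i iA; have iC := subsetP sAC i iA.
  by rewrite inE (subsetP sCB) // evB evZ w0 // f0 //= mulr0 subr0.
- apply/properP; split; first by apply/subsetP => i; rewrite inE => /andP[].
  exists p; first exact: (subsetP sCB).
  by rewrite inE evB evZ f0 // mulr0 subr0 negb_and gt_eqF ?orbT // w1.
- apply/setP => i; rewrite !inE evB evZ; case: (boolP (i \in C)) => iC /=; last first.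
    by apply/esym/negbTE/nA.
  rewrite f0 // mulr0 subr0 (subsetP sCB) //=.
  by case: (boolP (i \in A)) => iA; [rewrite w0 // eqxx | rewrite gt_eqF // w1].
Qed.

Lemma faces_graded : graded isface rk.
Proof.
split; [exact: isfaceI | by move=> A B FA _; apply: rk_strict | exact: isface_mid |].
by move=> A B C FA FB FC; apply: isface_compl.
Qed.

(** The source of the lower bounds on ranks: the functionals [g j] kill the span of [A] and map the
    span of [B] onto a space of dimension #|S|, since no nontrivial combination of them vanishes on
    [B]. *)
Lemma rk_indep (J : finType) (S : {set J}) (g : J -> 'cV[R]_n) A B : A \subset B ->
  (forall i j, i \in A -> j \in S -> ev (g j) i = 0) ->
  (forall a : J -> R, (forall i, i \in B -> \sum_(j in S) a j * ev (g j) i = 0) ->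
     forall j, j \in S -> a j = 0) ->
  (rk A + #|S| <= rk B)%N.
Proof.
move=> sAB gA ind.
pose N : 'M[R]_(n, #|S|) := \matrix_(i, k) g (enum_val k) i 0.
have colN k : col k N = g (enum_val k).
  by apply/matrixP => i j; rewrite !mxE ord1.
have full : row_full (span B *m N).
  rewrite -cokermx_eq0; apply/eqP/matrixP => a b; rewrite [RHS]mxE.
  set u := cokermx _.
  have hu : span B *m N *m u = 0 by exact: mulmx_coker.
  (* A column of the cokernel, read as a family of coefficients indexed by [J]. *)
  pose c j := \sum_k (if enum_val k == j then u k b else 0).
  have ck k : c (enum_val k) = u k b.
    rewrite /c (bigD1 k) //= eqxx big1 ?addr0 // => l nl.
    by rewrite (inj_eq enum_val_inj) (negbTE nl).
  rewrite -ck; apply: ind (enum_valP a) => i iB.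
  have e : span B *m (N *m col b u) = 0.
    by rewrite mulmxA -col_mulmx hu; apply/matrixP => i' j'; rewrite !mxE.
  have := ev_kill (span_sup iB) e; rewrite /ev mulmxA mxE; apply: etrans.
  rewrite big_enum_val /=; apply: eq_bigr => k _; rewrite ck mulrC; congr (_ * _).
    by rewrite /ev -(colN k) -col_mulmx mxE.
  by rewrite [RHS]mxE.
have := mxrank_mul_ker (span B) N; rewrite (eqP full) /rk => <-.
rewrite addnC leq_add2l; apply: mxrankS; rewrite sub_capmx spanS //=.
apply: span_sub => i iA; rewrite sub_kermx; apply/eqP/matrixP => a k.
have := gA i (enum_val k) iA (enum_valP k); rewrite -(colN k) /ev -col_mulmx mxE.
by rewrite ord1 => ->; rewrite mxE.
Qed.

End IndexFaces.

(** * Unconditional polytopes *)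

Section Unconditional.
Variables (R : realFieldType) (n : nat) (T : finType) (v : T -> 'rV[R]_n).
Implicit Types (A B C I : {set T}) (K S : {set 'I_n}) (c w f : 'cV[R]_n).

Local Notation ev := (ev v).
Local Notation isface := (isface v).
Local Notation rk := (rk v).
Local Notation ch := (ch isface).
Local Notation cov := (cov isface).

Definition flip S (x : 'rV[R]_n) : 'rV[R]_n :=
  \row_k (if k \in S then - x 0 k else x 0 k).

Definition crd (j : 'I_n) : 'cV[R]_n := delta_mx j 0.

Lemma ev_crd j i : ev (crd j) i = v i 0 j.
Proof. by rewrite !ev_mulmx -colE mxE. Qed.

Lemma ev_flip S w i i' : v i' = flip S (v i) ->
  ev w i' = ev w i - 2 * \sum_(k in S) v i 0 k * w k 0.
Proof.
move=> e; rewrite !evE e (bigID (mem S)) [X in _ = X - _](bigID (mem S)) /=.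
have -> : \sum_(k in S) flip S (v i) 0 k * w k 0 = - \sum_(k in S) v i 0 k * w k 0.
  by rewrite -sumrN; apply: eq_bigr => k kS; rewrite mxE kS mulNr.
have -> : \sum_(k | k \notin S) flip S (v i) 0 k * w k 0 = \sum_(k | k \notin S) v i 0 k * w k 0.
  by apply: eq_bigr => k kS; rewrite mxE (negbTE kS).
by ring.
Qed.

Lemma ev_flip1 j w i i' : v i' = flip [set j] (v i) ->
  ev w i' = ev w i - 2 * (v i 0 j * w j 0).
Proof. by move/(ev_flip w); rewrite big_set1. Qed.

(* The face interval [A, B] looks like the face lattice of an unconditional
   polytope in the coordinates K: dividing by c turns the points of B outside A
   into such a polytope, up to the span of A. *)
Record box A B K c : Prop := Box {
  boxA : isface A; boxB : isface B; boxAB : A \proper B;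
  box0 : forall i, i \in A -> ev c i = 0;
  box_gt0 : forall i, i \in B -> i \notin A -> 0 < ev c i;
  box_c : forall j, j \in K -> c j 0 = 0;
  box_coord0 : forall i j, i \in A -> j \in K -> v i 0 j = 0;
  box_coord : forall j, j \in K -> exists2 i, i \in B & v i 0 j != 0;
  box_flip : forall S i, S \subset K -> i \in B -> exists2 i', i' \in B & v i' = flip S (v i);
  box_rk : rk B = (rk A + #|K|.+1)%N }.

(** Reflection in [j] changes the value of [w] at a point by twice the product of the two [j]-th
    coordinates. *)
Lemma flip_coef0 B j w : (exists2 i, i \in B & v i 0 j != 0) ->
  (forall i, i \in B -> exists2 i', i' \in B & v i' = flip [set j] (v i)) ->
  (forall i, i \in B -> ev w i = 0) -> w j 0 = 0.
Proof.
move=> [i iB ij] /(_ i iB)[i' i'B e] w0.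
have := ev_flip1 w e; rewrite !w0 // sub0r => /esym/eqP.
by rewrite oppr_eq0 mulf_eq0 pnatr_eq0 /= mulf_eq0 (negbTE ij) /= => /eqP.
Qed.

(** The functional [c] and the coordinates in [K] vanish on [A]. By [flip_coef0] a combination of
    them that vanishes on [B] involves no coordinate of [K], and what remains is a multiple of
    [c]. *)
Lemma box_rk_le A B K c : A \subset B ->
  (forall i, i \in A -> ev c i = 0) -> (exists2 i, i \in B & ev c i != 0) ->
  (forall j, j \in K -> c j 0 = 0) -> (forall i j, i \in A -> j \in K -> v i 0 j = 0) ->
  (forall j, j \in K -> exists2 i, i \in B & v i 0 j != 0) ->
  (forall S i, S \subset K -> i \in B -> exists2 i', i' \in B & v i' = flip S (v i)) ->
  (rk A + #|K|.+1 <= rk B)%N.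
Proof.
move=> sAB h0 [t tB ct] hc hA hB hf.
pose S := None |: [set Some j | j in K].
have -> : #|K|.+1 = #|S|.
  rewrite cardsU1 card_imset; last by move=> ? ? [].
  by rewrite (_ : None \notin _) //; apply/imsetP => -[].
pose g o := if o is Some j then crd j else c.
apply: (@rk_indep _ _ _ _ _ _ g) => // [i o iA|a ha].
  by rewrite !inE => /orP[/eqP->/=|/imsetP[j jK ->]]; [exact: h0 | rewrite ev_crd hA].
pose w := a None *: c + \sum_(j in K) a (Some j) *: crd j.
have wE i : ev w i = \sum_(o in S) a o * ev (g o) i.
  rewrite /S big_setU1 /=; last by apply/imsetP => -[].
  rewrite big_imset /=; last by move=> ? ? _ _ [].
  rewrite evD evZ; congr (_ + _); rewrite !ev_mulmx mulmx_sumr summxE.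
  by apply: eq_bigr => j _; rewrite -scalemxAr mxE.
have w0 i : i \in B -> ev w i = 0 by move=> iB; rewrite wE ha.
have wj j : j \in K -> w j 0 = a (Some j).
  move=> jK; rewrite !mxE hc // mulr0 add0r summxE (bigD1 j) //= big1.
    by rewrite !mxE !eqxx mulr1 addr0.
  by move=> l /andP[_ nl]; rewrite !mxE eq_sym (negbTE nl) mulr0.
have aS j : j \in K -> a (Some j) = 0.
  move=> jK; rewrite -wj //; apply: (flip_coef0 (hB j jK) _ w0) => i iB.
  by apply: hf; rewrite ?sub1set.
have aN : a None = 0.
  have := w0 t tB; rewrite evD evZ big1 ?ev0 ?addr0.
    by move/eqP; rewrite mulf_eq0 (negbTE ct) orbF => /eqP.
  by move=> j jK; rewrite aS // scale0r.
by move=> o; rewrite !inE => /orP[/eqP->//|/imsetP[j jK ->]]; exact: aS.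
Qed.

(** * Cutting a box at the face where a signed coordinate is maximal *)

Section Split.
Variables (A B : {set T}) (K : {set 'I_n}) (c : 'cV[R]_n).
Hypothesis bx : box A B K c.

(** The maximum of the [j]-th coordinate after division by [c]. It is positive since some point has
    a nonzero [j]-th coordinate and its reflection has the opposite one. *)
Lemma box_max j : j \in K -> exists alpha : R, [/\ 0 < alpha,
  forall i, i \in B -> v i 0 j <= alpha * ev c i &
  exists i, [/\ i \in B, i \notin A & v i 0 j = alpha * ev c i]].
Proof.
move=> jK; have [i0 i0B i0j] := box_coord bx jK.
have i0A : i0 \notin A by apply: contra i0j => iA; rewrite (box_coord0 bx iA jK).
pose P i := (i \in B) && (i \notin A).
have P0 : P i0 by rewrite /P i0B.
case: (arg_maxP (P := P) (fun i => v i 0 j / ev c i) P0) => t /andP[tB tA] tmax.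
exists (v t 0 j / ev c t).
have le i : i \in B -> v i 0 j <= v t 0 j / ev c t * ev c i.
  move=> iB; case: (boolP (i \in A)) => iA.
    by rewrite (box_coord0 bx iA jK) (box0 bx iA) mulr0.
  by rewrite -ler_pdivrMr ?(box_gt0 bx) //; apply: tmax; rewrite /P iB iA.
split=> //; last by exists t; split=> //; rewrite divfK // gt_eqF // (box_gt0 bx).
have [i1 i1B e1] := box_flip bx (etrans (sub1set _ _) jK) i0B.
have c1 : ev c i1 = ev c i0 by rewrite (ev_flip1 c e1) (box_c bx jK) !mulr0 subr0.
have := le i0 i0B; have := le i1 i1B; rewrite e1 mxE !inE eqxx c1.
have := box_gt0 bx i0B i0A; move: i0j; clear.
set x := v i0 0 j; set a := v t 0 j / _; set q := ev c i0 => x0 q0 h1 h2.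
have : 0 <= a * q by lra.
rewrite pmulr_lge0 // le_eqVlt => /orP[/eqP e|//].
by move: x0 h1 h2; rewrite -e mul0r oppr_le0 => /negP n0 h1 h2; case: n0; rewrite eq_le h1 h2.
Qed.

Variable alpha : 'I_n -> R.
Hypothesis alpha_max : forall j, j \in K -> [/\ 0 < alpha j,
  forall i, i \in B -> v i 0 j <= alpha j * ev c i &
  exists i, [/\ i \in B, i \notin A & v i 0 j = alpha j * ev c i]].

(** The face on which coordinate [j] with sign [s] is maximal. [topc] exposes it in [B]; [topK] and
    [topJ] collect the other coordinates of [K] that are, respectively, not identically zero and
    identically zero on it. *)
Definition top j (s : bool) : {set T} :=
  [set i in B | v i 0 j == (-1) ^+ s * (alpha j * ev c i)].
Definition topc j (s : bool) := alpha j *: c - (-1) ^+ s *: crd j.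
Definition topK j s := [set l in K :\ j | [exists i in top j s, v i 0 l != 0]].
Definition topJ j s := (K :\ j) :\: topK j s.

Lemma ev_topc j s i : ev (topc j s) i = alpha j * ev c i - (-1) ^+ s * v i 0 j.
Proof. by rewrite /topc evB !evZ ev_crd. Qed.

Lemma topc_ge0 j s i : j \in K -> i \in B -> 0 <= ev (topc j s) i.
Proof.
move=> jK iB; rewrite ev_topc subr_ge0; case: s; last by rewrite mul1r; case: (alpha_max jK) => _ ->.
have [i1 i1B e1] := box_flip bx (etrans (sub1set _ _) jK) iB.
have [_ /(_ _ i1B)] := alpha_max jK.
by rewrite e1 mxE !inE eqxx (ev_flip1 c e1) (box_c bx jK) !mulr0 subr0 mulN1r.
Qed.

Lemma mem_top j s i : (i \in top j s) = (i \in B) && (ev (topc j s) i == 0).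
Proof.
rewrite inE ev_topc subr_eq0; case: (i \in B) => //=.
by rewrite eq_sym -(inj_eq (mulrI (unitr1 R))) !mul1r; case: s; rewrite ?expr0 ?expr1 ?mul1r ?mulN1r // eqr_oppLR.
Qed.

Lemma top_face j s : j \in K -> isface (top j s).
Proof.
by move=> jK; apply: (isface_in (boxB bx) _ (mem_top j s)) => i; exact: topc_ge0.
Qed.

Lemma top_subB j s : top j s \subset B.
Proof. by apply/subsetP => i; rewrite inE => /andP[]. Qed.

Lemma topA j s : j \in K -> A \proper top j s.
Proof.
move=> jK; have sAB := proper_sub (boxAB bx).
apply/properP; split.
  apply/subsetP => i iA; rewrite inE (subsetP sAB) // (box_coord0 bx iA jK) (box0 bx iA).
  by rewrite !mulr0 eqxx.
have [_ _ [i [iB iA e]]] := alpha_max jK.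
case: s; last by exists i => //; rewrite inE iB e mul1r eqxx.
have [i1 i1B e1] := box_flip bx (etrans (sub1set _ _) jK) iB.
have c1 : ev c i1 = ev c i by rewrite (ev_flip1 c e1) (box_c bx jK) !mulr0 subr0.
exists i1; first by rewrite inE i1B e1 mxE inE eqxx e c1 mulN1r eqxx.
apply/negP => i1A; have := box0 bx i1A; rewrite c1 => h.
by have := box_gt0 bx iB iA; rewrite h ltxx.
Qed.

Lemma topB j s : j \in K -> top j s \proper B.
Proof.
move=> jK; rewrite properE top_subB /=; apply/negP => /subsetP h.
have [a0 _ [i [iB iA e]]] := alpha_max jK.
have := h _ iB; rewrite inE => /andP[_ /eqP e1].
have [i1 i1B e2] := box_flip bx (etrans (sub1set _ _) jK) iB.
have := h _ i1B; rewrite inE => /andP[_ /eqP].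
rewrite (ev_flip1 c e2) (box_c bx jK) !mulr0 subr0 -e1 e2 mxE inE eqxx e.
have : 0 < alpha j * ev c i by rewrite mulr_gt0 // (box_gt0 bx).
by move=> h1 h2; lra.
Qed.

Lemma top_flip j s S i : j \in K -> S \subset K :\ j -> i \in top j s ->
  exists2 i', i' \in top j s & v i' = flip S (v i).
Proof.
move=> jK sS; rewrite inE => /andP[iB e].
have sSK : S \subset K by apply: subset_trans sS (subD1set _ _).
have jS : j \notin S by apply/negP => /(subsetP sS); rewrite !inE eqxx.
have [i1 i1B e1] := box_flip bx sSK iB; exists i1 => //.
rewrite inE i1B e1 mxE (negbTE jS) (ev_flip c e1) big1 ?mulr0 ?subr0 //.
by move=> k kS; rewrite (box_c bx (subsetP sSK _ kS)) mulr0.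
Qed.

Lemma topK_sub j s : topK j s \subset K :\ j.
Proof. by apply/subsetP => l; rewrite inE => /andP[]. Qed.

Lemma top_coord0 j s i l : l \in topJ j s -> i \in top j s -> v i 0 l = 0.
Proof.
rewrite in_setD => /andP[+ lK] iX; rewrite inE lK /= negb_exists => /forallP/(_ i).
by rewrite iX negbK => /eqP.
Qed.

Lemma card_topKJ j s : j \in K -> (#|topK j s| + #|topJ j s|).+1 = #|K|.
Proof.
move=> jK; rewrite (cardsD1 j K) jK add1n; congr _.+1.
by rewrite -(cardsID (topK j s) (K :\ j)) (setIidPr (topK_sub j s)).
Qed.

Lemma topJ_sub j s : topJ j s \subset K :\ j. Proof. exact: subsetDl. Qed.

Lemma subD1 S j : S \subset K :\ j -> S \subset K.
Proof. by move=> h; apply: subset_trans h (subD1set _ _). Qed.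

Lemma topc_coord j s l : l \in K :\ j -> topc j s l 0 = 0.
Proof.
rewrite !inE => /andP[lj lK]; rewrite !mxE (box_c bx lK) (negbTE lj) /=.
by rewrite !mulr0 subr0.
Qed.

(** [box_rk_le] bounds both rank gaps from below. As #|topK| + #|topJ| + 1 = #|K|, the two bounds
    add up to the known gap between [A] and [B], so both are attained. *)
Lemma box_top_rk j s : j \in K ->
  rk (top j s) = (rk A + #|topK j s|.+1)%N /\ rk B = (rk (top j s) + #|topJ j s|.+1)%N.
Proof.
move=> jK; have sAB := proper_sub (boxAB bx).
have h1 : (rk A + #|topK j s|.+1 <= rk (top j s))%N.
  apply: (@box_rk_le _ _ _ c).
  - exact: proper_sub (topA s jK).
  - exact: box0 bx.
  - have /properP[_ [i iX iA]] := topA s jK; exists i => //.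
    by rewrite gt_eqF // (box_gt0 bx) // (subsetP (top_subB j s)).
  - by move=> l /(subsetP (subD1 (topK_sub j s))); apply: (box_c bx).
  - by move=> i l iA /(subsetP (subD1 (topK_sub j s))); apply: (box_coord0 bx).
  - by move=> l; rewrite inE => /andP[_ /existsP[i /andP[]]]; exists i.
  - by move=> S i sS; apply: top_flip => //; apply: subset_trans sS (topK_sub j s).
have h2 : (rk (top j s) + #|topJ j s|.+1 <= rk B)%N.
  apply: (@box_rk_le _ _ _ (topc j s)).
  - exact: top_subB.
  - by move=> i; rewrite mem_top => /andP[_ /eqP].
  - by have /properP[_ [i iB]] := topB s jK; rewrite mem_top iB /=; exists i.
  - by move=> l /(subsetP (topJ_sub j s)); apply: topc_coord.
  - by move=> i l iX lJ; apply: top_coord0 iX.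
  - by move=> l /(subsetP (subD1 (topJ_sub j s))); apply: (box_coord bx).
  - by move=> S i sS; apply: (box_flip bx); apply: subset_trans sS (subD1 (topJ_sub j s)).
have := box_rk bx; have := card_topKJ s jK; move: h1 h2; clear; split; lia.
Qed.

Lemma box_lower j s : j \in K -> box A (top j s) (topK j s) c.
Proof.
move=> jK; split.
- exact: boxA bx.
- exact: top_face.
- exact: topA.
- exact: box0 bx.
- by move=> i; rewrite inE => /andP[iB _]; exact: (box_gt0 bx).
- by move=> l /(subsetP (subD1 (topK_sub j s))); apply: (box_c bx).
- by move=> i l iA /(subsetP (subD1 (topK_sub j s))); apply: (box_coord0 bx).
- by move=> l; rewrite inE => /andP[_ /existsP[i /andP[]]]; exists i.
- by move=> S i sS; apply: top_flip => //; apply: subset_trans sS (topK_sub j s).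
- by case: (box_top_rk s jK).
Qed.

Lemma box_upper j s : j \in K -> box (top j s) B (topJ j s) (topc j s).
Proof.
move=> jK; split.
- exact: top_face.
- exact: boxB bx.
- exact: topB.
- by move=> i; rewrite mem_top => /andP[_ /eqP].
- by move=> i iB; rewrite mem_top iB /= lt_def => -> /=; apply: topc_ge0.
- by move=> l /(subsetP (topJ_sub j s)); apply: topc_coord.
- by move=> i l iX lJ; apply: top_coord0 iX.
- by move=> l /(subsetP (subD1 (topJ_sub j s))); apply: (box_coord bx).
- by move=> S i sS; apply: (box_flip bx); apply: subset_trans sS (subD1 (topJ_sub j s)).
- by case: (box_top_rk s jK).
Qed.

(** Faces for opposite signs of one coordinate share no index outside [A]. For different
    coordinates, the functional [w] exposing [y] has no [j1]-coordinate, because the second face may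
    be reflected in [j1]. A modification of [w] then yields one functional more, independent on [B]
    and zero on the first face, than the rank of [B] over that face allows. *)
Lemma top_disjoint x y j1 s1 j2 s2 : j1 \in K -> j2 \in K ->
  cov A x -> isface y -> y \proper B ->
  x \subset top j1 s1 -> top j1 s1 \subset y -> x \subset top j2 s2 -> top j2 s2 \subset y ->
  (j1, s1) = (j2, s2).
Proof.
move=> jK1 jK2 cx Fy pyB sx1 s1y sx2 s2y.
have /properP[_ [p px pA]] := cov_proper cx.
have p1 := subsetP sx1 _ px; have p2 := subsetP sx2 _ px.
have pB : p \in B by move: p1; rewrite inE => /andP[].
have cp := box_gt0 bx pB pA.
have e1 : v p 0 j1 = (-1) ^+ s1 * (alpha j1 * ev c p) by move: p1; rewrite inE => /andP[_ /eqP].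
have e2 : v p 0 j2 = (-1) ^+ s2 * (alpha j2 * ev c p) by move: p2; rewrite inE => /andP[_ /eqP].
have [a1 _ _] := alpha_max jK1; have [a2 _ _] := alpha_max jK2.
have [ej|nj] := eqVneq j1 j2.
  congr (_, _) => //; move: e2; rewrite -ej e1; have : 0 < alpha j1 * ev c p by rewrite mulr_gt0.
  by case: (s1) (s2) => -[]; rewrite ?mul1r ?mulN1r // => h1 h2; exfalso; lra.
exfalso; have [w w0 w1] := isface_pos Fy.
have wj j j' s' : j \in K -> j' \in K -> j != j' -> v p 0 j != 0 -> p \in top j' s' -> top j' s' \subset y -> w j 0 = 0.
  move=> jK j'K njj' pj px' sy.
  have sj : [set j] \subset K :\ j' by rewrite sub1set !inE njj'.
  have [p' p'X e] := top_flip j'K sj px'.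
  have := ev_flip1 w e; rewrite !w0 ?(subsetP sy) // sub0r => /esym/eqP.
  by rewrite oppr_eq0 mulf_eq0 pnatr_eq0 /= mulf_eq0 (negbTE pj) => /eqP.
have nz j s : j \in K -> v p 0 j = (-1) ^+ s * (alpha j * ev c p) -> v p 0 j != 0.
  by move=> jK ->; case: (alpha_max jK) => a0 _ _; rewrite mulf_neq0 ?signr_eq0 // mulf_neq0 ?gt_eqF.
have wj1 : w j1 0 = 0 by apply: (wj j1 j2 s2) => //; apply: nz e1.
set J := topJ j1 s1; set X := top j1 s1 in s1y *.
(* The [J]-coordinates of [w] are removed, which makes it independent of the functionals [crd l]
   with [l] in [J]. *)
pose w' := w - \sum_(l in J) w l 0 *: crd l.
have ew' i : ev w' i = ev w i - \sum_(l in J) v i 0 l * w l 0.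
  rewrite evB; congr (_ - _); rewrite !ev_mulmx mulmx_sumr summxE; apply: eq_bigr => l _.
  by rewrite -scalemxAr mxE -(ev_crd l i) mulrC.
have sJK := subD1 (topJ_sub j1 s1).
have [q qB qy] : exists2 q, q \in B & q \notin y by case/properP: pyB.
have [q' q'B eq'] := box_flip bx sJK qB.
have wpos i : 0 <= ev w i by case: (boolP (i \in y)) => [/w0->//|/w1/ltW].
(* w' cannot vanish on B: otherwise w would change sign under the flip of J. *)
have w'n : ev w' q != 0 \/ ev w' q' != 0.
  case: (eqVneq (ev w' q) 0) => [h|]; [right | by left]; apply/eqP => h'.
  have := wpos q'; move: h; rewrite (ev_flip w eq') ew' => h.
  have := w1 _ qy; move: h; set s := \sum_(l in J) _ => h h2 h3; lra.
have [r rB w'r] : exists2 r, r \in B & ev w' r != 0 by case: w'n; [exists q|exists q'].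
have w'X i : i \in X -> ev w' i = 0.
  move=> iX; rewrite ew' w0 ?(subsetP s1y) // big1 ?subr0 // => l lJ.
  by rewrite (top_coord0 lJ iX) mul0r.
have w'l l : l \in J -> w' l 0 = 0.
  move=> lJ; rewrite !mxE summxE (bigD1 l) //= !mxE !eqxx mulr1 big1 ?addr0 ?subrr //.
  by move=> k /andP[_ nk]; rewrite !mxE eq_sym (negbTE nk) mulr0.
have j1J : j1 \notin J by apply/negP => /(subsetP (topJ_sub j1 s1)); rewrite !inE eqxx.
have w'j1 : w' j1 0 = 0.
  rewrite !mxE wj1 summxE big1 ?subr0 // => k kJ.
  have nk : (j1 == k) = false by apply/negP => /eqP e; rewrite e kJ in j1J.
  by rewrite !mxE nk mulr0.
(* Labels of #|J| + 2 functionals: [None] for [w'], [Some None] for [topc j1 s1], the others for the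
   coordinates in [J]. *)
pose S := None |: (Some None |: [set Some (Some l) | l in J]).
have n2 : Some None \notin [set Some (Some l) | l in J] by apply/imsetP => -[].
have n1 : None \notin Some None |: [set Some (Some l) | l in J].
  by rewrite in_setU1 /=; apply/imsetP => -[].
have cS : #|S| = #|J|.+2.
  by rewrite !cardsU1 n1 n2 card_imset // => ? ? [].
pose g o := if o is Some o' then (if o' is Some l then crd l else topc j1 s1) else w'.
have : (rk X + #|S| <= rk B)%N.
  apply: (@rk_indep _ _ _ _ _ _ g); first exact: top_subB.
    move=> i o iX; rewrite !in_setU1 => /or3P[/eqP->|/eqP->|/imsetP[l lJ ->]] /=.
    - exact: w'X.
    - by move: iX; rewrite mem_top => /andP[_ /eqP].
    - by rewrite ev_crd (top_coord0 lJ iX).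
  move=> a ha.
  pose u := a None *: w' + (a (Some None) *: topc j1 s1 + \sum_(l in J) a (Some (Some l)) *: crd l).
  have uE i : ev u i = \sum_(o in S) a o * ev (g o) i.
    rewrite /S big_setU1 //= big_setU1 //=.
    rewrite big_imset /=; last by move=> ? ? _ _ [].
    rewrite /u evD evZ [ev (a (Some None) *: _ + _) i]evD evZ; congr (_ + (_ + _)).
    rewrite !ev_mulmx mulmx_sumr summxE; apply: eq_bigr => j _; by rewrite -scalemxAr mxE.
  have u0 i : i \in B -> ev u i = 0 by move=> iB; rewrite uE ha.
  have uj j : j \in K -> u j 0 = 0.
    move=> jK; apply: (flip_coef0 (box_coord bx jK) _ u0) => i iB.
    by apply: (box_flip bx); rewrite ?sub1set.
  have uE1 : u j1 0 = - (-1) ^+ s1 * a (Some None).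
    rewrite /u 2!mxE w'j1 mulr0 add0r !mxE summxE big1 ?addr0; last first.
      move=> k kJ; have nk : (j1 == k) = false by apply/negP => /eqP e; rewrite e kJ in j1J.
      by rewrite !mxE nk mulr0.
    by rewrite (box_c bx jK1) !eqxx mulr0 mulr1 sub0r mulrN mulrC mulNr.
  have aN : a (Some None) = 0.
    move: uE1; rewrite uj // => /esym/eqP; rewrite mulf_eq0 oppr_eq0 signr_eq0 /= => /eqP//.
  have al l : l \in J -> a (Some (Some l)) = 0.
    move=> lJ; have := uj l (subsetP sJK _ lJ).
    rewrite /u 2!mxE w'l // mulr0 add0r aN scale0r 2!mxE add0r summxE (bigD1 l) //= !mxE !eqxx.
    rewrite mulr1 big1 ?addr0 // => k /andP[_ nk].
    by rewrite !mxE eq_sym (negbTE nk) mulr0.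
  have a0 : a None = 0.
    have := u0 r rB; rewrite /u evD evZ [ev (a (Some None) *: _ + _) r]evD evZ aN mul0r add0r big1 ?ev0 ?addr0.
      by move/eqP; rewrite mulf_eq0 (negbTE w'r) orbF => /eqP.
    by move=> l lJ; rewrite al // scale0r.
  move=> o; rewrite !in_setU1 => /or3P[/eqP->|/eqP->|/imsetP[l lJ ->]] //.
  exact: al.
have [_ h] := box_top_rk s1 jK1; rewrite cS; move: h; rewrite -/X -/J; clear; lia.
Qed.

End Split.

Lemma box_alpha A B K c : box A B K c -> exists alpha : 'I_n -> R, forall j, j \in K -> [/\ 0 < alpha j,
  forall i, i \in B -> v i 0 j <= alpha j * ev c i &
  exists i, [/\ i \in B, i \notin A & v i 0 j = alpha j * ev c i]].
Proof.
move=> bx; pose P j (a : R) := j \in K -> [/\ 0 < a,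
  forall i, i \in B -> v i 0 j <= a * ev c i &
  exists i, [/\ i \in B, i \notin A & v i 0 j = a * ev c i]].
have h j : exists a, P j a.
  rewrite /P; case: (boolP (j \in K)) => jK; last by exists 0.
  by have [a ha] := box_max bx jK; exists a.
by have [f hf] := fin_all_exists h; exists f => j; exact: hf.
Qed.

(** * The lower bound for boxes and its case of equality *)

Local Open Scope nat_scope.

Definition nflags k := 2 ^ k * k`!.

Lemma nflags_shuffle k l : 'C(k + l, k) * nflags k * nflags l = nflags (k + l).
Proof.
rewrite /nflags expnD -(bin_fact (leq_addr l k)) addKn; lia.
Qed.

Lemma nflags_pred k : 0 < k -> nflags k = 2 * k * nflags k.-1.
Proof. by case: k => // k _; rewrite /nflags expnS factS /=; lia. Qed.

Lemma sum_pairs_const (K : {set 'I_n}) (N : nat) :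
  \sum_(p : 'I_n * bool | p.1 \in K) N = 2 * #|K| * N.
Proof.
rewrite sum_nat_const; congr (_ * _).
rewrite (@eq_card _ _ (setX K [set: bool])) ?cardsX ?cardsT ?card_bool 1?mulnC //.
by move=> p; rewrite !inE andbT.
Qed.

(** The ranks in a box are known, so that the coefficient of [through_ge] becomes C(#|K| - 1, k), as
    [nflags_shuffle] requires. *)
Lemma box_through A B K c alpha j s : box A B K c -> 
  (forall j, j \in K -> [/\ (0 < alpha j)%R,
  forall i, i \in B -> (v i 0 j <= alpha j * ev c i)%R &
  exists i, [/\ i \in B, i \notin A & v i 0 j = alpha j * ev c i]%R]) -> j \in K ->
  let X := top B c alpha j s in
  let k := #|topK B K c alpha j s| in let l := #|topJ B K c alpha j s| in
  'C(rk B - (rk A).+2, rk X - (rk A).+1) * ch A X * ch X B <= through isface A X B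
  ?= iff [forall x : {set T}, forall y : {set T},
     (cov A x && (x \subset X)) ==> ([&& isface y, X \subset y & cov y B]) ==> (shuffles isface rk x X y == ch x y)]
  /\ 'C(rk B - (rk A).+2, rk X - (rk A).+1) = 'C(#|K|.-1, k) /\ k + l = #|K|.-1.
Proof.
move=> bx ha jK X k l.
have [r1 r2] := box_top_rk bx ha s jK; have cK := card_topKJ B c alpha s jK.
split; last split.
- apply: (through_ge (faces_graded v) (boxA bx) _ (boxB bx)).
  + exact: (top_face bx ha).
  + exact: (topA bx ha).
  + exact: (topB bx ha).
- congr 'C(_, _); move: r1 r2 cK; rewrite -/X -/k -/l; clear; lia.
- by move: cK; rewrite -/k -/l; clear; lia.
Qed.

Theorem box_flags A B K c : box A B K c -> nflags #|K| <= ch A B.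
Proof.
move: {2}#|K| (leqnn #|K|) => m hm; elim: m A B K c hm => [|m IH] A B K c hm bx.
  move: hm; rewrite leqn0 => /eqP->.
  by apply: (ch_gt0 (faces_graded v)); [exact: boxA bx | exact: boxB bx | exact: proper_sub (boxAB bx)].
have [K0|K0] := posnP #|K|.
  by apply: IH bx; rewrite K0.
have [alpha ha] := box_alpha bx.
pose X (p : 'I_n * bool) := top B c alpha p.1 p.2.
have r : (rk A).+1 < rk B by rewrite (box_rk bx); move: K0; clear; lia.
have [h _] := ch_ge_through (faces_graded v) (P := fun p : 'I_n * bool => p.1 \in K) (X := X)
  (boxA bx) (boxB bx) (boxAB bx) r
  (fun x y i j Pi Pj cx Fy cy s1 s2 s3 s4 =>
     let: e := @top_disjoint A B K c bx alpha ha x y i.1 i.2 j.1 j.2 Pi Pj cx Fy (cov_proper cy) s1 s2 s3 s4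
     in etrans (surjective_pairing i) (etrans e (esym (surjective_pairing j)))).
apply: leq_trans h.
have -> : nflags #|K| = \sum_(p : 'I_n * bool | p.1 \in K) nflags #|K|.-1.
  by rewrite sum_pairs_const -nflags_pred.
apply: leq_sum => -[j s] /= jK.
have [[h _] [eC ekl]] := box_through s bx ha jK; apply: leq_trans h.
rewrite eC -ekl -nflags_shuffle leq_mul ?leq_mul //.
- by apply: IH (box_lower bx ha s jK); move: ekl hm K0; clear; lia.
- by apply: IH (box_upper bx ha s jK); move: ekl hm K0; clear; lia.
Qed.

(** Both losses in [box_flags] must vanish: no comparable pair of an atom and a coatom is missed by
    the faces [top], and no pair around such a face has more chains than shuffles. *)
Theorem box_flags_eq A B K c alpha : box A B K c ->
  (forall j, j \in K -> [/\ (0 < alpha j)%R,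
  forall i, i \in B -> (v i 0 j <= alpha j * ev c i)%R &
  exists i, [/\ i \in B, i \notin A & v i 0 j = alpha j * ev c i]%R]) ->
  0 < #|K| -> ch A B = nflags #|K| ->
  (forall x y, cov A x -> isface y -> cov y B -> x \subset y ->
    exists j s, [/\ j \in K, x \subset top B c alpha j s & top B c alpha j s \subset y]) /\
  (forall j s x y, j \in K -> cov A x -> isface y -> cov y B ->
    x \subset top B c alpha j s -> top B c alpha j s \subset y ->
    shuffles isface rk x (top B c alpha j s) y = ch x y).
Proof.
move=> bx ha K0 e.
pose X (p : 'I_n * bool) := top B c alpha p.1 p.2.
have r : (rk A).+1 < rk B by rewrite (box_rk bx); move: K0; clear; lia.
have H1 := ch_ge_through (faces_graded v) (P := fun p : 'I_n * bool => p.1 \in K) (X := X)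
  (boxA bx) (boxB bx) (boxAB bx) r
  (fun x y i j Pi Pj cx Fy cy s1 s2 s3 s4 =>
     let: e := @top_disjoint A B K c bx alpha ha x y i.1 i.2 j.1 j.2 Pi Pj cx Fy (cov_proper cy) s1 s2 s3 s4
     in etrans (surjective_pairing i) (etrans e (esym (surjective_pairing j)))).
have eN : nflags #|K| = \sum_(p : 'I_n * bool | p.1 \in K) nflags #|K|.-1.
  by rewrite sum_pairs_const -nflags_pred.
have le1 (p : 'I_n * bool) : p.1 \in K -> nflags #|K|.-1 <= 
   'C(rk B - (rk A).+2, rk (X p) - (rk A).+1) * ch A (X p) * ch (X p) B.
  move=> jK; have [_ [eC ekl]] := box_through p.2 bx ha jK.
  rewrite eC -ekl -nflags_shuffle leq_mul ?leq_mul //.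
  - exact: box_flags (box_lower bx ha _ jK).
  - exact: box_flags (box_upper bx ha _ jK).
have le2 (p : 'I_n * bool) : p.1 \in K -> 
   'C(rk B - (rk A).+2, rk (X p) - (rk A).+1) * ch A (X p) * ch (X p) B <= through isface A (X p) B.
  by move=> jK; have [[h _] _] := box_through p.2 bx ha jK.
have S1 := leq_sum (index_enum _) le1; have S2 := leq_sum (index_enum _) le2.
move: S1; rewrite -eN -e => S1.
have [H1l H1e] := H1.
have E12 : \sum_(i | i.1 \in K) 'C(rk B - (rk A).+2, rk (X i) - (rk A).+1) * ch A (X i) * ch (X i) B
   = \sum_(i | i.1 \in K) through isface A (X i) B.
  by apply/eqP; rewrite eqn_leq S2 (leq_trans H1l S1).
split.
  have E : \sum_(i | i.1 \in K) through isface A (X i) B = ch A B.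
    by apply/eqP; rewrite eqn_leq H1l (leq_trans S1).
  move=> x y cx Fy cy sxy; move: H1e; rewrite E eqxx => /esym/forallP/(_ x)/forallP/(_ y).
  by rewrite cx Fy cy sxy => /existsP[[j s] /and3P[jK h1 h2]]; exists j, s.
move=> j s x y jK cx Fy cy s1 s2.
have [[_ h] _] := box_through s bx ha jK.
have := leq_sum_eq le2 E12 (i := (j, s)) jK; rewrite /X /= => e2.
move: h; rewrite e2 eqxx => /esym/forallP/(_ x)/forallP/(_ y).
by rewrite cx s1 Fy s2 cy => /eqP.
Qed.

End Unconditional.

(* From here on set0, setT, subset_trans, etc. without prefix are those of classical_sets. *)
From mathcomp Require Import classical_sets functions cardinality reals.
Local Open Scope classical_set_scope.
Local Open Scope ring_scope.

(** * Convex hulls, their faces and their flags *)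

Section Farkas.
Variables (R : realFieldType) (n : nat).

(* Bartl's algebraic proof: eliminate the last generator along a functional
   that violates the conclusion. *)
Lemma farkas_seq (T : eqType) (e : seq T) (v : T -> 'rV[R]_n) (z : 'rV[R]_n) : uniq e ->
  (forall w : 'cV[R]_n, (forall i, i \in e -> 0 <= (v i *m w) 0 0) -> 0 <= (z *m w) 0 0) ->
  exists l : T -> R, (forall i, 0 <= l i) /\ z = \sum_(i <- e) l i *: v i.
Proof.
elim: e v z => [|t e IH] v z /=.
  move=> _ h; exists (fun=> 0); split=> //; rewrite big_nil.
  apply/rowP => j; rewrite mxE; apply/eqP; rewrite eq_le -oppr_ge0.
  have h1 := h (delta_mx j 0) (fun i => _); have h2 := h (- delta_mx j 0) (fun i => _).
  move: h1 h2; rewrite mulmxN -colE !mxE => h1 h2.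
  by rewrite h1 ?h2.
move=> /andP[te ue] h.
case: (pselect (forall w : 'cV[R]_n, (forall i, i \in e -> 0 <= (v i *m w) 0 0) -> 0 <= (z *m w) 0 0)).
  move=> /(IH _ _ ue)[l [l0 ->]]; exists (fun i => if i == t then 0 else l i); split.
    by move=> i; case: ifP.
  rewrite big_cons eqxx scale0r add0r; apply: eq_big_seq => i ie.
  by case: eqP => // eit; rewrite -eit ie in te.
move=> /existsNP[w0 /not_implyP[w0e /negP]]; rewrite -ltNge => zw0.
have tw0 : (v t *m w0) 0 0 < 0.
  rewrite ltNge; apply/negP => tw; suff : 0 <= (z *m w0) 0 0 by rewrite leNgt zw0.
  by apply: h => i; rewrite in_cons => /predU1P[->//|/w0e].
pose tau := - (v t *m w0) 0 0; have tau0 : 0 < tau by rewrite oppr_gt0.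
pose pr (x : 'rV[R]_n) := x + ((x *m w0) 0 0 / tau) *: v t.
have prE x w : (pr x *m w) 0 0 = (x *m (w + ((v t *m w) 0 0 / tau) *: w0)) 0 0.
  rewrite /pr mulmxDl mulmxDr -scalemxAl -scalemxAr !mxE; congr (_ + _).
  rewrite [LHS]mulrAC [RHS]mulrAC; congr (_ / _); exact: mulrC.
have [|l [l0 e1]] := IH (fun i => pr (v i)) (pr z) ue.
  move=> w hw; rewrite prE; apply: h => i; rewrite in_cons => /predU1P[->|ie].
    rewrite mulmxDr -scalemxAr !mxE.
    set a := \sum_j _; set b := \sum_j _.
    have -> : b = - tau by rewrite /tau opprK mxE.
    by rewrite mulrN divfK ?gt_eqF // subrr.
  by rewrite -prE; apply: hw.
pose m := (\sum_(i <- e) l i * (v i *m w0) 0 0 - (z *m w0) 0 0) / tau.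
have m0 : 0 <= m.
  apply: divr_ge0; last exact: ltW.
  rewrite subr_ge0 (le_trans (ltW zw0)) // big_seq sumr_ge0 // => i ie.
  by rewrite mulr_ge0 // w0e.
exists (fun i => if i == t then m else l i); split; first by move=> i; case: ifP.
rewrite big_cons eqxx.
have -> : \sum_(i <- e) (if i == t then m else l i) *: v i = \sum_(i <- e) l i *: v i.
  apply: eq_big_seq => i ie; case: eqP => // eit; by rewrite -eit ie in te.
have : z = pr z - ((z *m w0) 0 0 / tau) *: v t by rewrite /pr addrK.
rewrite e1 /pr; under eq_bigr => i _ do rewrite scalerDr scalerA.
rewrite big_split /= -scaler_suml => ->.
have -> : \sum_(i <- e) l i * ((v i *m w0) 0 0 / tau) = (\sum_(i <- e) l i * (v i *m w0) 0 0) / tau.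
  by rewrite mulr_suml; apply: eq_bigr => i _; rewrite mulrA.
by rewrite /m mulrBl scalerBl -addrA addrC.
Qed.

Lemma farkas (T : finType) (v : T -> 'rV[R]_n) (z : 'rV[R]_n) :
  (forall w, nonneg v w -> 0 <= (z *m w) 0 0) ->
  exists l : T -> R, (forall i, 0 <= l i) /\ z = \sum_i l i *: v i.
Proof.
move=> h; apply: (@farkas_seq _ (index_enum T)); first exact: index_enum_uniq.
by move=> w hw; apply: h => i; apply: hw; exact: mem_index_enum.
Qed.

Lemma zeros_neqT (T : finType) (v : T -> 'rV[R]_n) (z : 'rV[R]_n) w :
  rk v [set: T]%SET = n -> (z *m w) 0 0 != 0 -> zeros v w != [set: T]%SET.
Proof.
move=> full; apply: contraNneq => eT.
have k : span v [set: T]%SET *m w = 0.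
  apply: span_kill => i _; apply/eqP.
  by have: i \in zeros v w by [rewrite eT finset.in_setT]; rewrite inE.
have rf : row_full (span v [set: T]%SET) by rewrite /row_full -/(rk v [set: T]%SET) full.
have := congr1 (mulmx (pinvmx (span v [set: T]%SET))) k.
by rewrite mulmxA mulVpmx // mul1mx mulmx0 => ->; rewrite mulmx0 mxE.
Qed.

(** The functional is pushed along an [f] that vanishes on its zeros and at [z]: the value at [z]
    stays negative while the zero set grows until it is a coatom. *)
Lemma facet_separate (T : finType) (v : T -> 'rV[R]_n) (z : 'rV[R]_n) w :
  rk v [set: T]%SET = n -> nonneg v w -> (z *m w) 0 0 < 0 ->
  exists w', [/\ nonneg v w', (z *m w') 0 0 < 0 & cov (isface v) (zeros v w') [set: T]%SET].
Proof.
move=> full; have [k hk] : exists k, (#|T| <= #|zeros v w| + k)%N by exists #|T|; lia.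
elim: k w hk => [|k IH] w hk hw zw; have nT := zeros_neqT full (ltr0_neq0 zw).
  by case/eqP: nT; apply/eqP; rewrite eqEcard finset.subsetT cardsT; move: hk; rewrite addn0.
have Fz : isface v (zeros v w) by apply/isfaceP; exists w.
have pz : zeros v w \proper [set: T]%SET by rewrite properT.
case: (leqP (rk v [set: T]%SET) (rk v (zeros v w)).+1) => hr.
  by exists w; split=> //; apply: (rk_cov (faces_graded v)) => //; exact: isface_setT.
(* The rank gap is at least two, so adding [z] does not yet span everything. *)
pose U := (span v (zeros v w) + z)%MS.
have [t tU] : exists t, ~~ (v t <= U)%MS.
  case: (pickP (fun t => ~~ (v t <= U)%MS)) => [t|h]; first by exists t.
  have : (span v [set: T]%SET <= U)%MS by apply: span_sub => i _; move: (h i) => /negbFE.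
  move/mxrankS; rewrite -/(rk v [set: T]%SET) => h1.
  have h2 := leq_of_leqif (mxrank_adds_leqif (span v (zeros v w)) z).
  have h3 := rank_leq_row z; move: hr h1 h2 h3; rewrite -/(rk v (zeros v w)) -/U.
  by clear; lia.
have [f fU ft] := ev_separate tU.
have f0 i : i \in zeros v w -> ev v f i = 0.
  by move=> iz; apply: ev_kill fU; apply: submx_trans (addsmxSl _ _); exact: span_sup.
have zf : (z *m f) 0 0 = 0.
  by have /submxP[D ->] : (z <= U)%MS := addsmxSr _ _; rewrite -mulmxA fU mulmx0 mxE.
have [tau [t' [h1 _ ft' e]]] := push (fun i _ => hw i) (finset.in_setT t) ft.
apply: (IH (w - tau *: f)).
- have : zeros v w \proper zeros v (w - tau *: f).
    apply/properP; split.
      apply/fintype.subsetP => i iz; rewrite inE evB evZ f0 // mulr0 subr0.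
      by move: iz; rewrite inE.
    exists t'; first by rewrite inE e.
    by apply/negP => /f0 h; rewrite h ltxx in ft'.
  by move/proper_card; move: hk; clear; lia.
- by move=> i; apply: h1; rewrite finset.in_setT.
- by rewrite mulmxBr -scalemxAr mxE [X in _ + X]mxE [X in _ - X]mxE zf mulr0 subr0.
Qed.

End Farkas.

(** * Homogeneous coordinates and hulls of finite families *)

Section Homogeneous.
Variables (R : realType) (d : nat).
Implicit Types (x y : 'rV[R]_d).

(** The point (1, x) of the cone over a polytope; [aff a y] is the affine functional a + <., y> seen
    on the cone. *)
Definition hvec x : 'rV[R]_(1 + d) := row_mx (1%:M : 'M_1) x.
Definition aff (a : R) y : 'cV[R]_(1 + d) := col_mx a%:M y^T.

Lemma dotpE x y : (x *m y^T) 0 0 = dotp x y.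
Proof. by rewrite mxE; apply: eq_bigr => i _; rewrite mxE. Qed.

Lemma hvec_aff x a y : (hvec x *m aff a y) 0 0 = a + dotp x y.
Proof. by rewrite mul_row_col mul1mx mxE mxE eqxx mulr1n dotpE. Qed.

Lemma affP (w : 'cV[R]_(1 + d)) : exists a y, w = aff a y.
Proof.
exists (usubmx w 0 0), (dsubmx w)^T; rewrite /aff trmxK -[LHS]vsubmxK; congr col_mx.
by apply/matrixP => i j; rewrite !ord1 [RHS]mxE eqxx mulr1n.
Qed.

Lemma dotpC x y : dotp x y = dotp y x.
Proof. by apply: eq_bigr => i _; rewrite mulrC. Qed.
Lemma dotpDl x y z : dotp (x + y) z = dotp x z + dotp y z.
Proof. by rewrite -big_split; apply: eq_bigr => i _; rewrite !mxE mulrDl. Qed.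
Lemma dotpZl a x y : dotp (a *: x) y = a * dotp x y.
Proof. by rewrite big_distrr; apply: eq_bigr => i _; rewrite mxE /= mulrA. Qed.
Lemma dotpDr x y z : dotp z (x + y) = dotp z x + dotp z y.
Proof. by rewrite dotpC dotpDl !(dotpC z). Qed.
Lemma dotpZr a x y : dotp y (a *: x) = a * dotp y x.
Proof. by rewrite dotpC dotpZl dotpC. Qed.
Lemma dotpNl x y : dotp (- x) y = - dotp x y.
Proof. by rewrite -scaleN1r dotpZl mulN1r. Qed.
Lemma dotpNr x y : dotp y (- x) = - dotp y x.
Proof. by rewrite dotpC dotpNl dotpC. Qed.
Lemma dotp0l x : dotp 0 x = 0.
Proof. by rewrite -(scale0r x) dotpZl mul0r. Qed.
Lemma dotp0r x : dotp x 0 = 0.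
Proof. by rewrite dotpC dotp0l. Qed.
Lemma dotp_suml (I : Type) (r : seq I) (P : pred I) (F : I -> 'rV[R]_d) y :
  dotp (\sum_(i <- r | P i) F i) y = \sum_(i <- r | P i) dotp (F i) y.
Proof. by elim/big_rec2: _ => [|i a b _ <-]; rewrite ?dotp0l // dotpDl. Qed.
Lemma dotp_delta x j : dotp x (delta_mx 0 j) = x 0 j.
Proof.
rewrite /dotp (bigD1 j) //= mxE !eqxx mulr1 big1 ?addr0 // => i ni.
by rewrite mxE (negbTE ni) andbF mulr0.
Qed.

Section Conv.
Variables (T : finType) (s : T -> 'rV[R]_d).
Implicit Types I J : {set T}.

Definition hom (i : T) := hvec (s i).
Definition conv I : set 'rV[R]_d := convex_hull [set s i | i in [set` I]].

Lemma convP I x : conv I x <-> exists l : T -> R,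
  [/\ forall i, 0 <= l i, forall i, i \notin I -> l i = 0, \sum_i l i = 1 & x = \sum_i l i *: s i].
Proof.
split=> [[n [p [w [hp w0 w1 ->]]]]|[l [l0 lI l1 ->]]].
  have H (k : 'I_n) : exists i, i \in I /\ s i = p k by have [i iI e] := hp k; exists i.
  have [h hh] := boolp.choice H.
  exists (fun i => \sum_(k | h k == i) w k); split.
  - by move=> i; apply: sumr_ge0.
  - move=> i iI; rewrite big_pred0 // => k; apply/negbTE; apply: contra iI => /eqP <-.
    by case: (hh k).
  - by rewrite -w1 (partition_big h xpredT).
  - rewrite (partition_big h xpredT) //=; apply: eq_bigr => i _.
    rewrite scaler_suml; apply: eq_bigr => k /eqP <-; by case: (hh k) => _ ->.
pose m := #|I|; have e (V : zmodType) (F : T -> V) : (forall i, i \notin I -> F i = 0) ->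
   \sum_i F i = \sum_(k < m) F (enum_val k).
  move=> F0; by rewrite -big_enum_val [LHS](bigID (mem I)) /= [X in _ + X]big1 ?addr0.
hnf; exists m, (fun k => s (enum_val k)), (fun k => l (enum_val k)); split=> //.
- by move=> k; exists (enum_val k) => //=; exact: enum_valP.
- by rewrite -l1 -(e R).
- by rewrite (e _ (fun i => l i *: s i)) // => i iI; rewrite lI // scale0r.
Qed.

Lemma conv_in I i : i \in I -> conv I (s i).
Proof.
move=> iI; apply/convP; exists (fun j => (j == i)%:R); split.
- by move=> j; rewrite ler0n.
- by move=> j jI; case: eqP jI => // ->; rewrite iI.
- by rewrite (bigD1 i) //= eqxx big1 ?addr0 // => j /negbTE->.
- rewrite (bigD1 i) //= eqxx scale1r big1 ?addr0 // => j /negbTE->; exact: scale0r.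
Qed.

Lemma convS I J : I \subset J -> conv I `<=` conv J.
Proof.
move=> sIJ x /convP[l [l0 lI l1 e]]; apply/convP; exists l; split=> // i iJ.
by apply: lI; apply: contra iJ; apply/fintype.subsetP.
Qed.

Lemma conv0 : conv finset.set0 = set0.
Proof.
rewrite -subset0 => x /convP[l [_ l0 + _]]; rewrite big1 => [/eqP|i _].
  by rewrite eq_sym oner_eq0.
by apply: l0; rewrite finset.in_set0.
Qed.

Lemma hvec_sum (l : T -> R) x : \sum_i l i = 1 -> x = \sum_i l i *: s i ->
  hvec x = \sum_i l i *: hom i.
Proof.
move=> l1 ->; rewrite [RHS](eq_bigr (fun i => row_mx (l i *: (1%:M : 'M_1)) (l i *: s i))); last first.
  by move=> i _; rewrite -scale_row_mx.
transitivity (row_mx (\sum_i l i *: (1%:M : 'M_1)) (\sum_i l i *: s i)).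
  by rewrite -scaler_suml l1 scale1r.
elim/big_rec3: _ => [|i a b c _ <-]; first by rewrite row_mx0.
by rewrite add_row_mx.
Qed.

Lemma hvec_sumV (l : T -> R) x : hvec x = \sum_i l i *: hom i ->
  \sum_i l i = 1 /\ x = \sum_i l i *: s i.
Proof.
have -> : \sum_i l i *: hom i = row_mx ((\sum_i l i)%:M) (\sum_i l i *: s i).
  rewrite [LHS](eq_bigr (fun i => row_mx (l i)%:M (l i *: s i))); last first.
    by move=> i _; rewrite /hom /hvec scale_row_mx scale_scalar_mx mulr1.
  by elim/big_rec3: _ => [|i a b c _ ->]; [rewrite raddf0 row_mx0 | rewrite add_row_mx raddfD].
move/eq_row_mx => [/matrixP/(_ 0 0) + <-]; rewrite !mxE eqxx !mulr1n => <-.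
by [].
Qed.

(** [P] stands for being nonnegative or for being zero, two conditions with the same proof. *)
Lemma ev_conv I x w (P : R -> Prop) : P 0 -> (forall a b, P a -> P b -> P (a + b)) ->
  (forall a b, 0 <= a -> P b -> P (a * b)) ->
  conv I x -> (forall i, i \in I -> P (ev hom w i)) -> P ((hvec x *m w) 0 0).
Proof.
move=> P0 PD PM /convP[l [l0 lI l1 e]] h; rewrite (hvec_sum l1 e) mulmx_suml summxE.
apply: (big_ind P) => // i _; rewrite -scalemxAl mxE.
by case: (boolP (i \in I)) => iI; [apply: PM; rewrite ?l0 //; apply: h | rewrite lI // mul0r].
Qed.

Lemma conv_ge0 I x w : conv I x -> (forall i, i \in I -> 0 <= ev hom w i) ->
  0 <= (hvec x *m w) 0 0.
Proof.
move=> c h; apply: (ev_conv (I := I) (P := fun a => 0 <= a)) => // [a b|a b].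
  exact: addr_ge0.
exact: mulr_ge0.
Qed.

Lemma conv_eq0 I x w : conv I x -> (forall i, i \in I -> ev hom w i = 0) ->
  (hvec x *m w) 0 0 = 0.
Proof.
move=> c h; apply: (ev_conv (I := I) (P := fun a => a = 0)) => // [a b -> ->|a b _ ->].
  exact: addr0.
exact: mulr0.
Qed.

(** A weighted sum of nonnegative values vanishes only if the weights sit on the zeros. *)
Lemma conv_zeros I x w : conv I x -> (forall i, i \in I -> 0 <= ev hom w i) ->
  (hvec x *m w) 0 0 = 0 -> conv [set i in I | ev hom w i == 0]%SET x.
Proof.
move=> /convP[l [l0 lI l1 e]] hw h0; apply/convP; exists l; split=> // i.
rewrite inE; case: (boolP (i \in I)) => [iI|/lI//] /= ni.
have ge j : 0 <= l j * ev hom w j.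
  by case: (boolP (j \in I)) => jI; [rewrite mulr_ge0 ?hw | rewrite lI // mul0r].
move/eqP: h0; rewrite (hvec_sum l1 e) mulmx_suml summxE psumr_eq0; last first.
  by move=> j _; rewrite -scalemxAl mxE; exact: ge.
move/allP/(_ i (mem_index_enum i)); rewrite /= -scalemxAl mxE -/(ev hom w i) mulf_eq0 (negbTE ni).
by rewrite orbF => /eqP.
Qed.

Lemma conv_setT x : (forall w, nonneg hom w -> 0 <= (hvec x *m w) 0 0) -> conv [set: T]%SET x.
Proof.
case/farkas=> l [l0 /hvec_sumV[l1 e]]; apply/convP; exists l; split=> // i.
by rewrite finset.in_setT.
Qed.


End Conv.
End Homogeneous.

(** * Dimension as rank, and faces as index sets *)

Section Dim.
Variables (R : realType) (d : nat).

Lemma vspace_mx (U : {vspace 'rV[R]_d}) : exists B : 'M[R]_(\dim U, d),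
  row_free B /\ forall u, (u \in U) = (u <= B)%MS.
Proof.
have rowE k : row k (\matrix_(k < \dim U) (vbasis U)`_k) = (vbasis U)`_k by rewrite rowK.
exists (\matrix_(k < \dim U) (vbasis U)`_k); split.
  apply: inj_row_free => u; rewrite mulmx_sum_row => h.
  have /freeP fr := basis_free (vbasisP U).
  apply/rowP => k; rewrite [RHS]mxE; apply: (fr (fun k => u 0 k)).
  by rewrite -[RHS]h; apply: eq_bigr => i _; rewrite rowE.
move=> u; apply/idP/idP => [uU|/submxP[D ->]].
  rewrite (coord_vbasis uU); apply: summx_sub => i _; apply: scalemx_sub.
  by rewrite -rowE row_sub.
rewrite mulmx_sum_row; apply: memv_suml => i _; apply: memvZ; rewrite rowE.
by apply: vbasis_mem; apply: mem_nth; rewrite size_tuple.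
Qed.

Lemma has_dim_uniq (A : set 'rV[R]_d) k k' : has_dim A k -> has_dim A k' -> k = k'.
Proof.
have sub (x y : 'rV[R]_d) (U V : {vspace 'rV[R]_d}) :
    [set x + u | u in [set` U]] `<=` [set y + u | u in [set` V]] -> (U <= V)%VS.
  move=> h; have [|v0 v0V e0] := h x; first by exists 0; rewrite /= ?mem0v ?addr0.
  apply/subvP => u uU; have [|v1 v1V e1] := h (x + u); first by exists u.
  have -> : u = v1 - v0 by apply: (addrI x); rewrite -e1 -e0 -addrA [v0 + _]addrC subrK.
  exact: memvB.
have aff0 : affine_hull (set0 : set 'rV[R]_d) = set0.
  rewrite -subset0 => x [[|n] [p [w [hp w1 _]]]]; last by case: (hp ord0).
  by move/eqP: w1; rewrite big_ord0 eq_sym oner_eq0.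
have ne (x : 'rV[R]_d) (U : {vspace 'rV[R]_d}) : [set x + u | u in [set` U]] <> set0.
  by move=> e; have : [set x + u | u in [set` U]] (x + 0) by [exists 0; rewrite /= ?mem0v]; rewrite e.
case=> [[A0 ->]|[x [U [hU ->]]]] [[A0' ->]|[y [V [hV ->]]]] //.
- by case: (ne y V); rewrite -hV A0.
- by case: (ne x U); rewrite -hU A0'.
- congr (Posz _); apply/eqP; rewrite eqn_leq !dimvS //.
    by apply: (sub y x); rewrite -hU -hV.
  by apply: (sub x y); rewrite -hU -hV.
Qed.

Variables (T : finType) (s : T -> 'rV[R]_d).
Local Notation v := (hom s).
Implicit Types I J : {set T}.

Lemma span_hom I (u : 'rV[R]_(1 + d)) : (u <= span v I)%MS <->
  exists l : T -> R, (forall i, i \notin I -> l i = 0) /\ u = \sum_i l i *: v i.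
Proof.
split=> [/sub_sumsmxP[u_ ->]|[l [l0 ->]]].
  have h i : exists a, u_ i *m <<v i>>%MS = a *: v i.
    by apply/sub_rVP; apply: submx_trans (submxMl _ _) _; rewrite genmxE.
  have [l hl] := boolp.choice h.
  exists (fun i => if i \in I then l i else 0); split; first by move=> i /negbTE->.
  rewrite big_mkcond /=; apply: eq_bigr => i _; case: (i \in I); first exact: hl.
  by rewrite scale0r.
apply: summx_sub => i _; case: (boolP (i \in I)) => iI; last by rewrite l0 // scale0r sub0mx.
by apply: scalemx_sub; apply: span_sup.
Qed.

Lemma affine_hull_conv I x : affine_hull (conv s I) x <-> (hvec x <= span v I)%MS.
Proof.
split=> [[n [p [w [hp w1 ->]]]]|/span_hom[l [l0 e]]].
  have -> : hvec (\sum_i w i *: p i) = \sum_i w i *: hvec (p i).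
    by rewrite (hvec_sum (s := p) w1 erefl).
  apply: summx_sub => i _; apply: scalemx_sub.
  by have /convP[l [_ lI l1 e]] := hp i; apply/span_hom; exists l; rewrite (hvec_sum l1 e).
have [l1 ex] := hvec_sumV e.
have en (V : zmodType) (F : T -> V) : (forall i, i \notin I -> F i = 0) ->
   \sum_i F i = \sum_(k < #|I|) F (enum_val k).
  by move=> F0; rewrite -big_enum_val [LHS](bigID (mem I)) /= [X in _ + X]big1 ?addr0.
exists #|I|, (fun k => s (enum_val k)), (fun k => l (enum_val k)); split.
- by move=> k; apply: conv_in; exact: enum_valP.
- by rewrite -l1 -(en R).
- by rewrite ex (en _ (fun i => l i *: s i)) // => i iI; rewrite l0 // scale0r.
Qed.

(** With [U] the direction space of the affine hull, (1, s i0) and the vectors (0, u), [u] in [U],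
    span the same space as the homogenised points; the row [v i0] accounts for the difference of
    one. The empty set, of rank 0, gets dimension -1. *)
Lemma has_dim_conv I : has_dim (conv s I) ((rk v I)%:Z - 1).
Proof.
have [->|[i0 i0I]] := set_0Vmem I.
  by left; rewrite conv0 /rk /span big_set0 mxrank0.
right; pose U := <<[seq s i - s i0 | i <- enum I]>>%VS; exists (s i0), U.
have [B [fB memB]] := vspace_mx U.
pose M : 'M_(1 + \dim U, 1 + d) := col_mx (v i0) (row_mx 0 B).
have memM x : (hvec x <= M)%MS = (x - s i0 <= B)%MS.
  apply/submxP/submxP => -[D]; last first.
    move=> e; exists (row_mx 1%:M D); rewrite /M /hom /hvec mul_row_col mul1mx mul_mx_row mulmx0 -e.
    by rewrite add_row_mx addr0 addrC subrK.
  rewrite -[D]hsubmxK /M /hom /hvec mul_row_col !mul_mx_row mulmx0 mulmx1 add_row_mx addr0.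
  by move/eq_row_mx => [<- ->]; rewrite mul1mx addrC addKr; exists (rsubmx D).
have iU i : i \in I -> s i - s i0 \in U.
  by move=> iI; apply: memv_span; apply: map_f; rewrite mem_enum.
have U0 u : u \in U -> (row_mx 0 u <= span v I)%MS.
  move=> uU; pose X := in_tuple [seq s i - s i0 | i <- enum I].
  have uX : u \in <<X>>%VS by [].
  rewrite (coord_span uX).
  have h k : (row_mx 0 X`_k <= span v I)%MS.
    have [kX|kX] := ltnP k (size X); last by rewrite nth_default // row_mx0 sub0mx.
    have : X`_k \in X by apply: mem_nth.
    case/mapP=> i; rewrite mem_enum => iI ->.
    have -> : row_mx 0 (s i - s i0) = v i - v i0 by rewrite /hom /hvec opp_row_mx add_row_mx subrr.
    by apply: addmx_sub; rewrite ?eqmx_opp; apply: span_sup.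
  have -> : row_mx 0 (\sum_i coord X i u *: X`_i) = \sum_i coord X i u *: row_mx (0 : 'M_1) X`_i.
    rewrite [RHS](eq_bigr (fun i => row_mx (0 : 'M_1) (coord X i u *: X`_i))); last first.
      by move=> i _; rewrite scale_row_mx scaler0.
    by elim/big_rec2: _ => [|i a b _ <-]; rewrite ?row_mx0 // add_row_mx addr0.
  by apply: summx_sub => i _; apply: scalemx_sub.
have eM : (span v I :=: M)%MS.
  apply/eqmxP/andP; split.
    by apply: span_sub => i iI; rewrite /hom memM -memB iU.
  rewrite col_mx_sub span_sup //=; apply/row_subP => k.
  by rewrite row_row_mx row0 U0 // memB row_sub.
have fM : row_free M.
  apply: inj_row_free => u; rewrite -[u]hsubmxK /M /hom /hvec mul_row_col !mul_mx_row mulmx0 mulmx1 add_row_mx addr0.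
  rewrite -[0 in RHS]row_mx0 => /eq_row_mx[-> ].
  rewrite mul0mx add0r => h.
  by rewrite (_ : rsubmx u = 0) ?row_mx0 //; apply: (row_free_inj fB); rewrite h mul0mx.
split; last by rewrite /rk eM (eqP fM) add1n -addn1 PoszD addrK.
apply/seteqP; split => x /=.
  move/affine_hull_conv; rewrite eM memM -memB => h; exists (x - s i0) => //.
  by rewrite addrC subrK.
by case=> u uU <-; apply/affine_hull_conv; rewrite eM memM -memB addrAC subrr add0r.
Qed.

Lemma has_dim_convE I k : has_dim (conv s I) k <-> k = (rk v I)%:Z - 1.
Proof.
by split=> [h|->]; [exact: has_dim_uniq h (has_dim_conv I) | exact: has_dim_conv].
Qed.

Lemma hom_ev a y i : ev v (aff a y) i = a + dotp (s i) y.
Proof. exact: hvec_aff. Qed.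

Lemma isface_set0 : isface v finset.set0.
Proof.
apply/isfaceP; exists (aff 1 0) => [i|]; first by rewrite hom_ev dotp0r addr0.
by apply/setP => i; rewrite !inE hom_ev dotp0r addr0 oner_eq0.
Qed.

Lemma face_conv I : isface v I -> face (conv s [set: T]%SET) (conv s I).
Proof.
move=> /isfaceP[w hw eI]; have [a [y ew]] := affP w; rewrite {}ew in hw eI.
have [->|[i0 i0I]] := set_0Vmem I; first by left; exact: conv0.
right; exists (- y).
have i0E : a + dotp (s i0) y = 0 by apply/eqP; move: i0I; rewrite eI inE hom_ev.
have P0 z : conv s [set: T]%SET z -> 0 <= a + dotp z y.
  by move=> Pz; rewrite -hvec_aff; apply: (conv_ge0 Pz) => i _; exact: hw.
apply/seteqP; split => x /=.
  move=> Ix; split; first by apply: convS Ix; exact: finset.subsetT.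
  have x0 : a + dotp x y = 0.
    by rewrite -hvec_aff; apply: (conv_eq0 Ix) => i; rewrite eI inE => /eqP.
  by move=> z /P0; rewrite !dotpNr; lra.
case=> Px hx; have := hx _ (conv_in s (finset.in_setT i0)).
have := P0 _ Px; rewrite !dotpNr => h1 h2.
have x0 : (hvec x *m aff a y) 0 0 = 0 by rewrite hvec_aff; lra.
have := conv_zeros Px (fun i _ => hw i) x0; congr (conv s _ x).
by apply/setP => i; rewrite eI !inE.
Qed.

Lemma face_convV F : face (conv s [set: T]%SET) F -> exists2 I, isface v I & F = conv s I.
Proof.
case=> [->|[y eF]]; first by exists finset.set0; [exact: isface_set0 | rewrite conv0].
(* Without generators there is no maximum to take, and the face is empty. *)
case: (pickP (fun _ : T => true)) => [t _|T0]; last first.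
  exists finset.set0; [exact: isface_set0 | rewrite conv0 eF].
  rewrite -subset0 => x [Px _]; move: Px.
  by rewrite (_ : [set: T]%SET = finset.set0) ?conv0 //; apply/setP => i; have := T0 i.
case: (arg_maxP (P := xpredT) (fun i => dotp (s i) y) (isT : xpredT t)) => t' _ tmax.
pose w := aff (dotp (s t') y) (- y).
have hw : nonneg v w by move=> i; rewrite hom_ev dotpNr subr_ge0; apply: tmax.
exists (zeros v w); first by apply/isfaceP; exists w.
rewrite eF; apply/seteqP; split => x /=.
  case=> Px hx; have hx' := hx _ (conv_in s (finset.in_setT t')).
  have := conv_ge0 Px (fun i _ => hw i); rewrite hvec_aff dotpNr => h.
  have x0 : (hvec x *m w) 0 0 = 0 by rewrite hvec_aff dotpNr; lra.
  have := conv_zeros Px (fun i _ => hw i) x0; congr (conv s _ x).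
  by apply/setP => i; rewrite !inE.
move=> zx; have Px : conv s [set: T]%SET x by apply: convS zx; exact: finset.subsetT.
have x0 : (hvec x *m w) 0 0 = 0 by apply: (conv_eq0 zx) => i; rewrite inE => /eqP.
split=> // z /conv_ge0-/(_ w (fun i _ => hw i)); move: x0; rewrite !hvec_aff !dotpNr; lra.
Qed.

Lemma conv_face_sub I J : isface v J -> conv s I `<=` conv s J -> I \subset J.
Proof.
move=> /isface_pos[w w0 w1] h; apply/fintype.subsetP => i iI; apply/negPn/negP => /w1.
by rewrite /ev /hom (conv_eq0 (h _ (conv_in s iI)) w0) ltxx.
Qed.

End Dim.

(** * Flags as lists of covers *)

Section ChainList.
Variables (T : finType) (F : pred {set T}).

(** An explicit list of the chains with [n] steps, to be matched with [flags]; the bottom [A] is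
    omitted from each chain. *)
Fixpoint chains n (A B : {set T}) : seq (seq {set T}) :=
  if n is m.+1 then
    [seq C :: p | C <- enum [pred C | cov F A C && (C \subset B)], p <- chains m C B]
  else if A == B then [:: [::]] else [::].

Lemma mem_chains n A B p :
  (p \in chains n A B) = [&& size p == n, path (cov F) A p & last A p == B].
Proof.
elim: n A p => [|n IH] A p /=.
  by case: p => [|C p] /=; case: (A == B); rewrite ?inE.
have lastS C q : path (cov F) C q -> C \subset last C q.
  elim: q C => //= D q IHq C /andP[c /IHq]; exact: fintype.subset_trans (cov_sub c).
apply/allpairsPdep/idP => [[C [q [+ + ->]]]|].
  rewrite mem_enum => /andP[c _]; rewrite IH => /and3P[/eqP<- pq e].
  by rewrite /= eqxx c pq.
case: p => [|C q] //= /and3P[sz /andP[c pq] e]; exists C, q; split=> //.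
  by rewrite mem_enum inE /= c -(eqP e) lastS.
by rewrite IH pq e -eqSS sz.
Qed.

Lemma chains_uniq n A B : uniq (chains n A B).
Proof.
elim: n A => [|n IH] A /=; first by case: (A == B).
apply: allpairs_uniq_dep; [exact: enum_uniq | by move=> C _ |].
by move=> [C p] [D q] _ _ /= [-> ->].
Qed.

Lemma size_chains rk n A B : graded F rk -> F A -> F B -> A \subset B -> rk B = (rk A + n)%N ->
  size (chains n A B) = ch F A B.
Proof.
move=> H FA FB; elim: n A FA => [|n IH] A FA sAB r /=.
  have -> : A = B by apply: (rk_sub_eq H) => //; rewrite r addn0.
  by rewrite eqxx ch_refl.
have pAB : A \proper B.
  by rewrite finset.properEneq sAB andbT; apply/eqP => e; move: r; rewrite e; clear; lia.
rewrite size_allpairs_dep sumnE big_map big_enum /= ch_step //.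
by apply: eq_bigr => C /andP[c sCB]; apply: IH => //; [exact: covF c | rewrite (cov_rk H FA c); move: r; clear; lia].
Qed.

End ChainList.

Local Open Scope classical_set_scope.
Local Open Scope ring_scope.

Section Flags.
Variables (R : realType) (d : nat) (T : finType) (s : T -> 'rV[R]_d).
Local Notation v := (hom s).
Hypothesis full : rk v [set: T]%SET = d.+1.

Lemma rk_set0 : rk v finset.set0 = 0%N.
Proof. by rewrite /rk /span big_set0 mxrank0. Qed.

(** With the omitted empty face restored, position [r] holds the face of rank [r], that is of
    dimension r - 1. *)
Definition chain_flag (p : seq {set T}) : 'I_d.+2 -> set 'rV[R]_d :=
  fun r => conv s (nth finset.set0 (finset.set0 :: p) r).

Let H := faces_graded v.

Lemma chain_nth p : p \in chains (isface v) d.+1 finset.set0 [set: T]%SET ->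
  forall r, (r <= d.+1)%N -> isface v (nth finset.set0 (finset.set0 :: p) r) /\
     rk v (nth finset.set0 (finset.set0 :: p) r) = r.
Proof.
rewrite mem_chains => /and3P[/eqP sz /(pathP finset.set0) pp _].
elim=> [|r IH] hr; first by rewrite /= rk_set0; split=> //; exact: isface_set0.
have [Fr rr] := IH (ltnW hr); have c := pp r; rewrite sz hr in c.
by have {}c := c isT; split; [exact: covF c | rewrite /= (cov_rk H Fr c) rr].
Qed.

(** The entries of a flag are hulls of index faces whose ranks equal their positions, and
    consecutive ones are covers because the rank rises by one. *)
Lemma flags_chains : flags (conv s [set: T]%SET) =
  chain_flag @` [set` chains (isface v) d.+1 finset.set0 [set: T]%SET].
Proof.
apply/seteqP; split=> F /=; last first.
  case=> p pin0 <-; have pin : p \in chains (isface v) d.+1 finset.set0 [set: T]%SET := pin0.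
  have h := chain_nth pin; split=> [i|i|i j ij].
  - by apply: face_conv; case: (h i _) => //; rewrite -ltnS.
  - by apply/has_dim_convE; case: (h i _) => //; [rewrite -ltnS | move=> _ ->].
  - have [Fi ri] := h i (ltnSE (ltn_ord i)); have [Fj rj] := h j (ltnSE (ltn_ord j)).
    have sij : nth finset.set0 (finset.set0 :: p) i \subset nth finset.set0 (finset.set0 :: p) j.
      move: pin; rewrite mem_chains => /and3P[/eqP sz pp _].
      have hp : path (fun A B : {set T} => A \subset B) finset.set0 p.
        by apply: sub_path pp => A B; exact: cov_sub.
      have tr : transitive (fun A B : {set T} => A \subset B).
        by move=> B A C; exact: fintype.subset_trans.
      apply: (@sorted_leq_nth _ (fun A B : {set T} => A \subset B) tr (fun A => subxx A)
        finset.set0 (finset.set0 :: p) hp).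
      + by rewrite inE /= sz.
      + by rewrite inE /= sz.
      + exact: ltnW.
    split; first exact: convS sij.
    move=> /(conv_face_sub Fi) sji; have := rkS v sji; rewrite ri rj leqNgt.
    by rewrite ij.
move=> [hf hd hs].
have hI i : exists I, isface v I /\ F i = conv s I.
  by have [I FI e] := face_convV (hf i); exists I.
have [I hI'] := boolp.choice hI.
have FI i : isface v (I i) by case: (hI' i).
have eI i : F i = conv s (I i) by case: (hI' i).
have rI i : rk v (I i) = i.
  have := hd i; rewrite eI => /has_dim_convE; lia.
pose p := [seq I (inord r.+1) | r <- iota 0 d.+1].
have nthp r : (r <= d.+1)%N -> nth finset.set0 (finset.set0 :: p) r = I (inord r).
  case: r => [_|r hr] /=.
    have e0 : finset.set0 \subset I ord0 := finset.sub0set _.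
    have -> : inord 0 = ord0 :> 'I_d.+2 by apply: val_inj; rewrite /= inordK.
    by apply: (rk_sub_eq H (isface_set0 s) (FI ord0) e0); rewrite rI.
  by rewrite /p (nth_map 0%N) ?size_iota // nth_iota.
exists p; last first.
  apply/funext => i; rewrite /chain_flag nthp ?eI; last by rewrite -ltnS.
  by rewrite inord_val.
suff : p \in chains (isface v) d.+1 finset.set0 [set: T]%SET by [].
rewrite mem_chains; apply/and3P; split.
- by rewrite size_map size_iota.
- apply/(pathP finset.set0) => r; rewrite size_map size_iota => hr.
  have -> : nth finset.set0 p r = nth finset.set0 (finset.set0 :: p) r.+1 by [].
  rewrite !nthp //; last exact: ltnW.
  have vr : (inord r : 'I_d.+2) = r :> nat by rewrite inordK // ltnW.
  have vr1 : (inord r.+1 : 'I_d.+2) = r.+1 :> nat by rewrite inordK.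
  have [s1 s2] := hs (inord r) (inord r.+1) (etrans (congr2 leq (congr1 S vr) vr1) (leqnn _)).
  apply: (rk_cov H) => //; last by rewrite !rI vr vr1.
  rewrite fintype.properE; apply/andP; split.
    by apply: (conv_face_sub (s := s)) => //; rewrite -!eI.
  by apply/negP => h; apply: s2; rewrite !eI; apply: convS.
- have -> : last finset.set0 p = nth finset.set0 (finset.set0 :: p) d.+1.
    by rewrite (last_nth finset.set0) size_map size_iota.
  rewrite nthp //; apply/eqP/(rk_sub_eq H) => //.
  + exact: isface_setT.
  + by rewrite full rI inordK.
Qed.

Lemma chain_flag_inj p q : p \in chains (isface v) d.+1 finset.set0 [set: T]%SET ->
  q \in chains (isface v) d.+1 finset.set0 [set: T]%SET -> chain_flag p = chain_flag q -> p = q.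
Proof.
move=> hp hq e; have h1 := chain_nth hp; have h2 := chain_nth hq.
move: hp hq; rewrite !mem_chains => /and3P[/eqP sp _ _] /and3P[/eqP sq _ _].
apply: (@eq_from_nth _ finset.set0); first by rewrite sp sq.
move=> r; rewrite sp => hr; have := congr1 (fun f => f (inord r.+1)) e.
rewrite /chain_flag inordK //= => er.
have [F1 _] := h1 r.+1 hr; have [F2 _] := h2 r.+1 hr.
by apply/eqP; rewrite finset.eqEsubset !(conv_face_sub (s := s)) //= er.
Qed.

Theorem card_flags : (flags (conv s [set: T]%SET) #= `I_(ch (isface v) finset.set0 [set: T]%SET))%card.
Proof.
have sz : size (chains (isface v) d.+1 finset.set0 [set: T]%SET) = ch (isface v) finset.set0 [set: T]%SET.
  apply: (size_chains H (isface_set0 s) (isface_setT v) (finset.sub0set _)).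
  by rewrite rk_set0 full.
rewrite flags_chains -sz; set L := chains _ _ _ _.
pose g k := chain_flag (nth [::] L k).
have -> : chain_flag @` [set` L] = g @` `I_(size L).
  apply/seteqP; split => F /=.
    case=> p pL <-; exists (index p L); rewrite /= ?index_mem // /g nth_index //.
  by case=> k kL <-; exists (nth [::] L k) => //; exact: mem_nth.
apply: inj_card_eq => k l; rewrite !inE /= => kL lL e.
have := chain_flag_inj (mem_nth [::] kL) (mem_nth [::] lL) e.
by move/eqP; rewrite nth_uniq ?chains_uniq // => /eqP.
Qed.

End Flags.

(** * Equality in the unconditional case *)

Section HomFlip.
Variables (R : realType) (d : nat) (T : finType) (s : T -> 'rV[R]_d).
Local Notation v := (hom s).
Local Notation up K := ([set rshift 1 j | j in K]%SET).
Implicit Types (A B : {set T}) (K S : {set 'I_d}).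

Lemma hvec_rshift (x : 'rV[R]_d) j : hvec x 0 (rshift 1 j) = x 0 j.
Proof. by rewrite /hvec row_mxEr. Qed.

Lemma hvec_lshift (x : 'rV[R]_d) j : hvec x 0 (lshift d j) = 1.
Proof. by rewrite /hvec row_mxEl mxE !ord1 eqxx. Qed.

Lemma aff_rshift (a : R) y (j : 'I_d) : aff a y (rshift 1 j) 0 = y 0 j.
Proof. by rewrite /aff col_mxEd mxE. Qed.

Lemma mem_up K j : (rshift 1 j \in up K) = (j \in K).
Proof. by rewrite mem_imset //; exact: rshift_inj. Qed.

Lemma lshift_up K j : (lshift d j \in up K) = false.
Proof. by apply/negP => /imsetP[k _ /eqP]; rewrite eq_lrshift. Qed.

Lemma hvec_flip (x : 'rV[R]_d) S : hvec (flip S x) = flip (up S) (hvec x).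
Proof.
apply/rowP => k; rewrite [RHS]mxE; case: (split_ordP k) => j ->.
  by rewrite lshift_up !hvec_lshift.
by rewrite mem_up !hvec_rshift mxE.
Qed.

Lemma hom_flip A K : (forall S i, S \subset K -> i \in A -> exists2 i', i' \in A & s i' = flip S (s i)) ->
  forall (S : {set 'I_(1 + d)}) i, S \subset up K -> i \in A -> exists2 i', i' \in A & v i' = flip S (v i).
Proof.
move=> h S i sS iA; pose S' := [set j | rshift 1 j \in S]%SET.
have eS : S = up S'.
  apply/setP => k; case: (split_ordP k) => j ->; last by rewrite mem_up inE.
  by rewrite lshift_up; apply/negP => /(fintype.subsetP sS); rewrite lshift_up.
have sS' : S' \subset K by apply/fintype.subsetP => j; rewrite inE => /(fintype.subsetP sS); rewrite mem_up.
by have [i' i'A e] := h S' i sS' iA; exists i' => //; rewrite /hom e hvec_flip -eS.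
Qed.

Lemma card_up K : #|up K| = #|K|.
Proof. by rewrite card_imset //; exact: rshift_inj. Qed.

Lemma hom_rk_le A B K a y : A \subset B ->
  (forall i, i \in A -> a + dotp (s i) y = 0) ->
  (exists2 i, i \in B & a + dotp (s i) y != 0) ->
  (forall j, j \in K -> y 0 j = 0) -> (forall i j, i \in A -> j \in K -> s i 0 j = 0) ->
  (forall j, j \in K -> exists2 i, i \in B & s i 0 j != 0) ->
  (forall S i, S \subset K -> i \in B -> exists2 i', i' \in B & s i' = flip S (s i)) ->
  (rk v A + #|K|.+1 <= rk v B)%N.
Proof.
move=> pAB h0 h1 hy hA hB hf; rewrite -(card_up K); apply: (@box_rk_le _ _ _ _ _ _ _ (aff a y)) => //.
- by move=> i iA; rewrite hom_ev h0.
- by case: h1 => i iB h; exists i => //; rewrite hom_ev.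
- by move=> k /imsetP[j jK ->]; rewrite aff_rshift hy.
- by move=> i k iA /imsetP[j jK ->]; rewrite /hom hvec_rshift hA.
- by move=> k /imsetP[j jK ->]; have [i iB n] := hB j jK; exists i; rewrite // /hom hvec_rshift.
- exact: hom_flip.
Qed.

End HomFlip.

(** The family lists vertices, as every singleton is a face; it is closed under sign changes, lies
    in the cube and touches each facet of it. *)
Record symmetric_list (R : realType) d (T : finType) (s : T -> 'rV[R]_d) : Prop := SymmetricList {
  sl_atom : forall t, isface (hom s) [set t]%SET;
  sl_flip : forall S t, exists t', s t' = flip S (s t);
  sl_le : forall t j, s t 0 j <= 1;
  sl_eq : forall j, exists t, s t 0 j = 1 }.

Section Symmetric.
Variables (R : realType) (d : nat) (T : finType) (s : T -> 'rV[R]_d).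
Hypothesis sl : symmetric_list s.
Hypothesis d0 : (0 < d)%N.
Local Notation v := (hom s).
Local Notation up K := ([set rshift 1 j | j in K]%SET).
Local Notation isface := (isface v).
Local Notation rk := (rk v).
Local Notation ch := (ch isface).
Local Notation cov := (cov isface).

Lemma flip_in (A : {set T}) S t : (forall t', s t' = flip S (s t) -> t' \in A) ->
  exists2 t', t' \in A & s t' = flip S (s t).
Proof. by move=> h; have [t' e] := sl_flip sl S t; exists t' => //; exact: h. Qed.

Lemma set0_proper : finset.set0 \proper [set: T]%SET.
Proof.
have [t _] := sl_eq sl (Ordinal d0).
by apply/properP; split; [exact: finset.sub0set | exists t; rewrite !inE].
Qed.

Lemma sl_full : rk finset.setT = d.+1.
Proof.
apply/eqP; rewrite eqn_leq; apply/andP; split; first exact: rk_leq.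
have : (rk finset.set0 + #|[set: 'I_d]%SET|.+1 <= rk finset.setT)%N; last first.
  by rewrite rk_set0 cardsT card_ord add0n.
apply: (@hom_rk_le _ _ _ _ _ _ _ 1 0); first exact: finset.sub0set.
- by move=> i; rewrite inE.
- by have [t _] := sl_eq sl (Ordinal d0); exists t; rewrite ?inE // dotp0r addr0 oner_eq0.
- by move=> j _; rewrite mxE.
- by move=> i j; rewrite inE.
- by move=> j _; have [t e] := sl_eq sl j; exists t; rewrite ?e ?oner_eq0.
- by move=> S t _ _; apply: flip_in.
Qed.

(** The whole polytope is a box over the empty face, with all its coordinates and the constant
    functional 1; the maxima [alpha] are then 1. *)
Lemma sl_box : box v finset.set0 finset.setT (up [set: 'I_d]%SET) (aff 1 0).
Proof.
split.
- exact: isface_set0.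
- exact: isface_setT.
- exact: set0_proper.
- by move=> i; rewrite inE.
- by move=> i _ _; rewrite hom_ev dotp0r addr0 ltr01.
- by move=> k /imsetP[j _ ->]; rewrite aff_rshift mxE.
- by move=> i j; rewrite inE.
- move=> k /imsetP[j _ ->]; have [t e] := sl_eq sl j; exists t => //.
  by rewrite /hom hvec_rshift e oner_eq0.
- by apply: hom_flip => S t _ _; apply: flip_in.
- by rewrite sl_full card_up cardsT card_ord rk_set0.
Qed.

Lemma sl_alpha k : k \in up [set: 'I_d]%SET -> [/\ (0 < 1 :> R),
  forall i, i \in finset.setT -> v i 0 k <= 1 * ev v (aff 1 0) i &
  exists i, [/\ i \in finset.setT, i \notin finset.set0 & v i 0 k = 1 * ev v (aff 1 0) i]].
Proof.
move=> /imsetP[j _ ->]; split=> //.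
  by move=> i _; rewrite hom_ev dotp0r addr0 mul1r /hom hvec_rshift; exact: (sl_le sl).
have [t e] := sl_eq sl j; exists t; rewrite !inE; split=> //.
by rewrite hom_ev dotp0r addr0 mul1r /hom hvec_rshift e.
Qed.

Theorem symmetric_flags : (nflags d <= ch finset.set0 finset.setT)%N.
Proof.
have := box_flags sl_box; by rewrite card_up cardsT card_ord.
Qed.

Definition cubic (j : 'I_d) (b : bool) : {set T} := [set t | s t 0 j == (-1) ^+ b]%SET.

Lemma cubic_top j b : cubic j b = top v finset.setT (aff 1 0) (fun=> 1) (rshift 1 j) b.
Proof.
by apply/setP => t; rewrite !inE hom_ev dotp0r addr0 !mulr1 /hom hvec_rshift.
Qed.

Lemma cubic_face j b : isface (cubic j b).
Proof.
by rewrite cubic_top; apply: (top_face sl_box sl_alpha); rewrite mem_up inE.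
Qed.

Lemma cov_atom t : cov finset.set0 [set t]%SET.
Proof.
apply: covI; first exact: (sl_atom sl).
  by apply/properP; split; [exact: finset.sub0set | exists t; rewrite !inE].
by move=> E _ /proper_card + /proper_card; rewrite cards0 cards1; case: #|E| => // -[].
Qed.

Hypothesis eqf : ch finset.set0 finset.setT = nflags d.

Lemma cubic_between t y : cov y finset.setT -> isface y -> t \in y ->
  exists j b, t \in cubic j b /\ cubic j b \subset y.
Proof.
move=> cy Fy ty; have K0 : (0 < #|up [set: 'I_d]%SET|)%N by rewrite card_up cardsT card_ord.
have e : ch finset.set0 finset.setT = nflags #|up [set: 'I_d]%SET| by rewrite eqf card_up cardsT card_ord.
have [h _] := box_flags_eq sl_box sl_alpha K0 e.
have [|k [b [/imsetP[j _ ->]]]] := h [set t]%SET y (cov_atom t) Fy cy; first by rewrite finset.sub1set.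
by rewrite -cubic_top finset.sub1set => h1 h2; exists j, b.
Qed.

Lemma cubic_shuffles j b t y : cov y finset.setT -> isface y -> t \in cubic j b -> cubic j b \subset y ->
  shuffles isface rk [set t]%SET (cubic j b) y = ch [set t]%SET y.
Proof.
move=> cy Fy ty sy; have K0 : (0 < #|up [set: 'I_d]%SET|)%N by rewrite card_up cardsT card_ord.
have e : ch finset.set0 finset.setT = nflags #|up [set: 'I_d]%SET| by rewrite eqf card_up cardsT card_ord.
have [_ h] := box_flags_eq sl_box sl_alpha K0 e.
rewrite cubic_top; apply: h => //; rewrite -?cubic_top ?mem_up ?finset.sub1set ?finset.in_setT //; exact: cov_atom.
Qed.

Lemma cubic_flip j b (S : {set 'I_d}) t t' : j \notin S -> t \in cubic j b -> s t' = flip S (s t) -> t' \in cubic j b.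
Proof. by move=> jS; rewrite !inE => tX ->; rewrite mxE (negbTE jS). Qed.

(** A facet [y] contains [t] but not its reflection in [i]. By equality some face {x_j = 1} or {x_j
    = -1} lies between [t] and [y]; for j different from i it would contain the reflected point
    too. *)
Lemma sl_vals t i : s t 0 i != 0 -> exists b, t \in cubic i b.
Proof.
move=> ti; have [t' e] := sl_flip sl [set i]%SET t.
have tt' : t' \notin [set t]%SET.
  rewrite inE; apply/eqP => ett; move: e; rewrite ett => /rowP/(_ i).
  rewrite mxE inE eqxx => /eqP; rewrite -addr_eq0 -mulr2n mulrn_eq0 /=.
  by rewrite (negbTE ti).
have [y [Fy ty t'y cy]] := graded_separate (faces_graded v) (sl_atom sl t) tt' (isface_setT v).
rewrite finset.sub1set in ty; have [j [b [tX Xy]]] := cubic_between cy Fy ty.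
have [ej|nj] := eqVneq j i; first by exists b; rewrite -ej.
case/negP: t'y; apply: (fintype.subsetP Xy); apply: cubic_flip tX e.
by rewrite inE.
Qed.

(** Edges are the pairs of coordinates that are never nonzero together, so that vertices have stable
    supports. *)
Definition adj (i j : 'I_d) := (i != j) && [forall t, (s t 0 i == 0) || (s t 0 j == 0)].

Lemma adj_sym i j : adj i j = adj j i.
Proof. by rewrite /adj eq_sym; congr (_ && _); apply: eq_forallb => t; rewrite orbC. Qed.

Lemma adj_irr i : adj i i = false. Proof. by rewrite /adj eqxx. Qed.

Lemma adj0 i j t : adj i j -> s t 0 i != 0 -> s t 0 j = 0.
Proof. by move=> /andP[_ /forallP/(_ t)] /orP[->//|/eqP]. Qed.

Lemma nadj_point i j : i != j -> ~~ adj i j -> exists2 t, s t 0 i = 1 & s t 0 j = 1.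
Proof.
move=> nij; rewrite /adj nij /= negb_forall => /existsP[t]; rewrite negb_or => /andP[ti tj].
have [bi hi] := sl_vals ti; have [bj hj] := sl_vals tj.
have [t' e] := sl_flip sl [set k | (k == i) && bi || (k == j) && bj]%SET t.
move: hi hj; rewrite !inE => /eqP hi /eqP hj; exists t'; rewrite e mxE inE eqxx ?[j == i]eq_sym (negbTE nij) /= ?orbF.
  by rewrite hi; case: (bi); rewrite ?opprK.
by rewrite hj; case: (bj); rewrite ?opprK.
Qed.

End Symmetric.

Definition stable_vectors (R : realType) d (e : rel 'I_d) : set 'rV[R]_d :=
  [set x | (forall i, [\/ x 0 i = 0, x 0 i = 1 | x 0 i = -1]) /\
           forall i j, e i j -> x 0 i = 0 \/ x 0 j = 0].

Definition stable_polytope (R : realType) d (e : rel 'I_d) : set 'rV[R]_d :=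
  convex_hull (@stable_vectors R d e).

(** If [e] is symmetric and irreflexive, the conditions force the four vertices to be distinct. *)
Definition P4_free (V : Type) (e : rel V) : Prop := forall a b c z,
  e a b -> e b c -> e c z -> ~~ e a c -> ~~ e a z -> ~~ e b z -> False.

Lemma convex_hullS (R : realType) d (A B : set 'rV[R]_d) : A `<=` B -> convex_hull A `<=` convex_hull B.
Proof. by move=> s x [n [p [w [hp w0 w1 e]]]]; exists n, p, w; split=> // i; apply: s. Qed.

Lemma sub_convex_hull (R : realType) d (A : set 'rV[R]_d) x : A x -> convex_hull A x.
Proof.
move=> Ax; exists 1%N, (fun _ => x), (fun _ => 1); split=> //; first by rewrite big_ord1.
by rewrite big_ord1 scale1r.
Qed.

Lemma convex_hull_conv (R : realType) d (T : finType) (s : T -> 'rV[R]_d) (A : set 'rV[R]_d) :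
  A `<=` conv s [set: T]%SET -> convex_hull A `<=` conv s [set: T]%SET.
Proof.
move=> h x [n [p [w [hp w0 w1 e]]]]; apply: conv_setT => f f0.
rewrite (hvec_sum w1 e) mulmx_suml summxE; apply: sumr_ge0 => i _.
by rewrite -scalemxAl mxE mulr_ge0 // (conv_ge0 (h _ (hp i))).
Qed.

Lemma convP_farkas (R : realType) d (T : finType) (s : T -> 'rV[R]_d) (x : 'rV[R]_d) :
  ~ conv s [set: T]%SET x -> exists2 w, nonneg (hom s) w & (hvec x *m w) 0 0 < 0.
Proof.
move=> nx; apply: contrapT => h; apply: nx; apply: conv_setT => w w0.
by rewrite leNgt; apply/negP => h'; apply: h; exists w.
Qed.

(** * Facets are signed cliques *)

Section Stable.
Variables (R : realType) (d : nat) (T : finType) (s : T -> 'rV[R]_d).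
Hypothesis sl : symmetric_list s.
Hypothesis d0 : (0 < d)%N.
Local Notation v := (hom s).
Local Notation isface := (isface v).
Local Notation rk := (rk v).
Local Notation ch := (ch isface).
Local Notation cov := (cov isface).
Hypothesis eqf : ch finset.set0 [set: T]%SET = nflags d.
Local Notation adj := (adj s).
Local Notation cubic := (cubic s).

Lemma points_stable t : stable_vectors adj (s t).
Proof.
split=> [i|i j].
  have [->|ti] := eqVneq (s t 0 i) 0; first by constructor 1.
  have [[] ] := sl_vals sl d0 eqf ti; rewrite inE => /eqP->; first by constructor 3.
  by constructor 2.
move=> aij; have [->|ti] := eqVneq (s t 0 i) 0; [by left | right; exact: adj0 aij ti].
Qed.

Section Facet.
Variables (a : R) (y : 'rV[R]_d).
Hypothesis w0 : nonneg v (aff a y).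
Hypothesis cy : cov (zeros v (aff a y)) [set: T]%SET.

Let Fy : isface (zeros v (aff a y)). Proof. by apply/isfaceP; exists (aff a y). Qed.

Lemma facet_flip t t' i : t \in zeros v (aff a y) -> t' \in zeros v (aff a y) ->
  s t' = flip [set i]%SET (s t) -> s t 0 i * y 0 i = 0.
Proof.
rewrite !inE !hom_ev => /eqP h /eqP h' e.
have e' : v t' = flip [set rshift 1 i]%SET (v t).
  by rewrite /hom e hvec_flip imset_set1.
have := ev_flip1 (aff a y) e'; rewrite !hom_ev h h' /hom hvec_rshift aff_rshift sub0r.
by move/esym/eqP; rewrite oppr_eq0 mulf_eq0 pnatr_eq0 /= => /eqP.
Qed.

(** If the facet lay in x_i = 0, then x_i and the functional without its [i]-th coordinate would
    both vanish on it, one too many for a coatom. So it has a vertex with nonzero [i]-th coordinate,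
    and the face that [cubic_between] puts between them belongs to [i]: any other one could be
    reflected in [i], which changes the value of the functional. *)
Lemma facet_cubic i : y 0 i != 0 -> exists b, cubic i b \subset zeros v (aff a y).
Proof.
move=> yi; set Y := zeros v (aff a y).
have [t tY ti] : exists2 t, t \in Y & s t 0 i != 0.
  case: (pickP (fun t => (t \in Y) && (s t 0 i != 0))) => [t /andP[]|h]; first by exists t.
  have Yi t : t \in Y -> s t 0 i = 0 by move=> tY; move: (h t); rewrite tY => /negbFE/eqP.
  have : (rk Y + #|[set i]%SET|.+1 <= rk [set: T]%SET)%N; last first.
    have rT : rk [set: T]%SET = (rk Y).+1 by exact: cov_rk (faces_graded v) _ _ Fy cy.
    by rewrite cards1 rT addn2 ltnn.
  have dotE t : dotp (s t) (y - y 0 i *: delta_mx 0 i) = dotp (s t) y - s t 0 i * y 0 i.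
    by rewrite dotpDr dotpNr dotpZr dotp_delta mulrC.
  apply: (@hom_rk_le _ _ _ s Y [set: T]%SET [set i]%SET a (y - y 0 i *: delta_mx 0 i)).
  - exact: finset.subsetT.
  - by move=> t tY; rewrite dotE Yi // mul0r subr0 -hom_ev; apply/eqP; move: tY; rewrite inE.
  (* Without its [i]-th coordinate the functional takes at [t] the mean of its values at [t] and at
     the reflection [t'], which is positive. *)
  - have /properP[_ [t _ tY]] := cov_proper cy; exists t; rewrite ?inE // dotE gt_eqF //; have [t' e] := sl_flip sl [set i]%SET t.
    have e' : v t' = flip [set rshift 1 i]%SET (v t) by rewrite /hom e hvec_flip imset_set1.
    have := ev_flip1 (aff a y) e'; rewrite !hom_ev /hom hvec_rshift aff_rshift => e2.
    have := w0 t'; rewrite hom_ev e2; have : 0 < ev v (aff a y) t.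
      by rewrite lt_def w0 andbT; move: tY; rewrite inE.
    rewrite hom_ev; lra.
  - by move=> j; rewrite inE => /eqP->; rewrite !mxE !eqxx mulr1 subrr.
  - by move=> t j tY; rewrite inE => /eqP->; exact: Yi.
  - by move=> j _; have [t e] := sl_eq sl j; exists t; rewrite ?inE // e oner_eq0.
  - by move=> S t _ _; apply: (flip_in sl) => t' _; rewrite inE.
have [j [b [tX XY]]] := cubic_between sl d0 eqf cy Fy tY.
have [ej|nj] := eqVneq j i; first by exists b; rewrite -ej.
have [t' e] := sl_flip sl [set i]%SET t.
have t'X : t' \in cubic j b by apply: cubic_flip tX e; rewrite inE.
have := facet_flip tY (fintype.subsetP XY _ t'X) e => /eqP.
by rewrite mulf_eq0 (negbTE ti) (negbTE yi).
Qed.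

(** A vertex on the face given by [facet_cubic] and its reflection in all other coordinates have a
    signed unit vector as midpoint, so that vector lies on the facet. *)
Lemma facet_coef i : y 0 i != 0 -> 0 < a /\ `|y 0 i| = a.
Proof.
move=> yi; have [b sX] := facet_cubic yi.
have [t0 e0] := sl_eq sl i.
have [t1 e1] := sl_flip sl (if b then [set i] else finset.set0)%SET t0.
have t1X : t1 \in cubic i b.
  by rewrite inE e1 mxE e0; case: (b); rewrite !inE ?eqxx.
have [t2 e2] := sl_flip sl [set~ i]%SET t1.
have t2X : t2 \in cubic i b by apply: cubic_flip t1X e2; rewrite !inE eqxx.
have /eqP z1 : ev v (aff a y) t1 == 0 by have := fintype.subsetP sX _ t1X; rewrite inE.
have /eqP z2 : ev v (aff a y) t2 == 0 by have := fintype.subsetP sX _ t2X; rewrite inE.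
have d1 : dotp (s t1) y = s t1 0 i * y 0 i + \sum_(k | k != i) s t1 0 k * y 0 k.
  by rewrite /dotp (bigD1 i).
have d2 : dotp (s t2) y = s t1 0 i * y 0 i - \sum_(k | k != i) s t1 0 k * y 0 k.
  rewrite /dotp (bigD1 i) //= e2 mxE !inE eqxx /=; congr (_ + _).
  by rewrite -sumrN; apply: eq_bigr => k ki; rewrite mxE !inE ki mulNr.
move: z1 z2; rewrite !hom_ev d1 d2; move: t1X; rewrite inE => /eqP ->.
set S := \sum_(k | _) _ => z1 z2.
have ea : a = - ((-1) ^+ b * y 0 i) by lra.
have a0 : 0 <= a.
  have [t3 e3] := sl_flip sl [set: 'I_d]%SET t0.
  have := w0 t0; have := w0 t3; rewrite !hom_ev.
  have -> : dotp (s t3) y = - dotp (s t0) y.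
    by rewrite /dotp -sumrN; apply: eq_bigr => k _; rewrite e3 mxE inE mulNr.
  lra.
have en : `|y 0 i| = a by rewrite -(ger0_norm a0) ea normrN normrM normrX normrN1 expr1n mul1r.
by split=> //; rewrite -en normr_gt0.
Qed.

Lemma facet_adj i j : i != j -> y 0 i != 0 -> y 0 j != 0 -> adj i j.
Proof.
move=> nij yi yj; have [b sX] := facet_cubic yi.
apply/negPn/negP => nadj; have [t ti tj] := nadj_point sl d0 eqf nij nadj.
have [t1 e1] := sl_flip sl (if b then [set i] else finset.set0)%SET t.
have t1X : t1 \in cubic i b.
  by rewrite inE e1 mxE ti; case: (b); rewrite !inE ?eqxx.
have [t2 e2] := sl_flip sl [set j]%SET t1.
have t2X : t2 \in cubic i b by apply: cubic_flip t1X e2; rewrite inE.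
have := facet_flip (fintype.subsetP sX _ t1X) (fintype.subsetP sX _ t2X) e2 => /eqP.
rewrite mulf_eq0 (negbTE yj) orbF e1 mxE tj; case: ifP => _; rewrite ?oppr_eq0 oner_eq0 //.
Qed.

(** By [facet_coef] and [facet_adj] the facet inequality is, up to the factor [a], a signed sum over
    a clique, where a stable vector has at most one nonzero coordinate. *)
Lemma facet_stable x : stable_vectors adj x -> 0 <= a + dotp x y.
Proof.
move=> [xv xs]; rewrite /dotp.
case: (pickP (fun i => x 0 i * y 0 i != 0)) => [i|h]; last first.
  rewrite big1 ?addr0; last by move=> i _; move: (h i) => /negbFE/eqP.
  case: (pickP (fun i => y 0 i != 0)) => [i /facet_coef[/ltW//]|h'].
  have [t0 _] := sl_eq sl (Ordinal d0); have := w0 t0; rewrite hom_ev /dotp big1 ?addr0 // => i _.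
  by move: (h' i) => /negbFE/eqP->; rewrite mulr0.
rewrite mulf_eq0 negb_or => /andP[xi yi]; rewrite (bigD1 i) //= big1 ?addr0.
  have [a0 <-] := facet_coef yi; case: (xv i) xi => ->; rewrite ?eqxx // => _.
    by rewrite mul1r; have := ler_norm (- y 0 i); rewrite normrN; lra.
  by rewrite mulN1r subr_ge0 ler_norm.
move=> j nji; have [->|yj] := eqVneq (y 0 j) 0; first by rewrite mulr0.
rewrite eq_sym in nji; case: (xs i j (facet_adj nji yi yj)) => e; first by rewrite e eqxx in xi.
by rewrite e mul0r.
Qed.

End Facet.

Lemma symmetric_stable : conv s [set: T]%SET = stable_polytope adj.
Proof.
apply/seteqP; split.
  by apply: convex_hullS => x [t _ <-]; exact: points_stable.
apply: convex_hull_conv => x sx; apply: contrapT => /convP_farkas[w w0 xw].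
have [w' [w'0 xw' cw']] := facet_separate (sl_full sl d0) w0 xw.
have [a [y ew]] := affP w'; rewrite {}ew in w'0 xw' cw'.
by have := facet_stable w'0 cw' sx; rewrite -hvec_aff leNgt xw'.
Qed.

(** * Excluding an induced path on four vertices *)

Section P4.
Variables (a b c z : 'I_d).
Hypotheses (ab : adj a b) (bc : adj b c) (cz : adj c z).
Hypotheses (nac : ~~ adj a c) (naz : ~~ adj a z) (nbz : ~~ adj b z).

Let adjs i j : adj i j = adj j i := adj_sym s i j.

(** For an edge, the intersection of the faces x_i + x_j + e x_u = 1, where e is 0, 1 or -1 and u is
    a common neighbour. *)
Definition edge_face i j : {set T} := [set t | (s t 0 i + s t 0 j == 1) &&
  [forall u, adj i u && adj j u ==> (s t 0 u == 0)]].

Lemma edge_face_face i j : adj i j -> isface (edge_face i j).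
Proof.
move=> ij; have nij : i != j by case/andP: ij.
have F1 u (e : R) : e = 0 \/ e = 1 \/ e = -1 -> (e == 0) || (adj i u && adj j u) ->
    isface [set t | s t 0 i + s t 0 j + e * s t 0 u == 1]%SET.
  move=> he hu; apply/isfaceP; exists (aff 1 (- (delta_mx 0 i + delta_mx 0 j + e *: delta_mx 0 u))).
    move=> t; rewrite hom_ev dotpNr !dotpDr dotpZr !dotp_delta.
    have [vi _] := points_stable t; have pi := vi i; have pj := vi j; have pu := vi u.
    have zij := adj0 (t := t) ij.
    have [e0|ne] := eqVneq e 0.
      rewrite e0 mul0r addr0; have [-> |/zij ->] := eqVneq (s t 0 i) 0.
        by rewrite add0r; case: pj => ->; lra.
      by rewrite addr0; case: pi => ->; lra.
    move: hu; rewrite (negbTE ne) /= => /andP[iu ju].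
    have [-> |ti] := eqVneq (s t 0 i) 0; last first.
      by rewrite (zij ti) (adj0 iu ti) mulr0 !addr0; case: pi => ->; lra.
    have [-> |tj] := eqVneq (s t 0 j) 0; last first.
      by rewrite (adj0 ju tj) mulr0 add0r !addr0; case: pj => ->; lra.
    by rewrite !add0r; case: pu => ->; case: he => [->|[->|->]]; lra.
  apply/setP => t; rewrite !inE hom_ev dotpNr !dotpDr dotpZr !dotp_delta.
  by rewrite subr_eq0 eq_sym.
have -> : edge_face i j = [set t | s t 0 i + s t 0 j + 0 * s t 0 i == 1]%SET :&:
   \bigcap_(u | adj i u && adj j u) ([set t | s t 0 i + s t 0 j + 1 * s t 0 u == 1]%SET :&:
      [set t | s t 0 i + s t 0 j + -1 * s t 0 u == 1]%SET).
  apply/setP => t; rewrite !inE mul0r addr0; case: eqP => //= e.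
  apply/forallP/bigcapP => h u.
    move=> hu; move: (h u); rewrite hu !inE => /eqP->; rewrite !mulr0 !addr0 e eqxx //.
  apply/implyP => hu; have := h u hu; rewrite !inE mul1r mulN1r e => /andP[/eqP h1 _].
  by apply/eqP; apply: (addrI 1); rewrite addr0.
apply: isfaceI; first by apply: F1; [left | rewrite eqxx].
apply: (big_ind (fun A : {set T} => isface A)) => [|A B|u hu]; [exact: isface_setT | exact: isfaceI |].
by apply: isfaceI; apply: F1; rewrite ?hu ?orbT //; [right; left | right; right].
Qed.

Lemma mem_edge i j t : adj i j -> s t 0 i = 1 -> t \in edge_face i j.
Proof.
move=> ij ti; have ti0 : s t 0 i != 0 by rewrite ti oner_eq0.
rewrite inE ti (adj0 ij ti0) addr0 eqxx /=; apply/forallP => u; apply/implyP => /andP[iu _].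
by rewrite (adj0 iu ti0).
Qed.

Lemma edgeC i j : edge_face i j = edge_face j i.
Proof.
apply/setP => t; rewrite !inE addrC; congr (_ && _); apply: eq_forallb => u.
by rewrite andbC.
Qed.

(** [X] and [W] share a vertex with x_a = x_c = 1 and have a join [U] inside [V], with rk U + rk (W
    :&: X) = rk W + rk X. The coordinates in [Ka] are free on [X], those in [Kb] are free on [W] but
    zero on its intersection with [X], and those in [N] vanish on [V]; hence #|Ka| + #|Kb| + 2 +
    #|N| <= d. But a, b, [N], [Ka] and [Kb] cover all indices, and z lies in both [Ka] and [Kb]. *)
Lemma P4_absurd : False.
Proof.
have nz_ab : a != b by case/andP: ab.
have nbc : b != c by case/andP: bc.
have n_ac : a != c by apply: contraNneq naz => ->.
have n_az : a != z by apply: contraNneq nbz => <-; rewrite adjs.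
have n_bz : b != z by apply: contraNneq naz => <-.
set X := cubic a false; set V := edge_face a b; set W := edge_face a b :&: edge_face b c.
have FV : isface V by apply: edge_face_face.
have FW : isface W by apply: isfaceI; apply: edge_face_face.
have FX : isface X by apply: cubic_face.
have XV : X \subset V.
  by apply/fintype.subsetP => t; rewrite inE expr0 => /eqP ta; apply: mem_edge.
have [t ta tc] := nadj_point sl d0 eqf n_ac nac.
have tX : t \in X by rewrite inE ta expr0.
have tW : t \in W by rewrite finset.in_setI mem_edge //= edgeC mem_edge // adjs.
have [t' e'] := sl_flip sl [set: 'I_d]%SET t.
have VT : V \proper [set: T]%SET.
  apply/properP; split; first exact: finset.subsetT.
  exists t'; rewrite ?inE //= e' !mxE !inE ta (adj0 ab) ?ta ?oner_eq0 //.
  by apply/negP => /andP[/eqP h _]; move: h; lra.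
have [y [Fy sVy cyT]] := covl_ex (faces_graded v) FV (isface_setT v) VT.
have esh := cubic_shuffles sl d0 eqf cyT Fy tX (fintype.subset_trans XV sVy).
have sXy := fintype.subset_trans XV sVy.
have sWy : W \subset y by apply: fintype.subset_trans sVy; exact: finset.subsetIl.
have tXs : [set t]%SET \subset X by rewrite finset.sub1set.
have tWs : [set t]%SET \subset W by rewrite finset.sub1set.
have [U [FU sU rU mU]] := shuffles_modular (faces_graded v) (sl_atom sl t) FX Fy tXs sXy esh FW tWs sWy.
have sUV : U \subset V by apply: mU => //; rewrite finset.subUset XV finset.subsetIl.
pose N : {set 'I_d} := [set u | adj a u && adj b u]%SET.
pose Ka : {set 'I_d} := [set u | (u != a) && ~~ adj a u]%SET.
pose Kb : {set 'I_d} := [set u | [&& u != b, ~~ adj b u & adj a u || adj c u]]%SET.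
have T0 t1 i j : adj i j -> s t1 0 i = 1 -> s t1 0 j = 0.
  by move=> ij ti; apply: adj0 ij _; rewrite ti oner_eq0.
have rV : (rk V + #|N|.+1 <= d.+1)%N.
  rewrite -(sl_full sl d0).
  apply: (@hom_rk_le _ _ _ s V [set: T]%SET N 1 (- (delta_mx 0 a + delta_mx 0 b))).
  - exact: finset.subsetT.
  - move=> i; rewrite inE => /andP[/eqP h _].
    by rewrite dotpNr dotpDr !dotp_delta h subrr.
  - exists t'; rewrite ?inE // dotpNr dotpDr !dotp_delta e' !mxE !inE ta (adj0 ab) ?ta ?oner_eq0 //.
    by rewrite oppr0 addr0 opprK (_ : 1 + 1 = 2%:R) ?pnatr_eq0.
  - move=> j; rewrite inE => /andP[aj bj]; rewrite !mxE /=.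
    have /negbTE nja : j != a by apply: contraTneq aj => ->; rewrite adj_irr.
    have /negbTE njb : j != b by apply: contraTneq bj => ->; rewrite adj_irr.
    by rewrite nja njb addr0 oppr0.
  - by move=> i j; rewrite !inE => /andP[_ /forallP/(_ j)] /implyP h /h /eqP.
  - by move=> j _; have [t1 e1] := sl_eq sl j; exists t1; rewrite ?inE // e1 oner_eq0.
  - by move=> S t1 _ _; apply: (flip_in sl) => t2 _; rewrite inE.
have rX : (#|Ka|.+1 <= rk X)%N.
  have : (rk finset.set0 + #|Ka|.+1 <= rk X)%N; last by rewrite rk_set0 add0n.
  apply: (@hom_rk_le _ _ _ s _ _ Ka 1 0).
  - exact: finset.sub0set.
  - by move=> i; rewrite inE.
  - by exists t => //; rewrite dotp0r addr0 oner_eq0.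
  - by move=> j _; rewrite mxE.
  - by move=> i j; rewrite inE.
  - move=> j; rewrite inE => /andP[nja naj].
    rewrite eq_sym in nja; have [t1 e1 e2] := nadj_point sl d0 eqf nja naj.
    by exists t1; rewrite ?inE ?e1 ?expr0 // e2 oner_eq0.
  - move=> S t1 sS t1X; apply: (flip_in sl) => t2 e2; apply: cubic_flip t1X e2.
    by apply/negP => /(fintype.subsetP sS); rewrite inE eqxx.
have rW : (rk (W :&: X) + #|Kb|.+1 <= rk W)%N.
  have bW t1 : s t1 0 b = 1 -> t1 \in W.
    by move=> e1; rewrite finset.in_setI edgeC !mem_edge // adjs.
  have [t1 e1 e2] := nadj_point sl d0 eqf n_bz nbz.
  apply: (@hom_rk_le _ _ _ s _ _ Kb 0 (delta_mx 0 b)).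
  - exact: finset.subsetIl.
  - move=> i; rewrite finset.in_setI => /andP[_]; rewrite inE expr0 => /eqP ia.
    by rewrite dotp_delta (T0 _ _ _ ab ia) addr0.
  - by exists t1; [exact: bW | rewrite dotp_delta e1 add0r oner_eq0].
  - by move=> j; rewrite inE => /andP[/negbTE nj _]; rewrite mxE eqxx nj.
  - move=> i j; rewrite finset.in_setI => /andP[iW]; rewrite inE expr0 => /eqP ia.
    rewrite inE => /and3P[njb nbj /orP[aj|cj]]; first exact: T0 aj ia.
    have ib := T0 _ _ _ ab ia.
    move: iW; rewrite !inE => /andP[_ /andP[/eqP + _]]; rewrite ib add0r => ic.
    exact: T0 cj ic.
  - move=> j; rewrite inE => /and3P[njb nbj _]; rewrite eq_sym in njb.
    have [t2 e3 e4] := nadj_point sl d0 eqf njb nbj.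
    by exists t2; [exact: bW | rewrite e4 oner_eq0].
  - move=> S t2 sS t2W; apply: (flip_in sl) => t3 e3.
    have nS j : (j == b) || adj b j -> j \notin S.
      move=> hj; apply/negP => /(fintype.subsetP sS); rewrite inE => /and3P[nj nbj _].
      by case/orP: hj; [rewrite (negbTE nj) | rewrite (negbTE nbj)].
    have bS : b \notin S by apply: nS; rewrite eqxx.
    have aS : a \notin S by apply: nS; rewrite adjs ab orbT.
    have cS : c \notin S by apply: nS; rewrite bc orbT.
    move: t2W; rewrite !inE e3 !mxE (negbTE aS) (negbTE bS) (negbTE cS).
    move=> /andP[/andP[-> /forallP h1] /andP[-> /forallP h2]] /=.
    by apply/andP; split; apply/forallP => u; apply/implyP => hu; rewrite mxE;
     [move: (h1 u)|move: (h2 u)]; rewrite hu => /eqP->; rewrite oppr0 if_same.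
(* [z] is dropped from [Kb] because it is in [Ka] already; this saves the one that contradicts the
   rank bound. *)
have cover : [set: 'I_d]%SET \subset [set a; b]%SET :|: N :|: Ka :|: (Kb :\ z).
  apply/fintype.subsetP => u _; rewrite !inE.
  have [//|nua] := eqVneq u a; have [//|nub] := eqVneq u b; rewrite /=.
  case: (boolP (adj a u)) => au; rewrite ?orbT //=.
  case: (boolP (adj b u)) => bu //=; rewrite ?andbT ?orbF.
  by apply: contraNneq naz => <-.
have zKa : z \in Ka by rewrite inE naz eq_sym n_az.
have zKb : z \in Kb by rewrite inE nbz eq_sym n_bz cz orbT.
have cc := subset_leq_card cover; rewrite cardsT card_ord in cc.
have c1 := cardsU [set a; b] N; have c2 := cardsU ([set a; b] :|: N) Ka.
have c3 := cardsU ([set a; b] :|: N :|: Ka) (Kb :\ z).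
have c4 : #|[set a; b]%SET| = 2%N by rewrite cards2 nz_ab.
have c5 := cardsD1 z Kb; rewrite zKb add1n in c5.
have rUV := rkS v sUV.
have ar (p q r w i n ka kb kb' u1 u2 u3 i1 i2 i3 h : nat) :
  (q + n.+1 <= d.+1)%N -> (ka.+1 <= r)%N -> (i + kb.+1 <= w)%N -> (p + i = w + r)%N ->
  (p <= q)%N -> (d <= u3)%N -> (u1 = h + n - i1)%N -> (u2 = u1 + ka - i2)%N ->
  (u3 = u2 + kb' - i3)%N -> (h = 2)%N -> (kb = kb'.+1)%N -> False.
  by clear; lia.
exact: (ar _ _ _ _ _ _ _ _ _ _ _ _ _ _ _ _ rV rX rW rU rUV cc c1 c2 c3 c4 c5).
Qed.

End P4.

Lemma adj_P4_free : P4_free adj.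
Proof. by move=> a b c z *; apply: (@P4_absurd a b c z). Qed.

End Stable.

(** * Symmetrisation in one coordinate *)

Section Irredundant.
Variables (R : realType) (d : nat).

Lemma conv_farkas (T : finType) (s : T -> 'rV[R]_d) (I : {set T}) x :
  (forall w, (forall i, i \in I -> 0 <= ev (hom s) w i) -> 0 <= (hvec x *m w) 0 0) -> conv s I x.
Proof.
move=> h; have [|l [l0 e]] := @farkas_seq R (1 + d) T (enum I) (hom s) (hvec x) (enum_uniq _).
  by move=> w hw; apply: h => i iI; apply: hw; rewrite mem_enum.
have e' : hvec x = \sum_i (if i \in I then l i else 0) *: hom s i.
  rewrite e big_enum big_mkcond /=; apply: eq_bigr => i _.
  by case: ifP => // _; rewrite scale0r.
have [l1 ex] := hvec_sumV e'; apply/convP; exists (fun i => if i \in I then l i else 0).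
by split=> // [i|i /negbTE->//]; case: ifP.
Qed.

(** In a shortest list of generators no point is in the hull of the others, so some functional is
    negative at that point only. Subtracting its value there makes it zero at the point and positive
    at the others. *)
Lemma polytope_irredundant (P : set 'rV[R]_d) : polytope P ->
  exists (T : finType) (s : T -> 'rV[R]_d), P = conv s [set: T]%SET /\
    forall t, isface (hom s) [set t]%SET.
Proof.
pose A n := `[< exists l : seq 'rV[R]_d, size l = n /\ P = convex_hull [set` l] >].
case=> l0 e0; have exA : exists n, A n by exists (size l0); apply/asboolP; exists l0.
case: (ex_minnP exA) => n /asboolP[l [sz eP]] nmin.
have convE (m : seq 'rV[R]_d) : convex_hull [set` m] = conv (fun i : 'I_(size m) => m`_i) [set: _]%SET.
  congr convex_hull; apply/seteqP; split=> x /=.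
    move=> xm; have im : (index x m < size m)%N by rewrite index_mem.
    by exists (Ordinal im) => //=; rewrite ?finset.in_setT // nth_index.
  by case=> i _ <-; exact: mem_nth.
pose s (i : 'I_(size l)) := l`_i.
exists 'I_(size l), s; split; first by rewrite eP convE.
move=> t.
have nt : ~ conv s (~: [set t])%SET (s t).
  move=> ct; have : A (size l).-1.
    apply/asboolP; exists [seq s i | i <- enum (~: [set t])%SET]; split.
      by rewrite size_map -cardE cardsC1 card_ord.
    rewrite eP convE; apply/seteqP; split; last first.
      apply: convex_hullS => x /= /mapP[i _ ->]; exists i => //=; exact: finset.in_setT.
    move=> x cx; have : conv s (~: [set t])%SET x.
      apply: conv_farkas => w hw; apply: (conv_ge0 cx) => i _.
      have [->|nit] := eqVneq i t; last by apply: hw; rewrite !inE.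
      exact: (conv_ge0 ct hw).
    apply: convex_hullS => _ [i /= ic <-]; apply: map_f.
    by rewrite mem_enum.
  move/nmin; rewrite -sz; case: (size l) t {ct} => [[]//|k _]; by rewrite ltnn.
have [w hw wt] : exists2 w, (forall i, i != t -> 0 <= ev (hom s) w i) & ev (hom s) w t < 0.
  apply: contrapT => h; apply: nt; apply: conv_farkas => w hw.
  rewrite leNgt; apply/negP => h'; apply: h; exists w => // i nit; apply: hw.
  by rewrite !inE.
have wE i : ev (hom s) (w - ev (hom s) w t *: aff 1 0) i = ev (hom s) w i - ev (hom s) w t.
  by rewrite evB evZ hom_ev dotp0r addr0 mulr1.
have pos i : i != t -> 0 < ev (hom s) (w - ev (hom s) w t *: aff 1 0) i.
  by move=> /hw h; rewrite wE; lra.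
apply/isfaceP; exists (w - ev (hom s) w t *: aff 1 0) => [i|].
  by have [->|/pos/ltW//] := eqVneq i t; rewrite wE subrr.
apply/setP => i; rewrite !inE; have [->|/pos h] := eqVneq i t; first by rewrite wE subrr eqxx.
by rewrite gt_eqF.
Qed.

End Irredundant.

(** * Normalized locally anti-blocking polytopes *)

Section Lab.
Variables (R : realType) (d : nat).
Implicit Types (P : set 'rV[R]_d) (x : 'rV[R]_d).

Definition zero_at l x : 'rV[R]_d := \row_k (if k == l then 0 else x 0 k).
Definition abs_at l x : 'rV[R]_d := \row_k (if k == l then `|x 0 k| else x 0 k).
Definition opp_at l x : 'rV[R]_d := \row_k (if k == l then - x 0 k else x 0 k).

Lemma opp_atE l x : opp_at l x = flip [set l]%SET x.
Proof. by apply/rowP => k; rewrite !mxE inE. Qed.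

(** Free of projections and support functions, this form passes directly to reflections and
    symmetrisations. *)
Record lab P : Prop := Lab {
  lab_poly : polytope P;
  lab_zero : forall l x, P x -> P (zero_at l x);
  lab_le : forall l x, P x -> x 0 l <= 1;
  lab_ge : forall l x, P x -> -1 <= x 0 l;
  lab_unit : forall l, P (delta_mx 0 l);
  lab_unitN : forall l, P (- delta_mx 0 l) }.

Definition mirrored l P := forall x, P x -> P (opp_at l x).

Lemma conv_lab_full (T : finType) (s : T -> 'rV[R]_d) : (0 < d)%N -> lab (conv s [set: T]%SET) ->
  rk (hom s) [set: T]%SET = d.+1.
Proof.
move=> d0 lP; apply/eqP; rewrite eqn_leq; apply/andP; split; first by rewrite /rk rank_leq_row.
have : (rk (hom s) finset.set0 + #|[set: 'I_(1 + d)]%SET| <= rk (hom s) [set: T]%SET)%N; last first.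
  by rewrite rk_set0 cardsT card_ord.
apply: (@rk_indep R (1 + d) T (hom s) 'I_(1 + d) _ (fun j => delta_mx j 0)).
- exact: finset.subsetT.
- by move=> i j; rewrite inE.
move=> c hc; pose w := \sum_j c j *: (delta_mx j 0 : 'cV[R]_(1 + d)).
have wE j : w j 0 = c j.
  rewrite summxE (bigD1 j) //= !mxE !eqxx mulr1 big1 ?addr0 // => k nk.
  by rewrite !mxE eq_sym (negbTE nk) mulr0.
have w0 i : ev (hom s) w i = 0.
  rewrite -[RHS](hc i (finset.in_setT i)) /ev mulmx_sumr summxE.
  apply: eq_big => [k|k _]; first by rewrite inE.
  by rewrite -scalemxAr mxE.
have Pw x : conv s [set: T]%SET x -> (hvec x *m w) 0 0 = 0.
  by move=> cx; apply: (conv_eq0 cx).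
have [a [y ew]] := affP w; rewrite {}ew in wE Pw.
have yj j : y 0 j = 0.
  have := Pw _ (lab_unit lP j); have := Pw _ (lab_unitN lP j).
  rewrite !hvec_aff dotpNl !(dotpC (delta_mx _ _)) dotp_delta; lra.
have a0 : a = 0.
  have := Pw _ (lab_unit lP (Ordinal d0)); rewrite hvec_aff dotpC dotp_delta yj; lra.
move=> k _; rewrite -wE; case: (split_ordP k) => j ->; last by rewrite aff_rshift yj.
by rewrite /aff col_mxEu a0 mxE mul0rn.
Qed.

Lemma flipS P (S : {set 'I_d}) : (forall l, mirrored l P) -> forall x, P x -> P (flip S x).
Proof.
move=> mir; elim: {S}_.+1 {-2}S (ltnSn #|S|) => // n IH S hS x Px.
have [->|[l lS]] := set_0Vmem S.
  by rewrite (_ : flip _ x = x) //; apply/rowP => k; rewrite mxE inE.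
have -> : flip S x = opp_at l (flip (S :\ l)%SET x).
  by apply/rowP => k; rewrite !mxE !inE; case: eqP => [->|]; rewrite ?lS.
by apply: mir; apply: IH => //; move: hS; rewrite (cardsD1 l S) lS.
Qed.

(** The reflection of a vertex is exposed by the reflected functional; as it is the only point so
    exposed, it must be one of the generators. *)
Lemma mirrored_symmetric_list P : lab P -> (forall l, mirrored l P) ->
  exists (T : finType) (s : T -> 'rV[R]_d), P = conv s [set: T]%SET /\ symmetric_list s.
Proof.
move=> lP mir; have [T [s [eP atom]]] := polytope_irredundant (lab_poly lP).
exists T, s; split=> //; have Ps t : P (s t) by rewrite eP; apply: conv_in; exact: finset.in_setT.
split=> //.
- move=> S t; have [w w0 w1] := isface_pos (atom t).
  have hw x : P x -> 0 <= (hvec x *m w) 0 0.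
    rewrite eP => cx; apply: (conv_ge0 cx) => i _.
    by case: (boolP (i \in [set t]%SET)) => [/w0->//|/w1/ltW].
  have uniq x : P x -> (hvec x *m w) 0 0 = 0 -> x = s t.
    rewrite eP => cx x0.
    have hw' i : i \in [set: T]%SET -> 0 <= ev (hom s) w i.
      by move=> _; case: (boolP (i \in [set t]%SET)) => [/w0->//|/w1/ltW].
    have /convP[l [_ l0 l1 ->]] := conv_zeros cx hw' x0.
    have l0' i : i != t -> l i = 0.
      by move=> nit; apply: l0; rewrite !inE gt_eqF // w1 // inE.
    rewrite (bigD1 t) //= big1 ?addr0; last by move=> i /l0' ->; rewrite scale0r.
    by move: l1; rewrite (bigD1 t) //= big1 ?addr0 => [->|i /l0'//]; rewrite scale1r.
  pose w' : 'cV[R]_(1 + d) := (flip ([set rshift 1 j | j in S]%SET) w^T)^T.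
  have w'E x : (hvec x *m w') 0 0 = (hvec (flip S x) *m w) 0 0.
    rewrite mxE [RHS]mxE; apply: eq_bigr => k _.
    have -> : w' k 0 = if k \in [set rshift 1 j | j in S]%SET then - w k 0 else w k 0.
      by rewrite /w' !mxE.
    have -> : hvec (flip S x) 0 k =
        if k \in [set rshift 1 j | j in S]%SET then - hvec x 0 k else hvec x 0 k.
      by rewrite hvec_flip mxE.
    by case: ifP; rewrite ?mulrN ?mulNr.
  have ff x : flip S (flip S x) = x.
    by apply/rowP => k; rewrite !mxE; case: (k \in S); rewrite ?opprK.
  have q0 : P (flip S (s t)) by apply: flipS.
  move: (q0); rewrite {1}eP => cq.
  have hw' i : i \in [set: T]%SET -> 0 <= ev (hom s) w' i.
    by move=> _; rewrite /ev w'E; apply: hw; apply: flipS.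
  have q1 : (hvec (flip S (s t)) *m w') 0 0 = 0.
    by rewrite w'E ff; apply: w0; rewrite inE.
  have := conv_zeros cq hw' q1.
  have [->|[t' +] _] := set_0Vmem [set i in [set: T]%SET | ev (hom s) w' i == 0]%SET.
    by rewrite conv0 => /= h; case: h.
  rewrite !inE /= /ev w'E => /eqP h; exists t'.
  by rewrite -(uniq _ (flipS S mir (Ps t')) h) ff.
- by move=> t j; exact: (lab_le lP j (Ps t)).
(* A unit vector is a convex combination of points with [j]-th coordinate at most 1, so one of these
   attains 1. *)
- move=> j; have := lab_unit lP j; rewrite eP => /convP[l [l0 _ l1 e]].
  apply: contrapT => h; have lt t : s t 0 j < 1.
    by rewrite lt_neqAle (lab_le lP) // andbT; apply/eqP => h'; apply: h; exists t.
  have : (delta_mx 0 j : 'rV[R]_d) 0 j = 1 by rewrite mxE !eqxx.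
  rewrite e summxE => e1; have e0 : \sum_t l t * (1 - s t 0 j) = 0.
    transitivity (\sum_t l t - \sum_t (l t *: s t) 0 j); last by rewrite l1 e1 subrr.
    by rewrite -sumrB; apply: eq_bigr => t _; rewrite mxE mulrBr mulr1.
  have l00 t : l t = 0.
    move/eqP: e0; rewrite psumr_eq0 => [/allP/(_ t (mem_index_enum t))|t' _].
      by rewrite mulf_eq0 subr_eq0 [1 == _]eq_sym (lt_eqF (lt t)) orbF => /eqP.
    by rewrite mulr_ge0 // subr_ge0 ltW.
  by move: l1; rewrite big1 // => /eqP; rewrite eq_sym oner_eq0.
Qed.

End Lab.

(** * Reflecting one half of a polytope *)

Section Coordinate.
Variables (R : realType) (d : nat).
Implicit Types (P : set 'rV[R]_d) (x : 'rV[R]_d).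

Lemma polytope_conv (T : finType) (s : T -> 'rV[R]_d) : polytope (conv s [set: T]%SET).
Proof.
exists [seq s i | i <- enum T]; congr convex_hull; apply/seteqP; split=> x /=.
  by case=> i _ <-; apply: map_f; rewrite mem_enum.
by case/mapP=> i _ ->; exists i => //=; exact: finset.in_setT.
Qed.

Lemma polytopeP P : polytope P -> exists (T : finType) (s : T -> 'rV[R]_d), P = conv s [set: T]%SET.
Proof. by move=> /polytope_irredundant[T [s [e _]]]; exists T, s. Qed.

Lemma conv_comb (T U : finType) (s : T -> 'rV[R]_d) (l : U -> R) (p : U -> 'rV[R]_d) :
  (forall i, 0 <= l i) -> \sum_i l i = 1 -> (forall i, conv s [set: T]%SET (p i)) ->
  conv s [set: T]%SET (\sum_i l i *: p i).
Proof.
move=> l0 l1 hp; apply: conv_setT => w w0.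
rewrite (hvec_sum l1 erefl) mulmx_suml summxE; apply: sumr_ge0 => i _.
by rewrite -scalemxAl mxE mulr_ge0 // (conv_ge0 (hp i)).
Qed.

Lemma opp_atK l : involutive (@opp_at R d l).
Proof. by move=> x; apply/rowP => k; rewrite !mxE; case: (k == l); rewrite ?opprK. Qed.

Lemma opp_at_comb (U : finType) l (c : U -> R) (p : U -> 'rV[R]_d) :
  opp_at l (\sum_i c i *: p i) = \sum_i c i *: opp_at l (p i).
Proof.
apply/rowP => k; rewrite mxE !summxE; case: ifP => h.
  by rewrite -sumrN; apply: eq_bigr => i _; rewrite !mxE h mulrN.
by apply: eq_bigr => i _; rewrite !mxE h.
Qed.

Lemma dotp_opp l x v : dotp (opp_at l x) v = dotp x v - 2 * (x 0 l * v 0 l).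
Proof.
rewrite /dotp (bigD1 l) //= [in RHS](bigD1 l) //= mxE eqxx.
rewrite (eq_bigr (fun i => x 0 i * v 0 i)); first by ring.
by move=> i ni; rewrite mxE (negbTE ni).
Qed.

Lemma dotp_zero l x v : dotp (zero_at l x) v = dotp x v - x 0 l * v 0 l.
Proof.
rewrite /dotp (bigD1 l) //= [in RHS](bigD1 l) //= mxE eqxx.
rewrite (eq_bigr (fun i => x 0 i * v 0 i)); first by ring.
by move=> i ni; rewrite mxE (negbTE ni).
Qed.

Lemma abs_at_ge0 l x : 0 <= x 0 l -> abs_at l x = x.
Proof. by move=> h; apply/rowP => k; rewrite mxE; case: eqP => // ->; rewrite ger0_norm. Qed.

Lemma abs_at_le0 l x : x 0 l <= 0 -> abs_at l x = opp_at l x.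
Proof. by move=> h; apply/rowP => k; rewrite !mxE; case: eqP => // ->; rewrite ler0_norm. Qed.

Lemma opp_at_id l x : x 0 l = 0 -> opp_at l x = x.
Proof. by move=> h; apply/rowP => k; rewrite mxE; case: eqP => // ->; rewrite h oppr0. Qed.

Lemma opp_at_coord l x : opp_at l x 0 l = - x 0 l.
Proof. by rewrite mxE eqxx. Qed.

Lemma zero_at_coord l x : zero_at l x 0 l = 0.
Proof. by rewrite mxE eqxx. Qed.

Lemma opp_at_delta l k : opp_at l (delta_mx 0 k : 'rV[R]_d) = (if k == l then - delta_mx 0 k else delta_mx 0 k).
Proof.
have [->|n] := eqVneq k l; apply/rowP => i; rewrite !mxE /=; have [e|n'] := eqVneq i l => //=.
  by rewrite oppr0.
by rewrite e eq_sym (negbTE n) oppr0.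
Qed.

Definition mirror l P : set 'rV[R]_d := [set x | P (opp_at l x)].

Lemma mirrorK l P : mirror l (mirror l P) = P.
Proof. by apply/seteqP; split=> x; rewrite /mirror /= opp_atK. Qed.

Lemma lab_mirror l P : lab P -> lab (mirror l P).
Proof.
move=> lP; split.
- have [T [s e]] := polytopeP (lab_poly lP).
  have -> : mirror l P = conv (fun t => opp_at l (s t)) [set: T]%SET; last exact: polytope_conv.
  apply/seteqP; split=> x; rewrite /mirror /= e => /convP[c [c0 _ c1 ex]].
    apply/convP; exists c; split=> // [i|]; first by rewrite finset.in_setT.
    by rewrite -opp_at_comb -ex opp_atK.
  apply/convP; exists c; split=> // [i|]; first by rewrite finset.in_setT.
  by rewrite ex -opp_at_comb opp_atK.
- move=> k x; rewrite /mirror /= => /(lab_zero lP k); congr P.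
  by apply/rowP => i; rewrite !mxE; case: eqP; case: eqP; rewrite ?oppr0.
- move=> k x /= Px; have := lab_le lP k Px; have := lab_ge lP k Px; rewrite mxE.
  case: eqP => // _; lra.
- move=> k x /= Px; have := lab_le lP k Px; have := lab_ge lP k Px; rewrite mxE.
  case: eqP => // _; lra.
- move=> k; rewrite /mirror /= opp_at_delta; case: ifP => _.
    exact: lab_unitN. exact: lab_unit.
- move=> k; rewrite /mirror /=; have -> : opp_at l (- delta_mx 0 k : 'rV[R]_d) = - opp_at l (delta_mx 0 k).
    by apply/rowP => i; rewrite !mxE; case: ifP.
  rewrite opp_at_delta; case: ifP => _; rewrite ?opprK.
    exact: lab_unit. exact: lab_unitN.
Qed.

(** The half x_l >= 0 together with its mirror image. The double of the other half is
    [sym l (mirror l P)]. *)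
Definition sym l P : set 'rV[R]_d := [set x | P (abs_at l x)].

Lemma sym_ge0 l P x : 0 <= x 0 l -> sym l P x <-> P x.
Proof. by move=> h; rewrite /sym /= abs_at_ge0. Qed.

Lemma sym_le0 l P x : x 0 l <= 0 -> sym l P x <-> P (opp_at l x).
Proof. by move=> h; rewrite /sym /= abs_at_le0. Qed.

Lemma sym_mirrored l P : mirrored l (sym l P).
Proof.
move=> x; rewrite /sym /=; congr P; apply/rowP => k.
by rewrite !mxE; case: eqP => // _; rewrite normrN.
Qed.

Lemma mirrored_sym j l P : mirrored j P -> mirrored j (sym l P).
Proof.
move=> h x; rewrite /sym /=; have [->|njl] := eqVneq j l; first exact: sym_mirrored.
move/h; congr P; apply/rowP => k; rewrite !mxE.
by case: (eqVneq k l) => [->|] //; rewrite eq_sym (negbTE njl).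
Qed.

Lemma mirrored_mirror j l P : mirrored j P -> mirrored j (mirror l P).
Proof.
move=> h x; rewrite /mirror /= => /h; congr P; apply/rowP => k; rewrite !mxE.
by case: eqP; case: eqP.
Qed.

Lemma lab_shrink l P (x y : 'rV[R]_d) : lab P -> P x -> 0 <= y 0 l <= x 0 l ->
  (forall k, k != l -> y 0 k = x 0 k) -> P y.
Proof.
move=> lP Px /andP[y0 yx] e; have [T [s eP]] := polytopeP (lab_poly lP).
have Pz := lab_zero lP l Px.
have [x0|x0] := eqVneq (x 0 l) 0.
  suff -> : y = x by []; apply/rowP => k; have [->|/e//] := eqVneq k l.
  by apply/eqP; rewrite x0 eq_le y0 -x0 yx.
have xp : 0 < x 0 l by rewrite lt_def x0 (le_trans y0).
pose t := y 0 l / x 0 l; have t0 : 0 <= t by rewrite divr_ge0 // ltW.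
have t1 : t <= 1 by rewrite ler_pdivrMr // mul1r.
have -> : y = \sum_(b : bool) (if b then t else 1 - t) *: (if b then x else zero_at l x).
  rewrite big_bool /=; apply/rowP => k; rewrite !mxE; have [->|n] := eqVneq k l.
    by rewrite mulr0 addr0 divfK.
  by rewrite e //; ring.
rewrite eP; apply: conv_comb; first by case=> //; rewrite subr_ge0.
  by rewrite big_bool /= addrC subrK.
by rewrite -eP; case.
Qed.

Lemma sym_comb (U : finType) l P (c : U -> R) (p : U -> 'rV[R]_d) : lab P ->
  (forall i, 0 <= c i) -> \sum_i c i = 1 -> (forall i, sym l P (p i)) -> sym l P (\sum_i c i *: p i).
Proof.
move=> lP c0 c1 hp; have [T [s eP]] := polytopeP (lab_poly lP).
have Pq : P (\sum_i c i *: abs_at l (p i)) by rewrite {1}eP; apply: conv_comb => // i; rewrite -eP; exact: hp.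
apply: (@lab_shrink l _ _ _ lP Pq); last first.
  move=> k nk; rewrite [LHS]mxE (negbTE nk) !summxE; apply: eq_bigr => i _.
  by rewrite !mxE (negbTE nk).
have -> : abs_at l (\sum_i c i *: p i) 0 l = `|(\sum_i c i *: p i) 0 l| by rewrite [LHS]mxE eqxx.
rewrite normr_ge0 /= !summxE (le_trans (ler_norm_sum _ _ _)) //.
by apply: ler_sum => i _; rewrite !mxE eqxx normrM (ger0_norm (c0 i)).
Qed.

(** Convexity is [sym_comb]. As finite generating set serve the generators with x_l >= 0, their
    reflections and the projections of all generators to x_l = 0. *)
Lemma polytope_sym l P : lab P -> polytope (sym l P).
Proof.
move=> lP; have [T [s eP]] := polytopeP (lab_poly lP).
have Ps t : P (s t) by rewrite eP; apply: conv_in; exact: finset.in_setT.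
pose q (tb : T * option bool) : 'rV[R]_d := if tb.2 is Some b then
   (if 0 <= s tb.1 0 l then (if b then opp_at l (s tb.1) else s tb.1) else zero_at l (s tb.1))
   else zero_at l (s tb.1).
have sq tb : sym l P (q tb).
  have z t : sym l P (zero_at l (s t)).
    by apply/sym_ge0; [rewrite zero_at_coord | exact: lab_zero].
  case: tb => t; case=> [b|]; rewrite /q //=; case: ifP => // h.
  have hs : sym l P (s t) by apply/sym_ge0.
  by case: b => //; apply: sym_mirrored.
have qopp tb : conv q [set: _]%SET (opp_at l (q tb)).
  have [tb' ->] : exists tb', opp_at l (q tb) = q tb'.
    have z t : opp_at l (zero_at l (s t)) = zero_at l (s t) by rewrite (opp_at_id (zero_at_coord l (s t))).
    case: tb => t; case=> [b|]; last by exists (t, None); exact: z.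
    case h : (0 <= s t 0 l); last by exists (t, None); rewrite /q /= h z.
    by exists (t, Some (~~ b)); rewrite /q /= h; case: b; rewrite ?opp_atK.
  by apply: conv_in; exact: finset.in_setT.
have copp x : conv q [set: _]%SET x -> conv q [set: _]%SET (opp_at l x).
  by case/convP=> c [c0 _ c1 ->]; rewrite opp_at_comb; apply: conv_comb.
have pos x : P x -> 0 <= x 0 l -> conv q [set: _]%SET x.
  move=> Px x0; move: (Px); rewrite {1}eP => /convP[c [c0 _ c1 ex]].
  pose A := \sum_(t | 0 <= s t 0 l) c t * s t 0 l.
  have xl : x 0 l = A + \sum_(t | ~~ (0 <= s t 0 l)) c t * s t 0 l.
    rewrite ex summxE (bigID (fun t => 0 <= s t 0 l)) /=.
    by congr (_ + _); apply: eq_bigr => t _; rewrite mxE.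
  have B0 : \sum_(t | ~~ (0 <= s t 0 l)) c t * s t 0 l <= 0.
    apply: sumr_le0 => t; rewrite -ltNge => /ltW h; exact: mulr_ge0_le0.
  have A0 : 0 <= A by lra.
  (* Negative contributions to coordinate [l] are projected away, and the positive ones, of total
     [A], are scaled down by [th] to compensate. If A = 0 then x_l = 0, and [th] is 0 by the
     convention for division. *)
  pose th := x 0 l / A.
  have th0 : 0 <= th by rewrite divr_ge0.
  have th1 : th <= 1.
    rewrite /th; have [->|nA] := eqVneq A 0; first by rewrite invr0 mulr0 ler01.
    by rewrite ler_pdivrMr ?mul1r ?lt_def ?nA //; lra.
  have thA : th * A = x 0 l.
    rewrite /th; have [eA|nA] := eqVneq A 0; last by rewrite divfK.
    by rewrite eA mulr0; lra.
  have -> : x = \sum_t c t *: (th *: q (t, Some false) + (1 - th) *: q (t, None)).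
    apply/rowP => k; rewrite {1}ex !summxE; have [->|n] := eqVneq k l.
      transitivity (x 0 l); first by rewrite ex summxE.
      rewrite -thA /A big_distrr /= big_mkcond /=; apply: eq_bigr => t _; rewrite /q /=.
      by case: ifP => h; rewrite !mxE !eqxx ?mxE; ring.
    apply: eq_bigr => t _; rewrite /q /=; case: ifP => h; rewrite !mxE (negbTE n) ?mxE ?(negbTE n); ring.
  apply: conv_comb => // t.
  have -> : th *: q (t, Some false) + (1 - th) *: q (t, None) =
    \sum_(b : bool) (if b then th else 1 - th) *: q (t, if b then Some false else None).
    by rewrite big_bool.
  apply: conv_comb; first by case=> //; rewrite subr_ge0.
    by rewrite big_bool /= addrC subrK.
  by move=> b; apply: conv_in; exact: finset.in_setT.
suff -> : sym l P = conv q [set: _]%SET by exact: polytope_conv.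
apply/seteqP; split=> x; last by case/convP=> c [c0 _ c1 ->]; apply: sym_comb.
case: (lerP 0 (x 0 l)) => h; first by move/(sym_ge0 _ h) => Px; exact: pos.
move/(sym_le0 _ (ltW h)) => Px; rewrite -[x](opp_atK l); apply: copp; apply: pos => //.
by rewrite opp_at_coord oppr_ge0 ltW.
Qed.

Lemma lab_sym l P : lab P -> lab (sym l P).
Proof.
move=> lP; split.
- exact: polytope_sym.
- move=> k x; rewrite /sym /= => /(lab_zero lP k); congr P.
  by apply/rowP => i; rewrite !mxE; case: eqP; case: eqP; rewrite ?normr0.
- move=> k x Px; have := lab_le lP k Px; rewrite mxE; case: eqP => // _.
  by apply: le_trans; exact: ler_norm.
- move=> k x Px; have := lab_le lP k Px; have := lab_ge lP k Px; rewrite mxE; case: eqP => // _ _.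
  by have := ler_norm (- x 0 k); rewrite normrN; lra.
- move=> k; apply/sym_ge0; last exact: lab_unit.
  by rewrite mxE; case: eqP; rewrite ?ler01 ?lexx //= => _; case: eqP.
- move=> k; have [->|n] := eqVneq k l.
    have -> : - delta_mx 0 l = opp_at l (delta_mx 0 l : 'rV[R]_d) by rewrite opp_at_delta eqxx.
    by apply: sym_mirrored; apply/sym_ge0; [rewrite mxE !eqxx ler01 | exact: lab_unit].
  by apply/sym_ge0; [rewrite !mxE eq_sym (negbTE n) oppr0 | exact: lab_unitN].
Qed.

End Coordinate.

Section FaceIn.
Variables (R : realType) (d : nat).
Implicit Types (P F G : set 'rV[R]_d) (x y v : 'rV[R]_d).

Lemma face_in P G a y : polytope P -> face P G -> (forall x, G x -> 0 <= a + dotp x y) ->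
  face P [set x | G x /\ a + dotp x y = 0].
Proof.
move=> /polytopeP[T [s ->]] /face_convV[I FI ->] h.
have hI i : i \in I -> 0 <= ev (hom s) (aff a y) i.
  by move=> iI; rewrite hom_ev; apply: h; exact: conv_in.
pose C := [set i in I | ev (hom s) (aff a y) i == 0]%SET.
have FC : isface (hom s) C by apply: (isface_in FI hI) => i; rewrite inE.
suff -> : [set x | conv s I x /\ a + dotp x y = 0] = conv s C by exact: face_conv.
apply/seteqP; split=> x /=.
  by case=> cx e; apply: conv_zeros => //; rewrite hvec_aff.
move=> cx; split.
  by apply: convS cx; apply/fintype.subsetP => i; rewrite inE => /andP[].
by rewrite -hvec_aff; apply: (conv_eq0 cx) => i; rewrite inE => /andP[_ /eqP].
Qed.

Lemma face_mid P F x y z : face P F -> F z -> P x -> P y -> z = 2^-1 *: x + 2^-1 *: y -> F x.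
Proof.
case=> [->//|[v ->]] /= [Pz zmax] Px Py e; split=> // u Pu.
have := zmax _ Pu; have := zmax _ Px; have := zmax _ Py.
rewrite e dotpDl !dotpZl; lra.
Qed.

Lemma face_sub P F : face P F -> F `<=` P.
Proof. by case=> [->|[v ->]] // x []. Qed.

End FaceIn.

(** * Unfolding the faces of a symmetrised polytope *)

Section Fold.
Variables (R : realType) (d : nat) (P : set 'rV[R]_d) (l : 'I_d).
Hypothesis lP : lab P.
Implicit Types (F G : set 'rV[R]_d) (x y v : 'rV[R]_d).
Local Notation Q := (sym l P).
Let lQ : lab Q := lab_sym l lP.

Definition neg_in F := exists2 x, F x & x 0 l < 0.
Definition pos_in F := exists2 x, F x & 0 < x 0 l.

(* A face of the symmetrised polytope that meets x_l < 0 is either symmetric ([sided]) or on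
   the wrong side.  Unfolding replaces the part in x_l <= 0 of a symmetric face by the part of P
   that projects into the face along the coordinate l. *)
Definition sided F := neg_in F -> pos_in F.

Definition unfold_face F : set 'rV[R]_d := [set x | P x /\ (F x \/ (neg_in F /\ F (zero_at l x)))].

(** Comparing a maximiser on either side with its reflection gives both signs for v_l. *)
Lemma sided_symmetric F v : F = [set x | Q x /\ forall y, Q y -> dotp y v <= dotp x v] ->
  pos_in F -> neg_in F -> v 0 l = 0.
Proof.
move=> eF [p] + pl [q] + ql; rewrite eF /= => -[Qp pmax] [Qq qmax].
have h1 := pmax _ (sym_mirrored Qp); have h2 := qmax _ (sym_mirrored Qq).
move: h1 h2; rewrite !dotp_opp => h1 h2; apply/eqP; rewrite eq_le; apply/andP; split.
  by rewrite -(nmulr_rge0 _ ql); lra.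
by rewrite -(pmulr_rge0 _ pl); lra.
Qed.

Lemma unfold_pos F x : face Q F -> sided F -> 0 <= x 0 l -> unfold_face F x <-> F x.
Proof.
move=> FF sF x0; split=> [[Px [//|[nF Fz]]]|Fx]; last first.
  by split; [apply/(sym_ge0 _ x0); apply: face_sub FF _ Fx | left].
case: FF => [e|[v e]]; first by move: Fz; rewrite e.
have v0 := sided_symmetric e (sF nF) nF.
move: Fz; rewrite e /= => -[_ h]; split; first exact/sym_ge0.
by move=> y /h; rewrite dotp_zero v0 mulr0 subr0.
Qed.

Lemma unfold_id F : face Q F -> ~ neg_in F -> unfold_face F = F.
Proof.
move=> FF nF; apply/seteqP; split=> x; first by case=> _ [//|[]].
move=> Fx; have x0 : 0 <= x 0 l by rewrite leNgt; apply/negP => h; apply: nF; exists x.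
by split; [apply/(sym_ge0 _ x0); apply: face_sub FF _ Fx | left].
Qed.

Lemma sym_zero x : Q x -> P (zero_at l x).
Proof.
move=> Qx; have := lab_zero lQ l Qx; apply: (sym_ge0 _ _).1.
by rewrite zero_at_coord.
Qed.

(** If [F] meets both sides, v_l = 0 and [v] exposes the unfolding. If it meets only x_l > 0, then
    v_l > 0 and [v] still exposes it in [P]. If it lies in x_l = 0, the given [v] may fail on the
    half of [P] with x_l < 0 and is replaced. *)
Lemma face_unfold F : face Q F -> sided F -> face P (unfold_face F).
Proof.
move=> FF sF; case: (pselect (neg_in F)) => nF.
  case: FF => [e|[v e]]; first by case: nF => x; rewrite e.
  have v0 := sided_symmetric e (sF nF) nF; right; exists v.
  have zE x : dotp (zero_at l x) v = dotp x v by rewrite dotp_zero v0 mulr0 subr0.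
  apply/seteqP; split=> x; rewrite /unfold_face /=.
    case=> Px h; split=> // y Py; have Qy : Q (zero_at l y).
      by apply/sym_ge0; [rewrite zero_at_coord | exact: lab_zero].
    have {}h : F x \/ F (zero_at l x) by case: h => [|[]]; [left | right].
    rewrite -(zE y); case: h; rewrite e /= => -[_ /(_ _ Qy)]; rewrite ?zE //.
  case=> Px h; split=> //; right; split=> //; rewrite e /=; split.
    by apply/sym_ge0; [rewrite zero_at_coord | exact: lab_zero].
  by move=> y /sym_zero /h; rewrite !zE.
rewrite unfold_id //.
have F0 x : F x -> 0 <= x 0 l by move=> Fx; rewrite leNgt; apply/negP => h; apply: nF; exists x.
have FP x : F x -> P x by move=> Fx; apply/(sym_ge0 _ (F0 x Fx)); apply: face_sub FF _ Fx.
case: FF => [->|[v e]]; first by left.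
case: (pselect (pos_in F)) => pF.
  have v0 : 0 < v 0 l.
    case: pF => p Fp pl; have := Fp; rewrite {1}e /= => -[Qp pmax].
    rewrite lt_def; apply/andP; split.
      apply/eqP => v0; apply: nF; exists (opp_at l p); last by rewrite opp_at_coord oppr_lt0.
      rewrite e /=; split; first exact: sym_mirrored.
      by move=> y /pmax; rewrite dotp_opp v0 mulr0; lra.
    have := pmax _ (sym_mirrored Qp); rewrite dotp_opp => h.
    by rewrite -(pmulr_rge0 _ pl); lra.
  right; exists v; apply/seteqP; split=> x /=.
    move=> Fx; split; first exact: FP.
    move: (Fx); rewrite {1}e /= => -[_ h] y Py.
    case: (lerP 0 (y 0 l)) => y0; first by apply: h; apply/sym_ge0.
    have : dotp (zero_at l y) v <= dotp x v.
      by apply: h; apply/sym_ge0; [rewrite zero_at_coord | exact: lab_zero].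
    by rewrite dotp_zero; have : y 0 l * v 0 l < 0 by [rewrite nmulr_rlt0]; lra.
  case=> Px h; have x0 : 0 <= x 0 l.
    rewrite leNgt; apply/negP => xn; have := h _ (lab_zero lP l Px).
    by rewrite dotp_zero; have : x 0 l * v 0 l < 0 by [rewrite nmulr_rlt0]; lra.
  rewrite e /=; split; first exact/sym_ge0.
  move=> y Qy; case: (lerP 0 (y 0 l)) => y0; first by apply: h; apply/(sym_ge0 _ y0).
  have /h : P (opp_at l y) by apply/(sym_le0 _ (ltW y0)).
  by rewrite dotp_opp; have : y 0 l * v 0 l < 0 by [rewrite nmulr_rlt0]; lra.
have Fl x : F x -> x 0 l = 0.
  move=> Fx; apply/eqP; rewrite eq_le F0 // andbT leNgt; apply/negP => h.
  by apply: pF; exists x.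
case: (pselect (exists x, F x)) => [[x0 Fx0]|nx]; last first.
  by left; rewrite -subset0 => x Fx; apply: nx; exists x.
(* What [v'] exposes in [P] lies in x_l <= 0, and [F] is the part of it in x_l = 0, hence a face of
   a face. *)
pose v' := zero_at l v.
have vE x : dotp x v' = dotp (zero_at l x) v by rewrite dotpC !dotp_zero dotpC mulrC.
have [Qx0 max0] : Q x0 /\ forall y, Q y -> dotp y v <= dotp x0 v by move: Fx0; rewrite e.
have x0E : dotp x0 v' = dotp x0 v by rewrite vE dotp_zero Fl // mul0r subr0.
have Pmax x : P x -> dotp x v' <= dotp x0 v.
  move=> Px; rewrite vE; apply: max0; apply/sym_ge0; last exact: lab_zero.
  by rewrite zero_at_coord.
(* [dotp x v'] is the mean of the values of [v] at [x] and at its reflection, neither of which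
   exceeds the maximum. *)
have tight x : Q x -> dotp x v' = dotp x0 v -> F x.
  move=> Qx ex; rewrite e /=; split=> // y Qy; apply: (le_trans (max0 _ Qy)).
  have h1 := max0 _ Qx; have h2 := max0 _ (sym_mirrored Qx).
  move: h2 ex; rewrite dotp_opp vE dotp_zero; lra.
pose G := [set x | P x /\ forall y, P y -> dotp y v' <= dotp x v'].
have GE x : G x -> dotp x v' = dotp x0 v.
  by move=> [Px h]; apply/eqP; rewrite eq_le Pmax //= -x0E h //; exact: FP.
have FG : face P G by right; exists v'.
have Gle x : G x -> 0 <= 0 + dotp x (- delta_mx 0 l).
  move=> Gx; rewrite add0r dotpNr dotp_delta oppr_ge0 leNgt; apply/negP => xl.
  have Fx : F x by apply: tight (GE _ Gx); apply/sym_ge0; [exact: ltW | case: Gx].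
  by move: xl; rewrite Fl // ltxx.
have := face_in (lab_poly lP) FG Gle; congr face; apply/seteqP; split=> x /=.
  rewrite add0r dotpNr dotp_delta => -[Gx /eqP]; rewrite oppr_eq0 => /eqP xl.
  by apply: tight (GE _ Gx); apply/sym_ge0; [rewrite xl | case: Gx].
move=> Fx; rewrite add0r dotpNr dotp_delta Fl // oppr0; split=> //; split; first exact: FP.
have xE : dotp x v' = dotp x0 v.
  rewrite vE dotp_zero Fl // mul0r subr0; apply/eqP; rewrite eq_le.
  move: (Fx); rewrite e /= => -[Qx h]; by rewrite h // max0.
by move=> y Py; rewrite xE; exact: Pmax.
Qed.

Lemma hvec_zero x (q : 'rV[R]_d) : q 0 l != 0 ->
  hvec x = hvec (zero_at l x) + (x 0 l / q 0 l) *: (hvec q - hvec (zero_at l q)).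
Proof.
move=> ql; apply/rowP => k; rewrite !mxE; case: (fintype.split k) => j; rewrite !mxE.
  by rewrite subrr mulr0 addr0.
by case: eqP => [->|_]; rewrite ?add0r ?subr0 ?divfK // subrr mulr0 addr0.
Qed.

Lemma sided_zero F x : face Q F -> neg_in F -> pos_in F -> F x -> F (zero_at l x).
Proof.
case=> [->//|[v e]] nF pF; have v0 := sided_symmetric e pF nF.
rewrite e /= => -[Qx h]; split; first exact: lab_zero.
by move=> y /h; rewrite dotp_zero v0 mulr0 subr0.
Qed.

(** The homogenised points of [F] and of its unfolding both span the projections to x_l = 0 and the
    direction e_l, which a point with x_l > 0 supplies. *)
Lemma has_dim_unfold F k : face Q F -> sided F -> has_dim F k -> has_dim (unfold_face F) k.
Proof.
move=> FF sF hF; case: (pselect (neg_in F)) => nF; last by rewrite unfold_id.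
have pF := sF nF; have [p Fp pl] := pF.
have F'F := face_unfold FF sF.
have [T [s eQ]] := polytopeP (lab_poly lQ); have [U [u eP]] := polytopeP (lab_poly lP).
move: (FF); rewrite eQ => /face_convV[I _ eI]; move: F'F; rewrite eP => /face_convV[J _ eJ].
have Fz := sided_zero FF nF pF.
have pos x : 0 <= x 0 l -> F x -> unfold_face F x by move=> h /(unfold_pos FF sF h).
have pl0 : p 0 l != 0 by rewrite gt_eqF.
have inI x : F x -> (hvec x <= span (hom s) I)%MS.
  rewrite eI => /convP[c [_ c0 c1 ex]]; apply/span_hom; exists c; split=> //.
  exact: hvec_sum.
have inJ x : unfold_face F x -> (hvec x <= span (hom u) J)%MS.
  rewrite eJ => /convP[c [_ c0 c1 ex]]; apply/span_hom; exists c; split=> //.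
  exact: hvec_sum.
have z0 x : 0 <= (zero_at l x) 0 l by rewrite zero_at_coord.
have e : rk (hom s) I = rk (hom u) J.
  apply/eqmx_rank/andP; split; apply: span_sub => i iX.
    have Fi : F (s i) by rewrite eI; exact: conv_in.
    have a0 : (hvec (zero_at l (s i)) <= span (hom u) J)%MS by apply/inJ/pos => //; exact: Fz.
    rewrite /hom (hvec_zero (s i) pl0) addmx_sub //.
    have a1 : (hvec p <= span (hom u) J)%MS by apply/inJ/pos => //; exact: ltW.
    have a2 : (hvec (zero_at l p) <= span (hom u) J)%MS by apply/inJ/pos => //; exact: Fz.
    by rewrite scalemx_sub // addmx_sub // eqmx_opp.
  have : unfold_face F (u i) by rewrite eJ; exact: conv_in.
  move=> [_ h]; have {h} [h|h] : F (u i) \/ F (zero_at l (u i)) by case: h => [|[]]; [left | right].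
    exact: inI.
  rewrite /hom (hvec_zero (u i) pl0) addmx_sub ?inI //.
  by rewrite scalemx_sub // addmx_sub ?eqmx_opp ?inI //; exact: Fz.
rewrite eJ has_dim_convE; move: hF; rewrite eI has_dim_convE => ->.
by rewrite e.
Qed.

Lemma unfold_mono F G : face Q F -> face Q G -> sided F -> sided G -> F `<=` G ->
  unfold_face F `<=` unfold_face G.
Proof.
move=> FF FG sF sG s x [Px h]; split=> //; case: h => [/s|[nF Fz]]; first by left.
right; split; last exact: s.
by case: nF => y /s Gy yl; exists y.
Qed.

(** The part in x_l >= 0 is read off the unfolding. A point with x_l < 0 is recovered from its
    projection, the midpoint of it and its reflection: a face containing a midpoint contains both
    ends. *)
Lemma unfold_inj F G : face Q F -> face Q G -> sided F -> sided G ->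
  unfold_face F = unfold_face G -> F `<=` G.
Proof.
move=> FF FG sF sG e x Fx.
have pos y : 0 <= y 0 l -> F y -> G y.
  by move=> y0 Fy; apply/(unfold_pos FG sG y0); rewrite -e; apply/(unfold_pos FF sF y0).
case: (lerP 0 (x 0 l)) => xl; first exact: pos.
have nF : neg_in F by exists x.
have Gz : G (zero_at l x) by apply: pos; [rewrite zero_at_coord | apply: sided_zero => //; exact: sF].
have Go : G (opp_at l x).
  apply: pos; first by rewrite opp_at_coord oppr_ge0 ltW.
  case: FF => [eF|[v eF]]; first by move: Fx; rewrite eF.
  have v0 := sided_symmetric eF (sF nF) nF.
  move: Fx; rewrite eF /= => -[Qx h]; split; first exact: sym_mirrored.
  by move=> y /h; rewrite dotp_opp v0 mulr0; lra.
have Qx : Q x := face_sub FF Fx.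
apply: (face_mid FG Gz Qx (sym_mirrored Qx)).
apply/rowP => k; rewrite !mxE; case: eqP => [->|_]; first by rewrite mulrN subrr.
by field.
Qed.

End Fold.

(** * Reflections and lists of flags *)

Section Mirror.
Variables (R : realType) (d : nat).
Implicit Types (P A : set 'rV[R]_d) (x v : 'rV[R]_d) (l : 'I_d).

Lemma flip_mx n (S : {set 'I_n}) : exists D : 'M[R]_n, forall x : 'rV[R]_n, flip S x = x *m D.
Proof.
exists (diag_mx (\row_k (if k \in S then -1 else 1))) => x; rewrite mul_mx_diag.
by apply/rowP => k; rewrite !mxE; case: ifP; rewrite ?mulr1 ?mulrN1.
Qed.

Lemma rk_mirror (T : finType) (s : T -> 'rV[R]_d) l (I : {set T}) :
  (rk (hom (fun i => opp_at l (s i))) I <= rk (hom s) I)%N.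
Proof.
have [D hD] := flip_mx [set rshift 1 j | j in [set l]%SET]%SET.
apply: leq_trans (mxrankM_maxl (span (hom s) I) D); apply: mxrankS.
apply: span_sub => i iI; rewrite /hom opp_atE hvec_flip hD.
by apply: submxMr; exact: span_sup.
Qed.

Lemma mirror_conv (T : finType) (s : T -> 'rV[R]_d) l (I : {set T}) :
  mirror l (conv s I) = conv (fun t => opp_at l (s t)) I.
Proof.
apply/seteqP; split=> x; rewrite /mirror /= => /convP[c [c0 c1 c2 ex]]; apply/convP; exists c; split=> //.
  by rewrite -opp_at_comb -ex opp_atK.
by rewrite ex -opp_at_comb opp_atK.
Qed.

Lemma has_dim_mirror P A k l : polytope P -> face P A -> has_dim A k -> has_dim (mirror l A) k.
Proof.
move=> /polytopeP[T [s ->]] /face_convV[I _ ->]; rewrite mirror_conv !has_dim_convE => ->.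
congr (Posz _ - _); apply/eqP; rewrite eqn_leq rk_mirror andbT.
have := rk_mirror (fun t => opp_at l (s t)) l I; apply: leq_trans; rewrite leq_eqVlt; apply/orP; left.
by apply/eqP; congr (rk (hom _) I); apply/funext => t; rewrite opp_atK.
Qed.

Lemma dotp_oppC l x v : dotp (opp_at l x) v = dotp x (opp_at l v).
Proof. by rewrite dotp_opp [RHS]dotpC dotp_opp dotpC [x 0 l * _]mulrC. Qed.

Lemma face_mirror P A l : face P A -> face (mirror l P) (mirror l A).
Proof.
case=> [->|[v ->]]; [by left | right; exists (opp_at l v)].
apply/seteqP; split=> x; rewrite /mirror /= => -[Px h]; split=> // y.
  by move=> /h; rewrite !dotp_oppC.
by move=> Py; have := h (opp_at l y); rewrite opp_atK => /(_ Py); rewrite !dotp_oppC opp_atK.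
Qed.

Definition mirror_flag l (F : 'I_d.+2 -> set 'rV[R]_d) r := mirror l (F r).

Lemma mirror_flagK l : involutive (mirror_flag l).
Proof. by move=> F; apply/funext => r; rewrite /mirror_flag mirrorK. Qed.

Lemma flags_mirror P l F : polytope P -> flags P F -> flags (mirror l P) (mirror_flag l F).
Proof.
move=> pP [h1 h2 h3]; split=> [r|r|i j ij]; first exact: face_mirror.
  exact: (has_dim_mirror l pP (h1 r) (h2 r)).
have [s n] := h3 _ _ ij; split=> [x|h]; first exact: s.
by apply: n => x Fx; have := h (opp_at l x); rewrite /mirror_flag /mirror /= opp_atK; apply.
Qed.

(** Enumerations turn injections between flags of different polytopes into inequalities between
    sizes of lists. *)
Definition flag_list P (L : seq ('I_d.+2 -> set 'rV[R]_d)) : Prop :=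
  uniq L /\ forall F, F \in L <-> flags P F.

Lemma flag_list_mirror P l L : lab P -> flag_list P L -> flag_list (mirror l P) [seq mirror_flag l F | F <- L].
Proof.
move=> lP [uL hL]; split; first by rewrite map_inj_uniq //; exact: inv_inj (mirror_flagK l).
move=> F; split=> [/mapP[G GL ->]|hF].
  by apply: flags_mirror; [exact: lab_poly | apply/hL].
apply/mapP; exists (mirror_flag l F); last by rewrite mirror_flagK.
apply/hL; rewrite -(mirrorK l P); apply: flags_mirror hF; exact: lab_poly (lab_mirror l lP).
Qed.

Lemma flag_list_size P L1 L2 : flag_list P L1 -> flag_list P L2 -> size L1 = size L2.
Proof.
move=> [u1 h1] [u2 h2]; apply: perm_size; apply: uniq_perm => // F.
by apply/idP/idP => [/h1/h2|/h2/h1].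
Qed.

Lemma flag_list_conv (T : finType) (s : T -> 'rV[R]_d) : rk (hom s) [set: T]%SET = d.+1 ->
  exists2 L, flag_list (conv s [set: T]%SET) L & size L = ch (isface (hom s)) finset.set0 [set: T]%SET.
Proof.
move=> full; pose C := chains (isface (hom s)) d.+1 finset.set0 [set: T]%SET.
exists [seq chain_flag s p | p <- C].
  split.
    rewrite map_inj_in_uniq; first exact: chains_uniq.
    by move=> p q; exact: chain_flag_inj.
  move=> F; rewrite flags_chains //; split=> [/mapP[p pC ->]|[p pC <-]]; first by exists p.
  exact: map_f.
rewrite size_map; apply: (size_chains (faces_graded _) (isface_set0 s) (isface_setT _) (finset.sub0set _)).
by rewrite rk_set0 full.
Qed.

Lemma flag_list_lab P : (0 < d)%N -> lab P -> exists L, flag_list P L.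
Proof.
move=> d0 lP; have [T [s e]] := polytopeP (lab_poly lP); rewrite e in lP *.
by have [L hL _] := flag_list_conv (conv_lab_full d0 lP); exists L.
Qed.

End Mirror.

(** * The side to which a flag leaves a hyperplane *)

Section Count.
Variables (R : realType) (d : nat) (l : 'I_d).
Implicit Types (P : set 'rV[R]_d) (F : 'I_d.+2 -> set 'rV[R]_d).

Definition plus_flag F := exists r, pos_in l (F r) /\ forall x, F r x -> 0 <= x 0 l.
Definition minus_flag F := exists r, neg_in l (F r) /\ forall x, F r x -> x 0 l <= 0.

Lemma flags_sub P F (i j : 'I_d.+2) : flags P F -> (i <= j)%N -> F i `<=` F j.
Proof.
case=> _ _ h; rewrite leq_eqVlt => /orP[/eqP/val_inj->//|/h[]] //.
Qed.

Lemma plus_minus P F : flags P F -> plus_flag F -> minus_flag F -> False.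
Proof.
move=> hF [r [[x Fx xl] hr]] [q [[y Fy yl] hq]].
case/orP: (leq_total r q) => h.
  by have := hq x (flags_sub hF h Fx); rewrite leNgt xl.
by have := hr y (flags_sub hF h Fy); rewrite leNgt yl.
Qed.

Lemma plus_mirror F : plus_flag (mirror_flag l F) <-> minus_flag F.
Proof.
split=> -[r [[x Fx xl] h]]; exists r; split.
- by exists (opp_at l x) => //; rewrite opp_at_coord oppr_lt0.
- move=> y Fy; have := h (opp_at l y); rewrite /mirror_flag /mirror /= opp_atK opp_at_coord.
  by move=> /(_ Fy); rewrite oppr_ge0.
- exists (opp_at l x); first by rewrite /mirror_flag /mirror /= opp_atK.
  by rewrite opp_at_coord oppr_gt0.
- by move=> y /h; rewrite opp_at_coord oppr_le0.
Qed.

Lemma conv_sign (T : finType) (s : T -> 'rV[R]_d) (I : {set T}) x : conv s I x -> 0 < x 0 l ->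
  exists2 i, i \in I & 0 < s i 0 l.
Proof.
move=> /convP[c [c0 cI c1 ex]] xl; apply: contrapT => h.
suff : x 0 l <= 0 by rewrite leNgt xl.
rewrite ex summxE; apply: sumr_le0 => i _; rewrite mxE.
case: (boolP (i \in I)) => iI; last by rewrite cI // mul0r.
by apply: mulr_ge0_le0 => //; rewrite leNgt; apply/negP => h'; apply: h; exists i.
Qed.

Lemma conv_signN (T : finType) (s : T -> 'rV[R]_d) (I : {set T}) x : conv s I x -> x 0 l < 0 ->
  exists2 i, i \in I & s i 0 l < 0.
Proof.
move=> /convP[c [c0 cI c1 ex]] xl; apply: contrapT => h.
suff : 0 <= x 0 l by rewrite leNgt xl.
rewrite ex summxE; apply: sumr_ge0 => i _; rewrite mxE.
case: (boolP (i \in I)) => iI; last by rewrite cI // mul0r.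
by apply: mulr_ge0 => //; rewrite leNgt; apply/negP => h'; apply: h; exists i.
Qed.

(** Otherwise x_l, which changes sign on [J], and the functional exposing [I], which does not, are
    independent on [J] and vanish on [I]; a cover has room for one functional. *)
Lemma no_jump (T : finType) (s : T -> 'rV[R]_d) (I J : {set T}) : isface (hom s) I -> I \subset J ->
  rk (hom s) J = (rk (hom s) I).+1 -> (forall x, conv s I x -> x 0 l = 0) ->
  pos_in l (conv s J) -> neg_in l (conv s J) -> False.
Proof.
move=> FI sIJ r hI [x Jx xl] [y Jy yl].
have [p pJ pl] := conv_sign Jx xl; have [q qJ ql] := conv_signN Jy yl.
have [w w0 w1] := isface_pos FI.
have il i : i \in I -> s i 0 l = 0 by move=> iI; apply: hI; exact: conv_in.
have pI : p \notin I by apply/negP => /il h; rewrite h ltxx in pl.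
have qI : q \notin I by apply/negP => /il h; rewrite h ltxx in ql.
pose g (b : bool) := if b then w else aff 0 (delta_mx 0 l).
have : (rk (hom s) I + #|[set: bool]%SET| <= rk (hom s) J)%N; last first.
  by rewrite cardsT card_bool r; clear; lia.
apply: (@rk_indep _ _ _ _ _ _ g) => // [i b iI _|a ha].
  by case: b => /=; [exact: w0 | rewrite hom_ev add0r dotp_delta il].
have h i : i \in J -> a true * ev (hom s) w i + a false * s i 0 l = 0.
  move=> iJ; rewrite -[RHS](ha i iJ) (eq_bigl xpredT); last by move=> b; rewrite inE.
  by rewrite big_bool /= hom_ev add0r dotp_delta.
have h1 := h p pJ; have h2 := h q qJ; have wp := w1 p pI; have wq := w1 q qI.
have at0 : a true = 0.
  have : a true * (ev (hom s) w q * s p 0 l - ev (hom s) w p * s q 0 l) = 0.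
    have -> : a true * (ev (hom s) w q * s p 0 l - ev (hom s) w p * s q 0 l) =
      (a true * ev (hom s) w q + a false * s q 0 l) * s p 0 l -
      (a true * ev (hom s) w p + a false * s p 0 l) * s q 0 l by ring.
    by rewrite h1 h2 !mul0r subrr.
  move/eqP; rewrite mulf_eq0 => /orP[/eqP//|/eqP h3]; exfalso.
  have : 0 < ev (hom s) w q * s p 0 l by rewrite mulr_gt0.
  have : ev (hom s) w p * s q 0 l < 0 by rewrite pmulr_rlt0.
  by lra.
case=> _ //; move/eqP: h1; rewrite at0 mul0r add0r mulf_eq0 (gt_eqF pl) orbF => /eqP//.
Qed.

(** The first member not contained in x_l = 0 decides: it covers one that is, so [no_jump]
    applies. *)
Lemma flag_sided P F : (0 < d)%N -> lab P -> flags P F -> plus_flag F \/ minus_flag F.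
Proof.
move=> d0 lP [hf hd hs]; have [T [s eP]] := polytopeP (lab_poly lP); rewrite eP in lP hf.
have full := conv_lab_full d0 lP.
have hI i : exists I, isface (hom s) I /\ F i = conv s I.
  by have [I FI e] := face_convV (hf i); exists I.
have [I hI'] := boolp.choice hI.
have FI i : isface (hom s) (I i) by case: (hI' i).
have eI i : F i = conv s (I i) by case: (hI' i).
have rI i : rk (hom s) (I i) = i by have := hd i; rewrite eI => /has_dim_convE; lia.
pose bad r := `[< exists i : 'I_d.+2, i = r :> nat /\ exists2 x, F i x & x 0 l != 0 >].
have exb : exists r, bad r.
  exists d.+1; apply/asboolP; exists ord_max; split=> //; exists (delta_mx 0 l); last by rewrite mxE !eqxx oner_eq0.
  have -> : F ord_max = conv s [set: T]%SET; last exact: lab_unit.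
  rewrite eI; congr conv; apply: (rk_sub_eq (faces_graded _) (FI _) (isface_setT _) (finset.subsetT _)).
  by rewrite full rI.
case: (ex_minnP exb) => r /asboolP[i [ei [x Fx xl]]] rmin.
case: r ei rmin => [|r] ei rmin.
  have : I i = finset.set0.
    apply/esym/(rk_sub_eq (faces_graded _) (isface_set0 s) (FI _) (finset.sub0set _)).
    by rewrite rI ei.
  by move=> e0; move: Fx; rewrite eI e0 conv0.
have hr : (r < d.+2)%N by rewrite -ltnS ltnW // -ei ltnS.
pose j := Ordinal hr.
have zj y : F j y -> y 0 l = 0.
  move=> Fy; apply/eqP/negPn/negP => yl; have : bad r by apply/asboolP; exists j; split=> //; exists y.
  by move/rmin; rewrite ltnn.
have sji : F j `<=` F i by case: (hs j i _) => //; rewrite ei.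
have sI : I j \subset I i by apply: (conv_face_sub (s := s)) => //; rewrite -!eI.
have rr : rk (hom s) (I i) = (rk (hom s) (I j)).+1 by rewrite !rI ei.
have zj' y : conv s (I j) y -> y 0 l = 0 by rewrite -eI; exact: zj.
have nj := no_jump (FI j) sI rr zj'; rewrite -eI in nj.
case: (ltgtP 0 (x 0 l)) xl => // xl _; [left|right]; exists i; split; try by exists x.
  move=> y Fy; rewrite leNgt; apply/negP => yl; apply: nj; [by exists x | by exists y].
move=> y Fy; rewrite leNgt; apply/negP => yl; apply: nj; [by exists y | by exists x].
Qed.

Definition unfold_flag P F r := unfold_face P l (F r).

Lemma nonminus_sided F : ~ minus_flag F -> forall r, sided l (F r).
Proof.
move=> nm r nF; apply: contrapT => np; apply: nm; exists r; split=> // x Fx.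
by rewrite leNgt; apply/negP => h; apply: np; exists x.
Qed.

Lemma flags_unfold P F : (0 < d)%N -> lab P -> flags (sym l P) F -> ~ minus_flag F ->
  flags P (unfold_flag P F) /\ plus_flag (unfold_flag P F).
Proof.
move=> d0 lP hF nm; have sF := nonminus_sided nm; have [hf hd hs] := hF.
have dF r : has_dim (unfold_flag P F r) (r%:Z - 1) by apply: has_dim_unfold.
split.
  split=> [r|//|i j ij]; first exact: face_unfold.
  have [s _] := hs _ _ ij.
  have s' : unfold_flag P F i `<=` unfold_flag P F j by apply: unfold_mono.
  split=> // s2; have e : unfold_flag P F i = unfold_flag P F j by apply/seteqP.
  have := dF i; rewrite e => /(has_dim_uniq (dF j)) h; move: ij; rewrite ltn_neqAle => /andP[/eqP n _].
  by apply: n; lia.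
have [|//] := flag_sided d0 (lab_sym l lP) hF.
case=> r [[x Fx xl] h]; exists r; rewrite /unfold_flag unfold_id //.
  by split=> //; exists x.
by case=> y /h; rewrite leNgt => /negP.
Qed.

Lemma unfold_flag_inj P F G : lab P -> flags (sym l P) F -> flags (sym l P) G ->
  ~ minus_flag F -> ~ minus_flag G -> unfold_flag P F = unfold_flag P G -> F = G.
Proof.
move=> lP [hF _ _] [hG _ _] /nonminus_sided sF /nonminus_sided sG e; apply/funext => r.
have er : unfold_face P l (F r) = unfold_face P l (G r) by rewrite -/(unfold_flag P F r) e.
by apply/seteqP; split; apply: (unfold_inj lP).
Qed.

Let isplus F := `[< plus_flag F >].
Let isminus F := `[< minus_flag F >].

(** Reflection takes the minus flags of the symmetrised polytope to flags of the other kind, so at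
    least half are not minus flags. Those unfold injectively to plus flags of [P], and onto them if
    the counts agree. *)
Lemma half_count P L L1 : (0 < d)%N -> lab P -> flag_list P L -> flag_list (sym l P) L1 ->
  (size L1 <= 2 * count isplus L)%N /\
  ((2 * count isplus L <= size L1)%N -> forall F, flags P F -> plus_flag F ->
     exists G, flags (sym l P) G /\ ~ minus_flag G /\ F = unfold_flag P G).
Proof.
move=> d0 lP [uL hL] [uL1 hL1]; have lQ := lab_sym l lP.
pose nm := [seq F <- L1 | ~~ isminus F].
have nmP F : F \in nm -> flags (sym l P) F /\ ~ minus_flag F.
  by rewrite mem_filter => /andP[/asboolPn ? /hL1].
have s1 : (size L1 <= 2 * size nm)%N.
  have e := count_predC isminus L1.
  suff h : (count isminus L1 <= size nm)%N.
    by rewrite -e size_filter in h *; rewrite mul2n -addnn leq_add2r.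
  rewrite -size_filter -(size_map (mirror_flag l)); apply: uniq_leq_size.
    rewrite map_inj_uniq ?filter_uniq //; exact: inv_inj (mirror_flagK l).
  move=> _ /mapP[F + ->]; rewrite mem_filter => /andP[/asboolP mF /hL1 fF].
  have mQ : mirror l (sym l P) = sym l P.
    apply/seteqP; split=> x; rewrite /mirror /=; last exact: sym_mirrored.
    by move/sym_mirrored; rewrite opp_atK.
  have fm : flags (sym l P) (mirror_flag l F).
    by rewrite -mQ; apply: flags_mirror fF; exact: lab_poly lQ.
  rewrite mem_filter; apply/andP; split; last exact/hL1.
  apply/asboolPn => mm; apply: (plus_minus fm _ mm).
  exact/plus_mirror.
pose im := [seq unfold_flag P F | F <- nm].
have uim : uniq im.
  rewrite map_inj_in_uniq ?filter_uniq // => F G /nmP[fF mF] /nmP[fG mG].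
  exact: unfold_flag_inj.
have sim : {subset im <= [seq F <- L | isplus F]}.
  move=> _ /mapP[F /nmP[fF mF] ->]; have [h1 h2] := flags_unfold d0 lP fF mF.
  by rewrite mem_filter; apply/andP; split; [exact/asboolP | exact/hL].
have s2 := uniq_leq_size uim sim.
rewrite size_map [X in (_ <= X)%N]size_filter in s2; split.
  by apply: leq_trans s1 _; rewrite leq_mul2l s2.
move=> s3 F fF pF.
have s4 : (size [seq F <- L | isplus F] <= size im)%N.
  by rewrite size_filter size_map -(leq_pmul2l (isT : 0 < 2)%N); exact: leq_trans s3 s1.
have [_ e] := uniq_min_size uim sim s4.
have : F \in im by rewrite e mem_filter; apply/andP; split; [exact/asboolP | exact/hL].
by case/mapP=> G /nmP[fG mG] ->; exists G.
Qed.

(** [half_count] is applied to [P] and to its mirror image, whose plus flags are the reflected minus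
    flags of [P]. *)
Lemma sym_count P L L1 L2 : (0 < d)%N -> lab P -> flag_list P L -> flag_list (sym l P) L1 ->
  flag_list (sym l (mirror l P)) L2 ->
  (size L1 + size L2 <= 2 * size L)%N /\
  ((2 * size L <= size L1 + size L2)%N ->
    (forall F, flags P F -> plus_flag F ->
     exists G, flags (sym l P) G /\ ~ minus_flag G /\ F = unfold_flag P G) /\
    (forall F, flags (mirror l P) F -> plus_flag F ->
     exists G, flags (sym l (mirror l P)) G /\ ~ minus_flag G /\ F = unfold_flag (mirror l P) G)).
Proof.
move=> d0 lP hL hL1 hL2; have hL' := flag_list_mirror l lP hL.
have [h1 e1] := half_count d0 lP hL hL1; have [h2 e2] := half_count d0 (lab_mirror l lP) hL' hL2.
have c2 : count isplus [seq mirror_flag l F | F <- L] = count isminus L.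
  rewrite count_map; apply: eq_count => F /=; apply/asboolP/asboolP; exact: (plus_mirror F).1 || exact: (plus_mirror F).2.
have c3 : (count isplus L + count isminus L <= size L)%N.
  rewrite -count_predUI; have -> : count (predI isplus isminus) L = 0%N.
    apply/eqP; rewrite -leqn0 leqNgt -has_count; apply/hasPn => F FL /=.
    apply/negP => /andP[/asboolP pF /asboolP mF]; apply: (plus_minus _ pF mF); exact/hL.2.
  by rewrite addn0 count_size.
rewrite c2 in h2 e2; split; first by move: h1 h2 c3; clear; lia.
move=> h; split; [apply: e1 | apply: e2]; move: h1 h2 c3 h; clear; lia.
Qed.

End Count.

Section StablePolytope.
Variables (R : realType) (d : nat).
Implicit Types (x y : 'rV[R]_d) (e : rel 'I_d).

Lemma stable_edge e i j x : i != j -> e i j -> stable_polytope e x -> `|x 0 i| + `|x 0 j| <= 1.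
Proof.
move=> nij eij [n [p [w [hp w0 w1 ->]]]]; rewrite !summxE.
apply: (@le_trans _ _ (\sum_k w k * (`|p k 0 i| + `|p k 0 j|))).
  under [leRHS]eq_bigr => k _ do rewrite mulrDr.
  rewrite big_split /=; apply: lerD; apply: (le_trans (ler_norm_sum _ _ _)); apply: ler_sum => k _.
    by rewrite mxE normrM (ger0_norm (w0 k)).
  by rewrite mxE normrM (ger0_norm (w0 k)).
rewrite -[leRHS]w1; apply: ler_sum => k _; rewrite ler_piMr //.
have [hv hs] := hp k; case: (hs _ _ eij) => ->; rewrite normr0 ?addr0 ?add0r.
  by case: (hv j) => ->; rewrite ?normr0 ?normrN ?normr1 ?ler01.
by case: (hv i) => ->; rewrite ?normr0 ?normrN ?normr1 ?ler01.
Qed.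

Lemma stable_pair e i j (a b : bool) : symmetric e -> irreflexive e -> i != j -> ~~ e i j ->
  stable_polytope e ((-1) ^+ a *: delta_mx 0 i + (-1) ^+ b *: delta_mx 0 j : 'rV[R]_d).
Proof.
move=> se ie nij neij; apply: sub_convex_hull.
have sg (c : bool) : [\/ (-1) ^+ c = 0 :> R, (-1) ^+ c = 1 :> R | (-1) ^+ c = -1 :> R].
  by case: c; [constructor 3 | constructor 2].
have val k : ((-1) ^+ a *: delta_mx 0 i + (-1) ^+ b *: delta_mx 0 j : 'rV[R]_d) 0 k =
   if k == i then (-1) ^+ a else if k == j then (-1) ^+ b else 0.
  rewrite !mxE /=; have [->|ni] := eqVneq k i.
    by rewrite (negbTE nij) mulr1 mulr0 addr0.
  by case: eqP => _; rewrite ?mulr1 mulr0 ?mulr0 add0r.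
split=> [k|k m ekm]; rewrite !val.
  by case: ifP => // _; case: ifP => // _; constructor 1.
case: (eqVneq k i) => [ek|_]; last first.
  case: (eqVneq k j) => [ek|_]; last by left.
  case: (eqVneq m i) => [em|_]; first by move: ekm; rewrite ek em se (negbTE neij).
  by case: (eqVneq m j) => [em|_]; [move: ekm; rewrite ek em ie | right].
case: (eqVneq m i) => [em|_]; first by move: ekm; rewrite ek em ie.
by case: (eqVneq m j) => [em|_]; [move: ekm; rewrite ek em (negbTE neij) | right].
Qed.

Lemma stable_opp e l x : stable_polytope e x -> stable_polytope e (opp_at l x).
Proof.
move=> [n [p [w [hp w0 w1 ->]]]]; exists n, (fun k => opp_at l (p k)), w; split=> //; last exact: opp_at_comb.
move=> k; have [hv hs] := hp k; split=> [i|i j eij]; rewrite !mxE.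
  case: ifP => _ //; case: (hv i) => ->; rewrite ?oppr0 ?opprK; [by constructor 1 | by constructor 3 | by constructor 2].
by case: (hs _ _ eij) => ->; [left | right]; case: ifP; rewrite ?oppr0.
Qed.

End StablePolytope.

(** * Gluing the two symmetrisations *)

Section Main.
Variables (R : realType) (d : nat).
Hypothesis d0 : (0 < d)%N.
Implicit Types (P : set 'rV[R]_d) (e : rel 'I_d).

Lemma chain_ex (T : finType) (v : T -> 'rV[R]_(1 + d)) (A B : {set T}) :
  isface v A -> isface v B -> A \subset B ->
  exists p, [/\ path (cov (isface v)) A p, last A p = B & size p = (rk v B - rk v A)%N].
Proof.
move=> FA FB sAB; have H := faces_graded v.
pose n := (rk v B - rk v A)%N; have rAB := rkS v sAB.
have e : rk v B = (rk v A + n)%N by rewrite /n subnKC.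
have := size_chains H FA FB sAB e.
case ec : (chains (isface v) n A B) => [|p c].
  by move=> h; have := ch_gt0 H FA FB sAB; rewrite -h.
move=> _; have : p \in chains (isface v) n A B by rewrite ec mem_head.
by rewrite mem_chains => /and3P[/eqP sz pp /eqP lp]; exists p.
Qed.

Lemma flag_through P F G : lab P -> face P F -> face P G -> F `<=` G ->
  exists2 L, flags P L & exists i j, L i = F /\ L j = G.
Proof.
move=> lP; have [T [s eP]] := polytopeP (lab_poly lP); rewrite eP in lP *.
have full := conv_lab_full d0 lP.
move=> /face_convV[A FA ->] /face_convV[B FB ->] /(conv_face_sub FB) sAB.
have [p1 [c1 l1 s1]] := chain_ex (isface_set0 s) FA (finset.sub0set A).
have [p2 [c2 l2 s2]] := chain_ex FA FB sAB.
have [p3 [c3 l3 s3]] := chain_ex FB (isface_setT _) (finset.subsetT B).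
pose p := p1 ++ p2 ++ p3.
have r1 := rkS (hom s) sAB; have r2 := rkS (hom s) (finset.subsetT B).
have pin : p \in chains (isface (hom s)) d.+1 finset.set0 [set: T]%SET.
  rewrite mem_chains !cat_path !last_cat l1 l2 l3 c1 c2 c3 eqxx /= andbT !size_cat s1 s2 s3.
  by rewrite full in r2 *; rewrite rk_set0; apply/eqP; move: r1 r2; clear; lia.
have nth1 : nth finset.set0 (finset.set0 :: p) (size p1) = A.
  by rewrite /p -l1 (last_nth finset.set0) -cat_cons nth_cat /= ltnS leqnn.
have nth2 : nth finset.set0 (finset.set0 :: p) (size p1 + size p2) = B.
  have -> : p = (p1 ++ p2) ++ p3 by rewrite /p catA.
  have <- : last finset.set0 (p1 ++ p2) = B by rewrite last_cat l1 l2.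
  by rewrite (last_nth finset.set0) -size_cat -cat_cons nth_cat /= ltnS leqnn.
have sz : (size p1 + size p2 <= d.+1)%N.
  by rewrite s1 s2 rk_set0; move: r1 r2; rewrite full; clear; lia.
exists (chain_flag s p); first by rewrite flags_chains //; exists p.
have h1 : (size p1 < d.+2)%N by move: sz; clear; lia.
have h2 : (size p1 + size p2 < d.+2)%N by move: sz; clear; lia.
by exists (Ordinal h1), (Ordinal h2); rewrite /chain_flag /= nth1 nth2.
Qed.

(** If only the negative side has the edge, {x_i = 1} lies in x_l >= 0 and its part in x_l = 0 is a
    face [X0]. A flag through both is a plus flag. If it were an unfolding, the face over [X0] would
    contain e_i, hence also e_i + e_l and e_i - e_l, of which e_i is the midpoint; but e_i + e_l is
    not in [X0]. *)
Lemma edge_transfer P l e1 e2 i : lab P -> symmetric e1 -> irreflexive e1 ->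
  sym l P = stable_polytope e1 -> sym l (mirror l P) = stable_polytope e2 ->
  (forall F, flags P F -> plus_flag l F ->
     exists G, flags (sym l P) G /\ ~ minus_flag l G /\ F = unfold_flag l P G) ->
  i != l -> e2 i l -> e1 i l.
Proof.
move=> lP se1 ie1 h1 h2 hs nil e2il; apply/negPn/negP => ne1.
pose X : set 'rV[R]_d := [set x | P x /\ 1 + dotp x (- delta_mx 0 i) = 0].
have PP : face P P by right; exists 0; apply/seteqP; split=> x /=; [split=> // y _; rewrite !dotp0r | case].
have FX : face P X.
  apply: face_in => //; first exact: lab_poly.
  by move=> x Px; rewrite dotpNr dotp_delta subr_ge0 (lab_le lP).
have Xi x : X x -> x 0 i = 1.
  by move=> [_]; rewrite dotpNr dotp_delta => /eqP; rewrite subr_eq0 eq_sym => /eqP.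
have Xl x : X x -> 0 <= x 0 l.
  move=> Xx; rewrite leNgt; apply/negP => xl; have [Px _] := Xx.
  have : sym l (mirror l P) (opp_at l x).
    by apply/sym_ge0; [rewrite opp_at_coord oppr_ge0 ltW | rewrite /mirror /= opp_atK].
  rewrite h2 => /(stable_edge nil e2il); rewrite opp_at_coord mxE (negbTE nil) Xi // normr1.
  by rewrite normrN; have : 0 < `|x 0 l| by [rewrite normr_gt0 lt_eqF]; lra.
pose X0 : set 'rV[R]_d := [set x | X x /\ 0 + dotp x (delta_mx 0 l) = 0].
have FX0 : face P X0.
  apply: face_in => //; first exact: lab_poly.
  by move=> x Xx; rewrite add0r dotp_delta Xl.
have [L fL [a [b [eA eB]]]] : exists2 L, flags P L & exists a b, L a = X0 /\ L b = X.
  by apply: flag_through => // x [].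
have pair (c : bool) : sym l P (delta_mx 0 i + (-1) ^+ c *: delta_mx 0 l).
  by have := stable_pair R false c se1 ie1 nil ne1; rewrite -h1 expr0 scale1r.
have Pil : P (delta_mx 0 i + delta_mx 0 l).
  have := pair false; rewrite expr0 scale1r; apply: (sym_ge0 _ _).1.
  by rewrite !mxE !eqxx [l == i]eq_sym (negbTE nil) add0r ler01.
have dil : dotp (delta_mx 0 i + delta_mx 0 l : 'rV[R]_d) (- delta_mx 0 i) = -1.
  by rewrite dotpNr dotp_delta !mxE !eqxx (negbTE nil) addr0.
have pL : plus_flag l L.
  exists b; rewrite eB; split; last exact: Xl.
  exists (delta_mx 0 i + delta_mx 0 l); first by split; rewrite // dil subrr.
  by rewrite !mxE !eqxx [l == i]eq_sym (negbTE nil) add0r ltr01.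
have [G [[fG _ _] [mG eL]]] := hs L fL pL.
have sG := nonminus_sided mG.
have eX0 : unfold_face P l (G a) = X0 by rewrite -eA eL.
have pos (x : 'rV[R]_d) : 0 <= x 0 l -> G a x <-> X0 x.
  by move=> x0; rewrite -eX0; split=> /(unfold_pos (fG a) (sG a) x0).
have Gi : G a (delta_mx 0 i).
  have il : (delta_mx 0 i : 'rV[R]_d) 0 l = 0 by rewrite mxE eq_sym (negbTE nil) andbF.
  apply/pos; first by rewrite il.
  split; last by rewrite dotp_delta il addr0.
  by split; [exact: lab_unit | rewrite dotpNr dotp_delta mxE !eqxx subrr].
have := face_mid (fG a) Gi (pair false) (pair true).
rewrite expr0 expr1 scale1r scaleN1r => /(_ _)/pos[].
- by rewrite !mxE !eqxx [l == i]eq_sym (negbTE nil) add0r ler01.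
- rewrite -scalerDr addrACA subrr addr0 -mulr2n -scaler_nat scalerA mulVf ?scale1r //.
  by rewrite pnatr_eq0.
- move=> _; rewrite add0r dotp_delta !mxE !eqxx [l == i]eq_sym (negbTE nil) add0r => /eqP.
  by rewrite oner_eq0.
Qed.

(** Pairs containing [l] are settled by [edge_transfer] in both directions. For other pairs the
    point e_i + e_j decides, since both symmetrisations have the same section with x_l = 0. *)
Lemma stable_unfold P l e1 e2 : lab P -> symmetric e1 -> irreflexive e1 -> symmetric e2 -> irreflexive e2 ->
  sym l P = stable_polytope e1 -> sym l (mirror l P) = stable_polytope e2 ->
  (forall F, flags P F -> plus_flag l F ->
     exists G, flags (sym l P) G /\ ~ minus_flag l G /\ F = unfold_flag l P G) ->
  (forall F, flags (mirror l P) F -> plus_flag l F ->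
     exists G, flags (sym l (mirror l P)) G /\ ~ minus_flag l G /\ F = unfold_flag l (mirror l P) G) ->
  P = stable_polytope e1.
Proof.
move=> lP se1 ie1 se2 ie2 h1 h2 hs1 hs2; have lM := lab_mirror l lP.
have el i : e1 i l = e2 i l.
  have [->|nil] := eqVneq i l; first by rewrite ie1 ie2.
  apply/idP/idP => h; last exact: (edge_transfer lP se1 ie1 h1 h2).
  have h1' : sym l (mirror l (mirror l P)) = stable_polytope e1 by rewrite mirrorK.
  exact: (edge_transfer lM se2 ie2 h2 h1').
have eij i j : i != l -> j != l -> i != j -> e1 i j = e2 i j.
  move=> nil njl nij.
  have z : (delta_mx 0 i + delta_mx 0 j : 'rV[R]_d) 0 l = 0.
    by rewrite !mxE ![l == _]eq_sym (negbTE nil) (negbTE njl) addr0.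
  have q12 : sym l P (delta_mx 0 i + delta_mx 0 j) <-> sym l (mirror l P) (delta_mx 0 i + delta_mx 0 j).
    by rewrite !sym_ge0 ?z // /mirror /= opp_at_id.
  have out (e : rel 'I_d) : e i j -> ~ stable_polytope e (delta_mx 0 i + delta_mx 0 j : 'rV[R]_d).
    move=> h /(stable_edge nij h); rewrite !mxE !eqxx [j == i]eq_sym (negbTE nij) addr0 add0r normr1.
    lra.
  have inn (e : rel 'I_d) : symmetric e -> irreflexive e -> ~~ e i j -> stable_polytope e (delta_mx 0 i + delta_mx 0 j : 'rV[R]_d).
    by move=> se ie h; have := stable_pair R false false se ie nij h; rewrite expr0 !scale1r.
  apply/idP/idP => h; apply/negPn/negP => h'.
    by apply: (out e1 h); rewrite -h1; apply/q12; rewrite h2; exact: inn.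
  by apply: (out e2 h); rewrite -h2; apply/q12; rewrite h1; exact: inn.
have e12 : e1 = e2.
  apply/funext => i; apply/funext => j; have [->|nij] := eqVneq i j; first by rewrite ie1 ie2.
  have [->|njl] := eqVneq j l; first exact: el.
  by have [->|nil] := eqVneq i l; [rewrite se1 se2 el | exact: eij].
apply/seteqP; split=> x.
  case: (lerP 0 (x 0 l)) => xl Px; first by rewrite -h1; apply/sym_ge0.
  rewrite -[x](opp_atK l); apply: stable_opp; rewrite e12 -h2.
  by apply/sym_ge0; [rewrite opp_at_coord oppr_ge0 ltW | rewrite /mirror /= opp_atK].
case: (lerP 0 (x 0 l)) => xl; first by rewrite -h1 => /(sym_ge0 _ xl).
move/(stable_opp l); rewrite e12 -h2 => /sym_ge0; rewrite /mirror /= opp_atK; apply.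
by rewrite opp_at_coord oppr_ge0 ltW.
Qed.

(** Induction on the number of coordinates in which [P] is not symmetric: both symmetrisations keep
    the symmetries of [P] and gain the one in [l]. *)
Theorem lab_flags P L : lab P -> flag_list P L -> (nflags d <= size L)%N /\
  (size L = nflags d -> exists e, [/\ symmetric e, irreflexive e, P4_free e & P = stable_polytope e]).
Proof.
pose U P := [set l | ~~ `[< mirrored l P >]]%SET.
have [n] := ubnP #|U P|; elim: n P L => // n IH P L hn lP hL.
have [U0|[l lU]] := set_0Vmem (U P).
  have mir l : mirrored l P.
    by apply/asboolP/negPn/negP => h; have : l \in U P by [rewrite inE]; rewrite U0 inE.
  have [T [s [eP sl]]] := mirrored_symmetric_list lP mir.
  have [L' hL' sz] := flag_list_conv (sl_full sl d0).
  rewrite eP in hL; rewrite (flag_list_size hL hL') sz; split; first exact: symmetric_flags.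
  move=> eqf; exists (adj s); split.
  - by move=> i j; exact: adj_sym.
  - by move=> i; exact: adj_irr.
  - exact: adj_P4_free.
  - by rewrite eP; exact: symmetric_stable.
have [L1 hL1] := flag_list_lab d0 (lab_sym l lP).
have lM := lab_mirror l lP; have [L2 hL2] := flag_list_lab d0 (lab_sym l lM).
have lessU Q : (forall j, mirrored j P -> mirrored j Q) -> (#|U (sym l Q)| < n)%N.
  move=> h; rewrite -ltnS; apply: leq_trans hn; rewrite ltnS; apply: proper_card.
  apply/properP; split.
    apply/fintype.subsetP => j; rewrite !inE; apply: contra => /asboolP h'.
    by apply/asboolP; apply: mirrored_sym; exact: h.
  by exists l => //; rewrite inE negbK; apply/asboolP; exact: sym_mirrored.
have [b1 e1] := IH _ _ (lessU P (fun j h => h)) (lab_sym l lP) hL1.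
have [b2 e2] := IH _ _ (lessU (mirror l P) (fun j h => @mirrored_mirror R d j l P h)) (lab_sym l lM) hL2.
have [le eq] := sym_count d0 lP hL hL1 hL2.
split; first by move: le b1 b2; clear; lia.
move=> sz.
have [|E1 [se1 ie1 pe1 h1]] := e1; first by move: le b1 b2 sz; clear; lia.
have [|E2 [se2 ie2 pe2 h2]] := e2; first by move: le b1 b2 sz; clear; lia.
have [|hs1 hs2] := eq; first by move: le b1 b2 sz; clear; lia.
by exists E1; split=> //; exact: (stable_unfold lP se1 ie1 se2 ie2 h1 h2 hs1 hs2).
Qed.

End Main.

(** * From projections and support functions to [lab] *)

Section Normalized.
Variables (R : realType) (d : nat).
Implicit Types (P : set 'rV[R]_d) (x : 'rV[R]_d).

Lemma coord_subspaceP (I : {set 'I_d}) x :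
  reflect (forall k, k \notin I -> x 0 k = 0) (x \in coord_subspace I).
Proof.
apply: (iffP idP) => [|h]; last first.
  rewrite (row_sum_delta x); apply: memv_suml => k _.
  have [kI|/h->] := boolP (k \in I); last by rewrite scale0r mem0v.
  by apply/memvZ/memv_span/map_f; rewrite mem_enum.
rewrite /coord_subspace => xs k kI.
have := coord_span (X := in_tuple [seq delta_mx 0 i | i in I]) xs => ->.
rewrite summxE big1 // => t _; rewrite mxE.
have /mapP[i] : (in_tuple [seq delta_mx 0 i | i in I])`_t \in [seq (delta_mx 0 i : 'rV[R]_d) | i in I].
  exact: mem_nth.
rewrite mem_enum => iI ->; rewrite mxE.
by have [ek|_] := eqVneq k i; [rewrite ek iI in kI | rewrite andbF mulr0].
Qed.

Lemma support_fun_attained P v : polytope P -> support_fun P v = 1 ->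
  (forall x, P x -> dotp x v <= 1) /\ exists2 x, P x & dotp x v = 1.
Proof.
move=> /polytopeP[T [s eP]] h.
have [t0 _|T0] := pickP (fun _ : T => true); last first.
  (* The supremum of the empty set is 0 by convention, so the value 1 excludes an empty polytope. *)
  move: h; rewrite /support_fun (_ : [set _ | _ in P] = set0) ?sup0; first by lra.
  rewrite -subset0 => y [x Px _]; move: Px; rewrite eP => /convP[l [_ _ + _]].
  by rewrite big1 => [/esym/eqP|i]; [rewrite oner_eq0 | have := T0 i].
have [m _ mmax] := @Order.TotalTheory.arg_maxP _ R T t0 xpredT (fun t => dotp (s t) v) isT.
have Pm : P (s m) by rewrite eP; apply: conv_in; rewrite finset.in_setT.
have ub : ubound [set dotp x v | x in P] (dotp (s m) v).
  move=> _ [x + <-]; rewrite eP => cx.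
  have := conv_ge0 cx (w := aff (dotp (s m) v) (- v)); rewrite hvec_aff dotpNr subr_ge0; apply.
  by move=> i _; rewrite hom_ev dotpNr subr_ge0; exact: mmax.
have le1 x : P x -> dotp x v <= 1.
  by move=> Px; rewrite -h; apply: sup_upper_bound; [split; [exists (dotp x v) | exists (dotp (s m) v)] |]; [exists x | | exists x].
split=> //; exists (s m) => //; apply/eqP; rewrite eq_le le1 //= -h.
by apply: ge_sup ub; exists (dotp (s m) v), (s m).
Qed.

(** Coordinate hyperplanes give [lab_zero]. Coordinate axes put into [P] the projections of the
    points where the support function is attained, which are the signed unit vectors. *)
Lemma normalized_lab P : locally_anti_blocking P -> normalized P -> lab P.
Proof.
move=> [pP lb] nP.
have proj (I : {set 'I_d}) x (y : 'rV[R]_d) : P x -> (forall k, k \in I -> y 0 k = x 0 k) ->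
    (forall k, k \notin I -> y 0 k = 0) -> P y.
  move=> Px hI hN; have yU : y \in coord_subspace I by exact/coord_subspaceP.
  have : orth_proj (coord_subspace I) P y.
    split=> //; exists x => // u /coord_subspaceP hu; rewrite /dotp big1 // => k _.
    have [/hI e|/hu->] := boolP (k \in I); last by rewrite mulr0.
    by rewrite !mxE e subrr mul0r.
  by rewrite lb => -[].
have axis j x a : P x -> x 0 j = a -> P (a *: delta_mx 0 j).
  move=> Px e; apply: (proj [set j]%SET x) => // k; rewrite !inE !mxE => h.
    by rewrite (eqP h) !eqxx mulr1 e.
  by rewrite (negbTE h) andbF mulr0.
have sp j := support_fun_attained pP (nP j).1.
have sn j := support_fun_attained pP (nP j).2.
split=> //.
- move=> l x Px; apply: (proj (~: [set l])%SET x) => // k; rewrite !inE mxE; first by move/negbTE->.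
  by rewrite negbK => ->.
- by move=> l x /(sp l).1; rewrite dotp_delta.
- by move=> l x /(sn l).1; rewrite dotpNr dotp_delta; lra.
- by move=> l; have [x Px] := (sp l).2; rewrite dotp_delta => /(axis _ _ _ Px); rewrite scale1r.
- move=> l; have [x Px] := (sn l).2; rewrite dotpNr dotp_delta => h.
  by have := axis l x (-1) Px; rewrite scaleN1r; apply; lra.
Qed.

End Normalized.

(** * Duality and joins *)

Section Anti.
Local Open Scope nat_scope.
Variables (S T : finType) (F : pred {set S}) (G : pred {set T}).
Variables (phi : {set S} -> {set T}) (psi : {set T} -> {set S}).
Hypotheses (GF : forall A, F A -> G (phi A)) (FG : forall B, G B -> F (psi B)).
Hypotheses (phiS : forall A B : {set S}, A \subset B -> phi B \subset phi A).
Hypotheses (psiS : forall A B : {set T}, A \subset B -> psi B \subset psi A).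
Hypotheses (phiK : forall A, F A -> psi (phi A) = A) (psiK : forall B, G B -> phi (psi B) = B).

Lemma anti_sub A B : F A -> F B -> (phi B \subset phi A) = (A \subset B).
Proof. by move=> FA FB; apply/idP/idP => [/psiS|/phiS//]; rewrite !phiK. Qed.

Lemma anti_proper A B : F A -> F B -> (phi B \proper phi A) = (A \proper B).
Proof. by move=> FA FB; rewrite !fintype.properE !anti_sub. Qed.

Lemma anti_cov A B : F A -> F B -> cov G (phi B) (phi A) = cov F A B.
Proof.
move=> FA FB; apply/idP/idP => c.
  have p := cov_proper c; rewrite anti_proper // in p.
  apply: covI => // E FE AE EB; have := covN c (GF FE).
  by rewrite !anti_proper // AE EB => /(_ isT).
have p := cov_proper c; apply: covI; rewrite ?anti_proper ?GF // => E GE.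
by rewrite -(psiK GE) !anti_proper ?FG // => h1 h2; have := covN c (FG GE) h2; rewrite h1.
Qed.

(** First steps on one side are last steps on the other: [ch_step] is matched with [ch_last]. *)
Lemma ch_anti A B : F A -> F B -> A \subset B -> ch F A B = ch G (phi B) (phi A).
Proof.
move=> FA FB; have [n] := ubnP #|~: A|; elim: n A FA => // n IH A FA hn.
rewrite subEproper => /orP[/eqP->|pAB]; first by rewrite !ch_refl.
rewrite ch_step // [RHS]ch_last ?anti_proper ?GF //.
rewrite [RHS](reindex_onto phi psi); last by move=> D /and3P[GD _ _]; exact: psiK.
apply: eq_big => [C|C /andP[c sCB]].
  apply/andP/andP => [[c sCB]|[/and3P[GC sB c] /eqP e]].
    by have FC := covF c; rewrite GF // phiS // anti_cov // phiK // eqxx c.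
  have FC : F C by rewrite -e; exact: FG.
  by rewrite anti_cov // in c; rewrite c -anti_sub.
have FC := covF c; apply: IH => //; rewrite -ltnS; apply: leq_trans hn; rewrite ltnS.
by apply: proper_card; rewrite finset.properEneq finset.setCS (cov_sub c) andbT (inj_eq (@finset.setC_inj S)) eq_sym; have := cov_proper c; rewrite finset.properEneq => /andP[].
Qed.

End Anti.

(** * Polar pairs of finite families *)

Section Polar.
Variables (R : realType) (d : nat).
Implicit Types (x y : 'rV[R]_d) (P : set 'rV[R]_d).

Lemma polar_conv (T : finType) (s : T -> 'rV[R]_d) x :
  polar (conv s [set: T]%SET) x <-> forall i, dotp x (s i) <= 1.
Proof.
split=> [h i|h y cy]; first by apply: h; apply: conv_in; rewrite finset.in_setT.
have := conv_ge0 cy (w := aff 1 (- x)); rewrite hvec_aff dotpNr subr_ge0 dotpC; apply.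
by move=> i _; rewrite hom_ev dotpNr subr_ge0 dotpC.
Qed.

Lemma polar0 P : polar P 0. Proof. by move=> y _; rewrite dotp0l ler01. Qed.

Lemma bipolar (T : finType) (s : T -> 'rV[R]_d) : conv s [set: T]%SET 0 ->
  polar (polar (conv s [set: T]%SET)) = conv s [set: T]%SET.
Proof.
move=> c0; apply/seteqP; split=> [x h|x cx y hy]; last by rewrite dotpC; exact: hy.
apply: contrapT => /convP_farkas[w w0]; have [a [y ew]] := affP w; rewrite {}ew in w0 *.
rewrite hvec_aff => wx.
have a0 : 0 <= a.
  by have := conv_ge0 c0 (w := aff a y); rewrite hvec_aff dotp0l addr0; apply=> i _; exact: w0.
(* [b] lies midway between [a] and -<x, y>: it is positive even if a = 0, so that [y] can be scaled
   into the polar, and it still separates [x]. *)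
pose b := (a - dotp x y) / 2; have b0 : 0 < b by rewrite /b; lra.
have ab : a <= b by rewrite /b; lra.
have scale z : dotp z (- b^-1 *: y) <= 1 <-> 0 <= b + dotp z y.
  by rewrite dotpZr mulNr lerNl -ler_pdivrMl ?invr_gt0 // invrK mulrN1 -subr_ge0 opprK addrC.
have /scale : dotp x (- b^-1 *: y) <= 1.
  apply: h; apply/polar_conv => i; rewrite dotpC; apply/scale.
  by have := w0 i; rewrite hom_ev; lra.
by rewrite /b; lra.
Qed.

Variables (S T : finType) (s : S -> 'rV[R]_d) (t : T -> 'rV[R]_d).

(* The facet-vertex incidences of a pair of dual polytopes; their face lattices are the
   closed sets of this Galois connection. *)
Definition dual_face (I : {set S}) : {set T} := [set j | [forall i in I, dotp (s i) (t j) == 1]]%SET.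

End Polar.

Section Dual.
Variables (R : realType) (d : nat).
Implicit Types (x y : 'rV[R]_d).

(** That the polar is again a hull of finitely many points bounds it, which puts 0 into the
    interior; [dual_sym] makes the notion symmetric. *)
Record dual_lists (S T : finType) (s : S -> 'rV[R]_d) (t : T -> 'rV[R]_d) : Prop := DualLists {
  dual_in0 : conv s [set: S]%SET 0;
  dual_polar : polar (conv s [set: S]%SET) = conv t [set: T]%SET }.

Lemma dual_sym (S T : finType) (s : S -> 'rV[R]_d) (t : T -> 'rV[R]_d) : dual_lists s t -> dual_lists t s.
Proof.
by move=> [c0 e]; split; rewrite -e; [exact: polar0 | exact: bipolar].
Qed.

Section Lists.
Variables (S T : finType) (s : S -> 'rV[R]_d) (t : T -> 'rV[R]_d).
Hypothesis D : dual_lists s t.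

Lemma dual_le1 i j : dotp (s i) (t j) <= 1.
Proof.
have : polar (conv s [set: S]%SET) (t j).
  by rewrite (dual_polar D); apply: conv_in; rewrite finset.in_setT.
by move/polar_conv/(_ i); rewrite dotpC.
Qed.

(** If a = 0 and [y] is nonzero, the ray through -y lies in the polar, which is bounded. *)
Lemma dual_interior a y : nonneg (hom s) (aff a y) -> 0 < a \/ a = 0 /\ y = 0.
Proof.
move=> w0; have a0 : 0 <= a.
  by have := conv_ge0 (dual_in0 D) (w := aff a y); rewrite hvec_aff dotp0l addr0; apply=> i _; exact: w0.
move: a0; rewrite le_eqVlt => /orP[/eqP e|]; [right; split=> //|by left].
rewrite -e in w0; apply/rowP => k; rewrite mxE; apply: contrapT => /eqP yk.
pose M := \sum_j `|t j 0 k|.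
have bd x : conv t [set: T]%SET x -> `|x 0 k| <= M.
  have tM j : `|t j 0 k| <= M by rewrite /M (bigD1 j) //= lerDl sumr_ge0.
  move=> cx; rewrite ler_norml -[x 0 k]dotp_delta; apply/andP; split.
    have := conv_ge0 cx (w := aff M (delta_mx 0 k)); rewrite hvec_aff -lerBlDl sub0r; apply=> j _.
    by rewrite hom_ev dotp_delta; have := tM j; rewrite ler_norml => /andP[]; lra.
  have := conv_ge0 cx (w := aff M (- delta_mx 0 k)); rewrite hvec_aff dotpNr subr_ge0; apply=> j _.
  by rewrite hom_ev dotpNr dotp_delta; have := tM j; rewrite ler_norml => /andP[]; lra.
have M0 : 0 <= M by apply: sumr_ge0.
(* This makes the [k]-th coordinate of the point -c y of absolute value M + 1, beyond the bound. *)
pose c := (M + 1) / `|y 0 k|; have yk0 : 0 < `|y 0 k| by rewrite normr_gt0.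
have c0 : 0 <= c by rewrite divr_ge0 // addr_ge0.
have : conv t [set: T]%SET (- c *: y).
  rewrite -(dual_polar D); apply/polar_conv => i; rewrite dotpC dotpZr mulNr.
  have := w0 i; rewrite hom_ev add0r => h; have := mulr_ge0 c0 h; lra.
move/bd; rewrite mxE mulNr normrN normrM (ger0_norm c0) /c divfK ?gt_eqF //; lra.
Qed.

Lemma zeros_aff_setT a y : nonneg (hom s) (aff a y) -> 0 < a -> zeros (hom s) (aff a y) != [set: S]%SET.
Proof.
move=> w0 a0; apply/eqP => e; have := conv_eq0 (dual_in0 D) (w := aff a y).
rewrite hvec_aff dotp0l addr0 => h; move: a0; rewrite h ?ltxx // => i _.
have : i \in zeros (hom s) (aff a y) by rewrite e finset.in_setT.
by rewrite inE => /eqP.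
Qed.

Lemma face_neqT a y : nonneg (hom s) (aff a y) -> zeros (hom s) (aff a y) != [set: S]%SET -> 0 < a.
Proof.
move=> w0; case: (dual_interior w0) => // -[-> ->] /eqP[]; apply/setP => i.
by rewrite !inE hom_ev dotp0r addr0 eqxx.
Qed.

Lemma dual_rk : rk (hom s) [set: S]%SET = d.+1.
Proof.
apply/eqP; rewrite eqn_leq {1}/rk rank_leq_row /= /rk -mxrank_tr.
have : row_free (span (hom s) [set: S]%SET)^T.
  apply: inj_row_free => v vM; apply/trmx_inj; rewrite trmx0.
  have ek : span (hom s) [set: S]%SET *m v^T = 0 by apply/trmx_inj; rewrite trmx_mul trmxK vM trmx0.
  have [a [y ew]] := affP v^T.
  have ez i : ev (hom s) (aff a y) i = 0.
    by rewrite -ew; apply: ev_kill ek; apply: span_sup; rewrite finset.in_setT.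
  have nn : nonneg (hom s) (aff a y) by move=> i; rewrite ez.
  case: (dual_interior nn) => [a0|[a0 y0]]; last first.
    by rewrite ew a0 y0 /aff trmx0 raddf0 col_mx0.
  case/eqP: (zeros_aff_setT nn a0); apply/setP => i; by rewrite !inE ez eqxx.
by rewrite /row_free => /eqP->.
Qed.

Lemma dual_set0 : dual_face s t finset.set0 = [set: T]%SET.
Proof. by apply/setP => j; rewrite !inE; apply/forall_inP => i; rewrite inE. Qed.

Lemma dual_faceS (I J : {set S}) : I \subset J -> dual_face s t J \subset dual_face s t I.
Proof.
move=> sIJ; apply/fintype.subsetP => j; rewrite !inE => /forall_inP h; apply/forall_inP => i iI.
by apply: h; apply: (fintype.subsetP sIJ).
Qed.

(** The sum of the functionals 1 - <s_i, .>, each nonnegative on [t], vanishes exactly where all of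
    them do. *)
Lemma isface_dual (I : {set S}) : isface (hom t) (dual_face s t I).
Proof.
have evE j : ev (hom t) (\sum_(i in I) aff 1 (- s i)) j = \sum_(i in I) (1 - dotp (s i) (t j)).
  rewrite /ev mulmx_sumr summxE; apply: eq_bigr => i _.
  by rewrite hvec_aff dotpNr dotpC.
have ge i j : 0 <= 1 - dotp (s i) (t j) by rewrite subr_ge0 dual_le1.
apply/isfaceP; exists (\sum_(i in I) aff 1 (- s i)) => [j|]; first by rewrite evE sumr_ge0.
apply/setP => j; rewrite !inE evE psumr_eq0 //.
apply/forall_inP/allP => h i; first by move=> _; apply/implyP => /h; rewrite subr_eq0 eq_sym.
by move=> iI; have := h i; rewrite mem_index_enum iI /= subr_eq0 eq_sym => /(_ isT).
Qed.

End Lists.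

Lemma dual_faceC (S T : finType) (s : S -> 'rV[R]_d) (t : T -> 'rV[R]_d) J :
  dual_face t s J = [set i | [forall j in J, dotp (s i) (t j) == 1]]%SET.
Proof. by apply/setP => i; rewrite !inE; apply: eq_forallb => j; rewrite dotpC. Qed.

(** A functional a + <., y> with a > 0 corresponds to the point u = -y/a of the polar, tight exactly
    on [I]. As a convex combination, [u] uses only those t_j that are tight on all of [I]; an index
    tight for these is tight for [u], hence in [I]. *)
Lemma dual_faceK (S T : finType) (s : S -> 'rV[R]_d) (t : T -> 'rV[R]_d) I : dual_lists s t ->
  isface (hom s) I -> dual_face t s (dual_face s t I) = I.
Proof.
move=> D /isfaceP[w w0 eI]; have [a [y ew]] := affP w; rewrite {}ew in w0 eI.
apply/setP => k; rewrite dual_faceC inE; apply/forall_inP/idP => [h|kI j]; last first.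
  by rewrite inE => /forall_inP/(_ _ kI).
case: (dual_interior D w0) => [a0|[a0 y0]]; last first.
  by rewrite eI inE hom_ev a0 y0 dotp0r addr0.
pose u := - a^-1 *: y.
have evu i : dotp (s i) u = 1 <-> ev (hom s) (aff a y) i = 0.
  rewrite hom_ev /u dotpZr mulNr; split=> [e|/eqP].
    have : a * (a^-1 * dotp (s i) y) = - a by rewrite -[a^-1 * _]opprK e mulrN1.
    by rewrite mulVKf ?gt_eqF // => ->; rewrite subrr.
  by rewrite addrC addr_eq0 => /eqP->; rewrite mulrN opprK mulVf ?gt_eqF.
have : conv t [set: T]%SET u.
  rewrite -(dual_polar D); apply/polar_conv => i; rewrite dotpC /u dotpZr mulNr lerNl.
  rewrite -ler_pdivrMl ?invr_gt0 // invrK mulrN1; have := w0 i; rewrite hom_ev; lra.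
case/convP=> l [l0 _ l1 eu].
have evl i : dotp (s i) u = \sum_j l j * dotp (s i) (t j).
  by rewrite eu dotpC dotp_suml; apply: eq_bigr => j _; rewrite dotpZl dotpC.
rewrite eI inE; apply/eqP/evu; rewrite evl -[RHS]l1; apply: eq_bigr => j _.
have [->|lj] := eqVneq (l j) 0; first by rewrite mul0r.
suff /h/eqP-> : j \in dual_face s t I by rewrite mulr1.
rewrite inE; apply/forall_inP => i; rewrite eI inE => /eqP/evu; rewrite evl -{1}l1.
move/esym/eqP; rewrite -subr_eq0 -sumrB psumr_eq0 => [/allP/(_ j (mem_index_enum j))|m _].
  rewrite /= -{1}[l j]mulr1 -mulrBr mulf_eq0 (negbTE lj) /= subr_eq0 eq_sym; exact: id.
by rewrite -{1}[l m]mulr1 -mulrBr mulr_ge0 // subr_ge0 dual_le1.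
Qed.

Lemma dual_ch (S T : finType) (s : S -> 'rV[R]_d) (t : T -> 'rV[R]_d) : dual_lists s t ->
  ch (isface (hom t)) finset.set0 [set: T]%SET = ch (isface (hom s)) finset.set0 [set: S]%SET.
Proof.
move=> D; have D' := dual_sym D.
rewrite (@ch_anti S T (isface (hom s)) (isface (hom t)) (dual_face s t) (dual_face t s)).
- rewrite dual_set0; congr ch.
  by rewrite -[LHS](dual_faceK D' (isface_set0 t)) dual_set0.
- by move=> I _; exact: isface_dual.
- by move=> I _; exact: isface_dual.
- by move=> I J; exact: dual_faceS.
- by move=> I J; exact: dual_faceS.
- by move=> I; exact: dual_faceK.
- by move=> I; exact: dual_faceK.
- exact: isface_set0.
- exact: isface_setT.
- exact: finset.sub0set.
Qed.

End Dual.

(** * Chains in the face lattice of a join *)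

Section JoinCount.
Local Open Scope nat_scope.
Variables (T1 T2 : finType) (F1 : pred {set T1}) (F2 : pred {set T2}) (rk1 : {set T1} -> nat) (rk2 : {set T2} -> nat).
Variable F : pred {set T1 + T2}.
Implicit Types (K : {set T1 + T2}) (I : {set T1}) (J : {set T2}).

Definition sum_set I J : {set T1 + T2} := [set x | match x with inl i => i \in I | inr j => j \in J end]%SET.
Definition lpart K : {set T1} := [set i | inl i \in K]%SET.
Definition rpart K : {set T2} := [set j | inr j \in K]%SET.

Lemma lpart_sum I J : lpart (sum_set I J) = I.
Proof. by apply/setP => i; rewrite !inE. Qed.
Lemma rpart_sum I J : rpart (sum_set I J) = J.
Proof. by apply/setP => j; rewrite !inE. Qed.
Lemma sum_parts K : sum_set (lpart K) (rpart K) = K.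
Proof. by apply/setP => -[i|j]; rewrite !inE. Qed.
Lemma sum_setS I J I' J' : (sum_set I J \subset sum_set I' J') = (I \subset I') && (J \subset J').
Proof.
apply/idP/andP => [/fintype.subsetP s|[/fintype.subsetP s1 /fintype.subsetP s2]].
  split; apply/fintype.subsetP => x xI; first by have := s (inl x); rewrite !inE; apply.
  by have := s (inr x); rewrite !inE; apply.
by apply/fintype.subsetP => -[i|j]; rewrite !inE; [apply: s1 | apply: s2].
Qed.
Lemma sum_set_eq I J I' J' : (sum_set I J == sum_set I' J') = (I == I') && (J == J').
Proof. by rewrite !finset.eqEsubset !sum_setS; do !case: (_ \subset _). Qed.
Lemma sum_setT : sum_set [set: T1]%SET [set: T2]%SET = [set: T1 + T2]%SET.
Proof. by apply/setP => -[i|j]; rewrite !inE. Qed.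

Hypotheses (H1 : graded F1 rk1) (H2 : graded F2 rk2).
Hypotheses (F1T : F1 [set: T1]%SET) (F2T : F2 [set: T2]%SET).
Notation proper1 I := (F1 I && (I != [set: T1]%SET)).
Notation proper2 J := (F2 J && (J != [set: T2]%SET)).
(** The shape of the face lattice of a join whose summands have 0 in their interiors: proper faces
    are pairs of proper faces. *)
Hypothesis FE : forall K, F K = (K == [set: T1 + T2]%SET) || (proper1 (lpart K) && proper2 (rpart K)).

Let n1 := rk1 [set: T1]%SET.
Let n2 := rk2 [set: T2]%SET.

Lemma proper1_rk I : proper1 I -> rk1 I < n1.
Proof. by case/andP=> FI nI; apply: (graded_rk H1) => //; rewrite finset.properEneq nI finset.subsetT. Qed.
Lemma proper2_rk J : proper2 J -> rk2 J < n2.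
Proof. by case/andP=> FJ nJ; apply: (graded_rk H2) => //; rewrite finset.properEneq nJ finset.subsetT. Qed.

Lemma F_sum I J : proper1 I -> proper2 J -> F (sum_set I J).
Proof. by move=> h1 h2; rewrite FE lpart_sum rpart_sum h1 h2 orbT. Qed.

Lemma sum_neqT I J : proper1 I -> sum_set I J != [set: T1 + T2]%SET.
Proof. by move=> /andP[_ nI]; rewrite -sum_setT sum_set_eq (negbTE nI). Qed.

Lemma sum_proper I J K : proper1 I -> proper2 J -> F K -> sum_set I J \proper K -> K != [set: T1 + T2]%SET ->
  [/\ proper1 (lpart K), proper2 (rpart K), I \subset lpart K, J \subset rpart K & (I != lpart K) || (J != rpart K)].
Proof.
move=> h1 h2 FK p nK; move: FK p; rewrite FE (negbTE nK) finset.properEneq /= => /andP[k1 k2].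
by rewrite -{1 2}(sum_parts K) sum_set_eq sum_setS negb_and => /andP[n /andP[s1 s2]].
Qed.

Lemma cov_sum1 I J K : proper1 I -> proper2 J ->
  (cov F (sum_set I J) K && (K != [set: T1 + T2]%SET)) && (rpart K == J) =
  [&& cov F1 I (lpart K), lpart K != [set: T1]%SET & K == sum_set (lpart K) J].
Proof.
move=> h1 h2; apply/idP/idP => [/andP[/andP[c nK] /eqP eJ]|/and3P[c nI /eqP eK]].
  have [k1 k2 s1 s2 ns] := sum_proper h1 h2 (covF c) (cov_proper c) nK.
  rewrite eJ eqxx orbF in ns *; case/andP: (k1) => FK ->; rewrite -eJ sum_parts eqxx !andbT.
  apply: covI => //; first by rewrite finset.properEneq ns s1.
  move=> E FE0 p1 p2; have pE : proper1 E.
    by rewrite FE0; apply: contraTneq p2 => ->; rewrite fintype.properE finset.subsetT andbF.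
  have := covN c (F_sum pE h2); rewrite -(sum_parts K) eJ !fintype.properE !sum_setS !fintype.subxx !andbT.
  by rewrite -!fintype.properE p1 p2 => /(_ isT).
have k1 : proper1 (lpart K) by rewrite (covF c).
have eJ : rpart K = J by rewrite eK rpart_sum.
rewrite eJ eqxx andbT eK sum_neqT // andbT; apply: covI; first exact: F_sum.
  by rewrite fintype.properE !sum_setS !fintype.subxx !andbT -fintype.properE (cov_proper c).
move=> E FE0 p1 p2; have nE : E != [set: T1 + T2]%SET.
  by apply: contraTneq p2 => ->; rewrite fintype.properE finset.subsetT andbF.
have [e1 e2 s1 s2 ns] := sum_proper h1 h2 FE0 p1 nE.
move: p2; rewrite -(sum_parts E) finset.properEneq sum_set_eq sum_setS => /andP[+ /andP[t1 t2]].
have eJE : rpart E = J by apply/eqP; rewrite finset.eqEsubset t2.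
rewrite eJE eqxx orbF in ns; rewrite eJE eqxx andbT => ne.
case/andP: (e1) => FE1 _; have := covN c FE1; rewrite !finset.properEneq ns s1 ne t1.
by move=> /(_ isT).
Qed.

Lemma cov_sum2 I J K : proper1 I -> proper2 J ->
  (cov F (sum_set I J) K && (K != [set: T1 + T2]%SET)) && (lpart K == I) =
  [&& cov F2 J (rpart K), rpart K != [set: T2]%SET & K == sum_set I (rpart K)].
Proof.
move=> h1 h2; apply/idP/idP => [/andP[/andP[c nK] /eqP eJ]|/and3P[c nI /eqP eK]].
  have [k1 k2 s1 s2 ns] := sum_proper h1 h2 (covF c) (cov_proper c) nK.
  rewrite eJ eqxx /= in ns *; case/andP: (k2) => FK ->; rewrite -eJ sum_parts eqxx !andbT.
  apply: covI => //; first by rewrite finset.properEneq ns s2.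
  move=> E FE0 p1 p2; have pE : proper2 E.
    by rewrite FE0; apply: contraTneq p2 => ->; rewrite fintype.properE finset.subsetT andbF.
  have := covN c (F_sum h1 pE); rewrite -(sum_parts K) eJ !fintype.properE !sum_setS !fintype.subxx /=.
  by rewrite -!fintype.properE p1 p2 => /(_ isT).
have k1 : proper2 (rpart K) by rewrite (covF c).
have eJ : lpart K = I by rewrite eK lpart_sum.
rewrite eJ eqxx andbT eK sum_neqT // andbT; apply: covI; first exact: F_sum.
  by rewrite fintype.properE !sum_setS !fintype.subxx /= -fintype.properE (cov_proper c).
move=> E FE0 p1 p2; have nE : E != [set: T1 + T2]%SET.
  by apply: contraTneq p2 => ->; rewrite fintype.properE finset.subsetT andbF.
have [e1 e2 s1 s2 ns] := sum_proper h1 h2 FE0 p1 nE.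
move: p2; rewrite -(sum_parts E) finset.properEneq sum_set_eq sum_setS => /andP[+ /andP[t1 t2]].
have eJE : lpart E = I by apply/eqP; rewrite finset.eqEsubset t1.
rewrite eJE eqxx /= in ns; rewrite eJE eqxx /= => ne.
case/andP: (e2) => FE1 _; have := covN c FE1; rewrite !finset.properEneq ns s2 ne t2.
by move=> /(_ isT).
Qed.

Lemma cov_sum I J K : proper1 I -> proper2 J -> cov F (sum_set I J) K -> K != [set: T1 + T2]%SET ->
  (rpart K != J) = (lpart K == I).
Proof.
move=> h1 h2 c nK; have [k1 k2 s1 s2 ns] := sum_proper h1 h2 (covF c) (cov_proper c) nK.
apply/idP/eqP => [nJ|e]; last by move: ns; rewrite e eqxx /= eq_sym.
apply/eqP/negPn/negP => nI; move: c; rewrite -(sum_parts K) => c.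
have := covN c (F_sum h1 k2); rewrite !finset.properEneq !sum_set_eq !sum_setS ?rpart_sum !eqxx.
by rewrite !fintype.subxx s1 s2 [J == _]eq_sym [I == _]eq_sym (negbTE nJ) (negbTE nI) => /(_ isT).
Qed.

(** The step to the top is common to both parts, so covers equal to the top are left out of the sum
    in each part; for a coatom nothing remains. *)
Lemma sum_cov_proper (T : finType) (G : pred {set T}) rk (I : {set T}) : graded G rk -> G [set: T]%SET -> G I -> I != [set: T]%SET ->
  \sum_(C | cov G I C && (C != [set: T]%SET)) ch G C [set: T]%SET =
  (if (rk I).+1 < rk [set: T]%SET then ch G I [set: T]%SET else 0).
Proof.
move=> H GT GI nI; have pI : I \proper [set: T]%SET by rewrite finset.properEneq nI finset.subsetT.
case: ifP => r; last first.
  rewrite big_pred0 // => C; apply/negbTE/negP => /andP[c nC].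
  have := cov_rk H GI c; have pC : C \proper [set: T]%SET by rewrite finset.properEneq nC finset.subsetT.
  by have := graded_rk H (covF c) GT pC; move: r; clear; lia.
rewrite ch_step //; apply: eq_bigl => C; rewrite finset.subsetT andbT.
case c : (cov G I C) => //=; apply: contraTneq r => e; have := cov_rk H GI c; rewrite e; clear; lia.
Qed.

(** A maximal chain shuffles the steps among proper faces of the two parts and ends with one common
    step to the top. Hence each part contributes its corank minus one, and Pascal's rule closes the
    induction. *)
Lemma ch_sum I J : proper1 I -> proper2 J -> ch F (sum_set I J) [set: T1 + T2]%SET =
  'C((n1 - rk1 I).-1 + (n2 - rk2 J).-1, (n1 - rk1 I).-1) * (ch F1 I [set: T1]%SET * ch F2 J [set: T2]%SET).
Proof.
have [m] := ubnP ((n1 - rk1 I) + (n2 - rk2 J)); elim: m I J => // m IH I J hm h1 h2.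
have [FI nI] := andP h1; have [FJ nJ] := andP h2.
have r1 := proper1_rk h1; have r2 := proper2_rk h2.
have FT : F [set: T1 + T2]%SET by rewrite FE eqxx.
have pT : sum_set I J \proper [set: T1 + T2]%SET by rewrite finset.properEneq sum_neqT // finset.subsetT.
have neq K : K \proper [set: T1 + T2]%SET -> K != [set: T1 + T2]%SET by rewrite finset.properEneq => /andP[].
case: (boolP (((rk1 I).+1 == n1) && ((rk2 J).+1 == n2))) => [/andP[/eqP e1 /eqP e2]|ne].
  have i1 : cov F1 I [set: T1]%SET.
    by apply: (rk_cov H1) => //; [rewrite finset.properEneq nI finset.subsetT | rewrite -/n1 e1].
  have i2 : cov F2 J [set: T2]%SET.
    by apply: (rk_cov H2) => //; [rewrite finset.properEneq nJ finset.subsetT | rewrite -/n2 e2].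
  rewrite (cov_ch i1) (cov_ch i2) -e1 -e2 !subSnn /= bin0 cov_ch //; apply: covI => // E FE0 p1 /neq nE.
  have [k1 k2 s1 s2 ns] := sum_proper h1 h2 FE0 p1 nE.
  have := proper1_rk k1; have := proper2_rk k2.
  case/orP: ns => n.
    have := graded_rk H1 FI (andP k1).1; rewrite finset.properEneq n s1 => /(_ isT); move: e1; clear; lia.
  have := graded_rk H2 FJ (andP k2).1; rewrite finset.properEneq n s2 => /(_ isT); move: e2; clear; lia.
have ncT : ~~ cov F (sum_set I J) [set: T1 + T2]%SET.
  have tr1 : (rk1 I).+1 < n1 -> exists2 C, proper1 C & I \proper C.
    move=> r; have [|C [FC p q]] := graded_mid H1 FI F1T _ r.
      by rewrite finset.properEneq nI finset.subsetT.
    by exists C => //; rewrite FC; move: q; rewrite finset.properEneq => /andP[].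
  have tr2 : (rk2 J).+1 < n2 -> exists2 C, proper2 C & J \proper C.
    move=> r; have [|C [FC p q]] := graded_mid H2 FJ F2T _ r.
      by rewrite finset.properEneq nJ finset.subsetT.
    by exists C => //; rewrite FC; move: q; rewrite finset.properEneq => /andP[].
  apply/negP => c; case: (ltnP (rk1 I).+1 n1) => [/tr1[C hC pC]|l1].
    have pP : sum_set I J \proper sum_set C J.
      by rewrite fintype.properE !sum_setS !fintype.subxx !andbT -fintype.properE.
    by have := covN c (F_sum hC h2) pP; rewrite finset.properEneq (sum_neqT _ hC) finset.subsetT.
  case: (ltnP (rk2 J).+1 n2) => [/tr2[C hC pC]|l2]; last first.
    by case/negP: ne; rewrite !eqn_leq r1 r2 l1 l2.
  have pP : sum_set I J \proper sum_set I C.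
    by rewrite fintype.properE !sum_setS !fintype.subxx /= -fintype.properE.
  by have := covN c (F_sum h1 hC) pP; rewrite finset.properEneq (sum_neqT _ h1) finset.subsetT.
rewrite ch_step // (eq_bigl (fun K => cov F (sum_set I J) K && (K != [set: T1 + T2]%SET))); last first.
  move=> K; rewrite finset.subsetT andbT; case c : (cov _ _ _) => //=; apply/esym.
  by apply: contraNneq ncT => <-.
rewrite (bigID (fun K => rpart K == J)) /=.
have -> : \sum_(K | (cov F (sum_set I J) K && (K != [set: T1 + T2]%SET)) && (rpart K == J)) ch F K [set: T1 + T2]%SET =
    \sum_(C | cov F1 I C && (C != [set: T1]%SET)) 'C((n1 - (rk1 I).+1).-1 + (n2 - rk2 J).-1, (n1 - (rk1 I).+1).-1) * (ch F1 C [set: T1]%SET * ch F2 J [set: T2]%SET).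
  rewrite (eq_bigl _ _ (fun K => cov_sum1 K h1 h2)) (reindex_onto (fun C => sum_set C J) lpart) /=.
    apply: eq_big => [C|C]; first by rewrite lpart_sum !eqxx !andbT.
    rewrite lpart_sum => /andP[/and3P[c nC _] _]; rewrite IH ?(covF c) // (cov_rk H1 FI c) //.
    by move: hm r1 r2; clear; lia.
  by move=> K /and3P[_ _ /eqP <-].
have -> : \sum_(K | (cov F (sum_set I J) K && (K != [set: T1 + T2]%SET)) && (rpart K != J)) ch F K [set: T1 + T2]%SET =
    \sum_(C | cov F2 J C && (C != [set: T2]%SET)) 'C((n1 - rk1 I).-1 + (n2 - (rk2 J).+1).-1, (n1 - rk1 I).-1) * (ch F1 I [set: T1]%SET * ch F2 C [set: T2]%SET).
  rewrite (eq_bigl (fun K => (cov F (sum_set I J) K && (K != [set: T1 + T2]%SET)) && (lpart K == I))); last first.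
    by move=> K; apply: andb_id2l => /andP[c nK]; exact: cov_sum.
  rewrite (eq_bigl _ _ (fun K => cov_sum2 K h1 h2)) (reindex_onto (fun C => sum_set I C) rpart) /=.
    apply: eq_big => [C|C]; first by rewrite rpart_sum !eqxx !andbT.
    rewrite rpart_sum => /andP[/and3P[c nC _] _]; rewrite IH ?(covF c) // (cov_rk H2 FJ c) //.
    by move: hm r1 r2; clear; lia.
  by move=> K /and3P[_ _ /eqP <-].
rewrite -!big_distrr -big_distrl /= (sum_cov_proper H1) // (sum_cov_proper H2) // -/n1 -/n2.
set x := ch F1 I _; set y := ch F2 J _; move: r1 r2 ne; clearbody n1 n2 x y; move: (rk1 I) (rk2 J) => a b; clear.
move=> r1 r2 ne.
have [p ep] : exists p, n1 = (a + p).+1 by exists (n1 - a).-1; move: r1; clear; lia.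
have [q eq] : exists q, n2 = (b + q).+1 by exists (n2 - b).-1; move: r2; clear; lia.
have -> : (n1 - a).-1 = p by rewrite ep; clear; lia.
have -> : (n2 - b).-1 = q by rewrite eq; clear; lia.
have -> : (n1 - a.+1).-1 = p.-1 by rewrite ep; clear; lia.
have -> : (n2 - b.+1).-1 = q.-1 by rewrite eq; clear; lia.
have -> : (a.+1 < n1) = (0 < p) by rewrite ep; apply/idP/idP; clear; lia.
have -> : (b.+1 < n2) = (0 < q) by rewrite eq; apply/idP/idP; clear; lia.
have : (0 < p) || (0 < q) by move: ne; rewrite ep eq; clear; lia.
case: p {ep} => [|p]; case: q {eq} => [|q] //= _.
- by rewrite muln0 !add0n !bin0.
- by rewrite !muln0 addn0 !addn0 !binn.
- by rewrite -mulnDl [in RHS]addSn binS addSnnS [in RHS]addnC.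
Qed.

End JoinCount.

Lemma dotp_eq0 (R : realType) d (x : 'rV[R]_d) : dotp x x = 0 -> x = 0.
Proof.
move=> /eqP; rewrite psumr_eq0 => [/allP h|i _]; last by rewrite -expr2 sqr_ge0.
by apply/rowP => i; have := h i (mem_index_enum i); rewrite /= -expr2 sqrf_eq0 mxE => /eqP.
Qed.

Lemma polar_hull (R : realType) d (A : set 'rV[R]_d) : polar (convex_hull A) = polar A.
Proof.
apply/seteqP; split=> x h y; first by move=> Ay; apply: h; exact: sub_convex_hull.
move=> [n [p [w [hp w0 w1 ->]]]]; rewrite dotpC dotp_suml -[leRHS]w1; apply: ler_sum => i _.
by rewrite dotpZl ler_piMr // dotpC h.
Qed.

(** * Joins in orthogonal subspaces *)

Section Join.
Variables (R : realType) (k l : nat).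
Variables (f : {linear 'rV[R]_k -> 'rV[R]_(k + l)}) (g : {linear 'rV[R]_l -> 'rV[R]_(k + l)}).
Hypothesis ff : forall x y : 'rV[R]_k, dotp (f x) (f y) = dotp x y.
Hypothesis gg : forall x y : 'rV[R]_l, dotp (g x) (g y) = dotp x y.
Hypothesis fg : forall (x : 'rV[R]_k) (y : 'rV[R]_l), dotp (f x) (g y) = 0.
Implicit Types (x : 'rV[R]_k) (y : 'rV[R]_l).

Lemma dotp_fl x x' y : dotp (f x) (f x' + g y) = dotp x x'.
Proof. by rewrite dotpDr ff fg addr0. Qed.
Lemma dotp_gl x y y' : dotp (g y) (f x + g y') = dotp y y'.
Proof. by rewrite dotpDr gg dotpC fg add0r. Qed.
Lemma dotp_fgl x x' y y' : dotp (f x + g y) (f x' + g y') = dotp x x' + dotp y y'.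
Proof. by rewrite dotpDl dotp_fl dotp_gl. Qed.

(** The isometries [f] and [g] are jointly injective, hence onto by dimension. *)
Lemma ortho_sum z : exists x y, z = f x + g y.
Proof.
pose A := col_mx (lin1_mx f) (lin1_mx g).
have AE x y : row_mx x y *m A = f x + g y by rewrite mul_row_col !mul_rV_lin1.
have : A \in unitmx.
  rewrite -row_free_unit; apply: inj_row_free => v; rewrite -[v]hsubmxK AE => e.
  have ez w : dotp w (f (lsubmx v) + g (rsubmx v)) = 0 by rewrite e dotp0r.
  by rewrite (dotp_eq0 (etrans (esym (dotp_fl _ _ _)) (ez _))) (dotp_eq0 (etrans (esym (dotp_gl _ _ _)) (ez _))) row_mx0.
move=> uA; exists (lsubmx (z *m invmx A)), (rsubmx (z *m invmx A)).
by rewrite -AE hsubmxK mulmxKV.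
Qed.

Lemma polar_join (P : set 'rV[R]_k) (Q : set 'rV[R]_l) z : polar (convex_hull (f @` P `|` g @` Q)) z <->
  exists x y, [/\ polar P x, polar Q y & z = f x + g y].
Proof.
rewrite polar_hull; split=> [h|[x [y [hx hy ->]]] _ [[u Pu <-]|[v Qv <-]]].
- have [x [y e]] := ortho_sum z; exists x, y; split=> // u hu.
    by rewrite dotpC -(dotp_fl u x y) -e dotpC; apply: h; left; exists u.
  by rewrite dotpC -(dotp_gl x u y) -e dotpC; apply: h; right; exists u.
- by rewrite dotpC dotp_fl dotpC hx.
- by rewrite dotpC dotp_gl dotpC hy.
Qed.

Variables (S1 S2 T1 T2 : finType).
Variables (s1 : S1 -> 'rV[R]_k) (s2 : S2 -> 'rV[R]_l) (t1 : T1 -> 'rV[R]_k) (t2 : T2 -> 'rV[R]_l).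

Definition join_list (i : S1 + S2) := match i with inl i => f (s1 i) | inr j => g (s2 j) end.
(** Generators of the product of the polars, which is the polar of the join. *)
Definition prod_list (p : T1 * T2) := f (t1 p.1) + g (t2 p.2).

Lemma conv_join : convex_hull (f @` conv s1 [set: S1]%SET `|` g @` conv s2 [set: S2]%SET) = conv join_list [set: S1 + S2]%SET.
Proof.
apply/seteqP; split.
  apply: convex_hull_conv => z zU; apply: conv_setT => w; have [a [y ->]] := affP w.
  have [y1 [y2 ->]] := ortho_sum y => w0; rewrite hvec_aff.
  case: zU => [[x cx <-]|[x cx <-]].
    rewrite dotp_fl; have := conv_ge0 cx (w := aff a y1); rewrite hvec_aff; apply=> i _.
    by have := w0 (inl i); rewrite !hom_ev dotp_fl.
  rewrite dotp_gl; have := conv_ge0 cx (w := aff a y2); rewrite hvec_aff; apply=> i _.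
  by have := w0 (inr i); rewrite !hom_ev dotp_gl.
apply: convex_hullS => _ [[i|j] _ <-]; [left | right].
  by exists (s1 i) => //; apply: conv_in; rewrite finset.in_setT.
by exists (s2 j) => //; apply: conv_in; rewrite finset.in_setT.
Qed.

Lemma conv_prod x y : conv t1 [set: T1]%SET x -> conv t2 [set: T2]%SET y ->
  conv prod_list [set: T1 * T2]%SET (f x + g y).
Proof.
move=> cx cy; apply: conv_setT => w; have [a [u ->]] := affP w.
have [u1 [u2 ->]] := ortho_sum u => w0; rewrite hvec_aff dotp_fgl addrA -hvec_aff.
apply: (conv_ge0 cy) => j _; rewrite hom_ev addrAC -hvec_aff.
apply: (conv_ge0 cx) => i _; rewrite hom_ev addrAC -addrA.
by have := w0 (i, j); rewrite hom_ev dotp_fgl.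
Qed.

Hypotheses (D1 : dual_lists s1 t1) (D2 : dual_lists s2 t2).

Lemma dual_join : dual_lists join_list prod_list.
Proof.
split.
  rewrite -conv_join; apply: sub_convex_hull; left; exists 0; last exact: linear0.
  exact: dual_in0 D1.
rewrite -conv_join; apply/seteqP; split=> z.
  move/polar_join => [x [y [+ + ->]]]; rewrite (dual_polar D1) (dual_polar D2).
  exact: conv_prod.
rewrite conv_join => cz; apply/polar_conv => i; rewrite -subr_ge0 -dotpNr -hvec_aff.
apply: (conv_ge0 cz) => -[p q] _; rewrite hom_ev dotpNr subr_ge0 dotpC.
by case: i => i /=; rewrite ?dotp_fl ?dotp_gl; [exact: (dual_le1 D1) | exact: (dual_le1 D2)].
Qed.

(** A functional on the join restricts to both summands with the same constant [a]: if a > 0 both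
    zero sets are proper, and if a = 0 it is zero by [dual_interior]. Conversely, functionals of
    proper faces are glued after scaling both constants to 1. *)
Lemma face_join (K : {set S1 + S2}) : isface (hom join_list) K = (K == [set: S1 + S2]%SET) ||
  (isface (hom s1) (lpart K) && (lpart K != [set: S1]%SET)) &&
  (isface (hom s2) (rpart K) && (rpart K != [set: S2]%SET)).
Proof.
have evl a (y1 : 'rV[R]_k) y2 i : ev (hom join_list) (aff a (f y1 + g y2)) (inl i) = ev (hom s1) (aff a y1) i.
  by rewrite !hom_ev dotp_fl.
have evr a (y1 : 'rV[R]_k) y2 i : ev (hom join_list) (aff a (f y1 + g y2)) (inr i) = ev (hom s2) (aff a y2) i.
  by rewrite !hom_ev dotp_gl.
apply/idP/idP => [/isfaceP[w w0 ->]|/orP[/eqP->|/andP[/andP[/isfaceP[w1 p1 e1] n1] /andP[/isfaceP[w2 p2 e2] n2]]]].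
- move: w0; have [a [y ->]] := affP w; have [y1 [y2 ->]] := ortho_sum y => w0.
  have el : lpart (zeros (hom join_list) (aff a (f y1 + g y2))) = zeros (hom s1) (aff a y1).
    by apply/setP => i; rewrite !inE evl.
  have er : rpart (zeros (hom join_list) (aff a (f y1 + g y2))) = zeros (hom s2) (aff a y2).
    by apply/setP => i; rewrite !inE evr.
  have h1 : nonneg (hom s1) (aff a y1) by move=> i; have := w0 (inl i); rewrite evl.
  have h2 : nonneg (hom s2) (aff a y2) by move=> i; have := w0 (inr i); rewrite evr.
  case: (dual_interior D1 h1) => [a0|[a0 y10]].
    rewrite el er (zeros_aff_setT D1) // (zeros_aff_setT D2) // !andbT.
    by rewrite orbC; apply/orP; left; apply/andP; split; apply/isfaceP; [exists (aff a y1) | exists (aff a y2)].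
  case: (dual_interior D2 h2) => [|[_ y20]]; first by rewrite a0 ltxx.
  apply/orP; left; apply/eqP/setP => -[i|i]; rewrite inE ?evl ?evr a0 ?y10 ?y20 hom_ev dotp0r addr0 eqxx ?inE //.
- exact: isface_setT.
have [a [y1 ea]] := affP w1; have [b [y2 eb]] := affP w2; rewrite {}ea in p1 e1; rewrite {}eb in p2 e2.
have a0 : 0 < a by apply: (face_neqT D1 p1); rewrite -e1.
have b0 : 0 < b by apply: (face_neqT D2 p2); rewrite -e2.
have scl d (T : finType) (s : T -> 'rV[R]_d) c (y : 'rV[R]_d) i : 0 < c ->
    ev (hom s) (aff 1 (c^-1 *: y)) i = c^-1 * ev (hom s) (aff c y) i.
  by move=> c0; rewrite !hom_ev dotpZr mulrDr mulVf ?gt_eqF.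
apply/isfaceP; exists (aff 1 (f (a^-1 *: y1) + g (b^-1 *: y2))) => [[i|i]|].
- by rewrite evl scl // mulr_ge0 ?invr_ge0 // ltW.
- by rewrite evr scl // mulr_ge0 ?invr_ge0 // ltW.
rewrite -[LHS]sum_parts e1 e2; apply/setP => -[i|i]; rewrite !inE ?evl ?evr scl // mulf_eq0 invr_eq0 ?(gt_eqF a0) ?(gt_eqF b0) //.
Qed.

Lemma ch_join : ch (isface (hom join_list)) finset.set0 [set: S1 + S2]%SET =
  ('C(k + l, k) * (ch (isface (hom s1)) finset.set0 [set: S1]%SET * ch (isface (hom s2)) finset.set0 [set: S2]%SET))%N.
Proof.
have r1 := dual_rk D1; have r2 := dual_rk D2.
have -> : finset.set0 = sum_set finset.set0 finset.set0 :> {set S1 + S2} by apply/setP => -[i|i]; rewrite !inE.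
have np d (S : finType) (s : S -> 'rV[R]_d) : rk (hom s) [set: S]%SET = d.+1 -> finset.set0 != [set: S]%SET.
  by move=> r; apply: contra_eq_neq r => <-; rewrite rk_set0.
rewrite (ch_sum (faces_graded (hom s1)) (faces_graded (hom s2)) (isface_setT _) (isface_setT _) face_join).
- by rewrite !rk_set0 r1 r2 !subn0.
- by rewrite isface_set0 (np _ _ _ r1).
- by rewrite isface_set0 (np _ _ _ r2).
Qed.

End Join.

(** * The segment, and flags of Hanner polytopes *)

Section Segment.
Variable R : realType.

Let s (b : bool) : 'rV[R]_1 := const_mx ((-1) ^+ b).

Lemma conv_segment : conv s [set: bool]%SET = [set x | -1 <= x 0 0 <= 1].
Proof.
apply/seteqP; split=> x.
  move=> cx; have := conv_ge0 cx (w := aff 1 (delta_mx 0 0)); have := conv_ge0 cx (w := aff 1 (- delta_mx 0 0)).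
  rewrite !hvec_aff dotpNr dotp_delta /= => h1 h2; apply/andP; split.
    by rewrite -subr_ge0 opprK addrC; apply: h2 => -[] _; rewrite hom_ev dotp_delta mxE ?expr1 ?expr0; lra.
  by rewrite -subr_ge0; apply: h1 => -[] _; rewrite hom_ev dotpNr dotp_delta mxE ?expr1 ?expr0; lra.
move=> /andP[h1 h2]; apply/convP; exists (fun b => if b then (1 - x 0 0) / 2 else (1 + x 0 0) / 2); split.
- by case; lra.
- by move=> b; rewrite finset.in_setT.
- by rewrite big_bool /=; lra.
- by apply/rowP => i; rewrite big_bool !mxE !ord1 expr1 expr0 /=; lra.
Qed.

Lemma dual_segment : dual_lists s s.
Proof.
split; first by rewrite conv_segment /= mxE; apply/andP; split; lra.
apply/seteqP; split=> x; last first.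
  move=> cx; apply/polar_conv; move: cx; rewrite conv_segment => /= h -[]; rewrite /dotp big_ord1 !mxE ?expr1 ?expr0; lra.
move=> /polar_conv h; rewrite conv_segment /=; have := h true; have := h false.
by rewrite /dotp !big_ord1 !mxE expr1 expr0; lra.
Qed.

Lemma ch_segment : ch (isface (hom s)) finset.set0 [set: bool]%SET = 2%N.
Proof.
have F (A : {set bool}) : isface (hom s) A.
  pose c (b : bool) : R := if b \in A then 0 else 1.
  have evE b : ev (hom s) (aff ((c true + c false) / 2) (const_mx ((c false - c true) / 2))) b = c b.
    by rewrite hom_ev /dotp big_ord1 !mxE; case: b; rewrite ?expr1 ?expr0; field.
  apply/isfaceP; exists (aff ((c true + c false) / 2) (const_mx ((c false - c true) / 2))).
    by move=> b; rewrite evE /c; case: ifP.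
  by apply/setP => b; rewrite inE evE /c; case: ifP; rewrite ?eqxx ?oner_eq0.
have cT (A : {set bool}) : #|A| = 1%N -> cov (isface (hom s)) A [set: bool]%SET.
  move=> cA; apply: covI => [||E _ /proper_card h1 /proper_card h2].
  - exact: F.
  - by rewrite finset.properEcard finset.subsetT cA cardsT card_bool.
  - by move: h1 h2; rewrite cA cardsT card_bool; clear; lia.
have c0 (A : {set bool}) : cov (isface (hom s)) finset.set0 A = (#|A| == 1%N).
  apply/idP/eqP => [c|cA]; last first.
    by apply: covI => // [|E _ /proper_card h1 /proper_card]; rewrite ?cA ?finset.proper0 -?finset.card_gt0 ?cA //; move: h1; rewrite cards0; clear; lia.
  have := cov_proper c; rewrite finset.proper0 => /finset.set0Pn[b bA].
  have := covN c (F [set b]%SET); rewrite finset.proper0 -finset.card_gt0 cards1 => /(_ isT).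
  rewrite finset.properEneq finset.sub1set bA andbT negbK => /eqP<-; exact: cards1.
rewrite ch_step ?finset.proper0 -?finset.card_gt0 ?cardsT ?card_bool //.
rewrite (eq_bigr (fun _ => 1%N)) => [|A /andP[]]; last by rewrite c0 => /eqP/cT/cov_ch.
rewrite (_ : 2%N = 'C(#|{: bool}|, 1)); last by rewrite card_bool.
by rewrite -card_draws -sum1_card; apply: eq_bigl => A; rewrite inE c0 finset.subsetT andbT.
Qed.

End Segment.

(** With the dual list carried along, polarity merely exchanges the lists, and the interior
    condition needed for joins is at hand. *)
Theorem hanner_lists (R : realType) d (P : set 'rV[R]_d) : hanner P ->
  exists (S T : finType) (s : S -> 'rV[R]_d) (t : T -> 'rV[R]_d),
    [/\ P = conv s [set: S]%SET, dual_lists s t & ch (isface (hom s)) finset.set0 [set: S]%SET = nflags d].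
Proof.
elim=> {d P} [|d P _ [S [T [s [t [-> D e]]]]]|k l P Q f g _ [S1 [T1 [s1 [t1 [-> D1 e1]]]]] _ [S2 [T2 [s2 [t2 [-> D2 e2]]]]] ff gg fg].
- exists bool, bool; do 2![exists (fun b : bool => const_mx ((-1) ^+ b))].
  by split; [rewrite conv_segment | exact: dual_segment | exact: ch_segment].
- exists T, S, t, s; split; [exact: dual_polar D | exact: dual_sym | by rewrite (dual_ch D)].
exists (S1 + S2)%type, (T1 * T2)%type, (join_list f g s1 s2), (prod_list f g t1 t2).
by split; [exact: conv_join | exact: dual_join | rewrite (ch_join ff gg fg D1 D2) e1 e2 mulnA nflags_shuffle].
Qed.

(** * Graphs without induced path on four vertices *)

Section Cographs.
Local Open Scope nat_scope.
Variable V : finType.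
Implicit Types (e : rel V) (A B : {set V}).

Definition compl_rel e : rel V := [rel x y | (x != y) && ~~ e x y].

Lemma compl_sym e : symmetric e -> symmetric (compl_rel e).
Proof. by move=> se x y; rewrite /compl_rel /= se eq_sym. Qed.

Lemma compl_irr e : irreflexive (compl_rel e).
Proof. by move=> x; rewrite /compl_rel /= eqxx. Qed.

(** The complement of the path a b c z is the path c a z b. *)
Lemma compl_P4 e : symmetric e -> P4_free e -> P4_free (compl_rel e).
Proof.
move=> se h a b c z eab ebc ecz nac naz nbz; have sc := compl_sym se.
have N x y : x != y -> ~~ compl_rel e x y -> e x y by rewrite /compl_rel /= => -> /=; rewrite negbK.
have Y x y : compl_rel e x y -> ~~ e x y by case/andP.
have ac : a != c by apply: contraNneq naz => ->.
have az : a != z by apply: contraNneq nbz => <-; rewrite sc.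
have bz : b != z by apply: contraNneq naz => <-.
apply: (h c a z b); rewrite ?[e c a]se ?[e z b]se ?[e c b]se; try exact: N; exact: Y.
Qed.

Lemma compl_relK e : irreflexive e -> compl_rel (compl_rel e) = e.
Proof.
move=> ie; apply/funext => x; apply/funext => y; rewrite /compl_rel /=; have [->|n] := eqVneq x y; first by rewrite ie.
by rewrite /= negbK.
Qed.

(* D is the component of u in B: an edge of B with exactly one end adjacent to v would
   extend through v and z to an induced path. *)
Lemma component_split e A B v : symmetric e -> P4_free e -> v \in A -> B \proper A :\ v -> B != finset.set0 ->
  (forall x y, x \in B -> y \in (A :\ v) :\: B -> ~~ e x y) ->
  forall u z, u \in B -> ~~ e u v -> z \in (A :\ v) :\: B -> e z v ->
  exists2 D : {set V}, (D != finset.set0) && (D \proper A) & forall x y, x \in D -> y \in A :\: D -> ~~ e x y.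
Proof.
move=> se P4 vA pB B0 sep u z uB nuv zB ezv.
pose r := [rel x y | [&& x \in B, y \in B & e x y]].
pose D := [set y in B | connect r u y]%SET.
have rs : connect_sym r by apply: sym_connect_sym => x y; rewrite /= se andbCA.
have nv y : y \in D -> ~~ e y v.
  rewrite inE => /andP[yB uy]; have cl : closed r [pred x | e x v].
    apply: (intro_closed rs) => x w /and3P[xB wB xw] /= xv; apply/negPn/negP => nwv.
    by apply: (P4 w x v z _ xv _ nwv (sep _ _ wB zB) (sep _ _ xB zB)); rewrite se.
  by have := closed_connect cl uy; rewrite !inE (negbTE nuv) => <-.
have uD : u \in D by rewrite inE uB connect0.
have sDB : D \subset B by apply/fintype.subsetP => x; rewrite inE => /andP[].
have sBA : B \subset A :\ v := proper_sub pB.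
exists D; last first.
  move=> x y xD; rewrite inE => /andP[nyD yA]; have xB := fintype.subsetP sDB x xD.
  have [->|nyv] := eqVneq y v; first exact: nv.
  have [yB|yB] := boolP (y \in B); last by apply: sep => //; rewrite !inE yB nyv.
  apply: contra nyD => xy; rewrite inE yB /=; move: xD; rewrite inE => /andP[_ ux].
  by apply: connect_trans ux (connect1 _); rewrite /= xB yB.
apply/andP; split; first by apply/finset.set0Pn; exists u.
apply/properP; split; first exact: fintype.subset_trans sDB (fintype.subset_trans sBA (subD1set _ _)).
by exists v => //; apply/negP => /(fintype.subsetP sDB)/(fintype.subsetP sBA); rewrite !inE eqxx.
Qed.

(** If [v] has a nonneighbour in one of [B], [C] and a neighbour in the other, [component_split]
    applies. Otherwise [v] is joined to all or to none of the remaining vertices, and {v} splits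
    [A]. *)
Lemma seinsche_step e A B v : symmetric e -> irreflexive e -> P4_free e -> v \in A -> B \proper A :\ v -> B != finset.set0 ->
  (forall x y, x \in B -> y \in (A :\ v) :\: B -> ~~ e x y) ->
  exists (D : {set V}) b, (D != finset.set0) && (D \proper A) /\ forall x y, x \in D -> y \in A :\: D -> e x y = b.
Proof.
move=> se ie P4 vA pB B0 sep; pose C := ((A :\ v) :\: B)%SET.
have CE : ((A :\ v) :\: C)%SET = B.
  apply/setP => x; rewrite !inE; have := fintype.subsetP (proper_sub pB) x; rewrite !inE.
  by case: (x \in B) => [/(_ isT)/andP[-> ->]//|_]; case: (x == v); case: (x \in A).
have C0 : C != finset.set0.
  by have /properP[_ [c cA cB]] := pB; apply/finset.set0Pn; exists c; rewrite inE cB cA.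
have pC : C \proper A :\ v.
  rewrite finset.properEneq subsetDl andbT; apply: contra_neq B0 => eC.
  by rewrite -CE eC finset.setDv.
have sepC x y : x \in C -> y \in (A :\ v) :\: C -> ~~ e x y.
  by rewrite CE => xC yB; rewrite se; exact: sep.
have comp : (exists2 D : {set V}, (D != finset.set0) && (D \proper A) & forall x y, x \in D -> y \in A :\: D -> ~~ e x y) ->
    exists (D : {set V}) b, (D != finset.set0) && (D \proper A) /\ forall x y, x \in D -> y \in A :\: D -> e x y = b.
  by case=> D pD h; exists D, false; split=> // x y xD yD; apply/negbTE; exact: h.
have vsplit b : (forall x, x \in A :\ v -> e x v = b) ->
    exists (D : {set V}) b, (D != finset.set0) && (D \proper A) /\ forall x y, x \in D -> y \in A :\: D -> e x y = b.
  move=> h; exists [set v]%SET, b; split.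
    rewrite -finset.card_gt0 cards1 /=; apply/properP; split; first by rewrite finset.sub1set.
    have /properP[_ [c]] := pB; rewrite !inE => /andP[cv cA] _; exists c => //.
    by rewrite inE.
  by move=> x y; rewrite inE => /eqP->; rewrite se => /h.
have inBC x : x \in A :\ v -> (x \in B) || (x \in C) by move=> xA; rewrite [in X in _ || X]inE xA andbT orbN.
have [[u uB nuv]|allB] : (exists2 u, u \in B & ~~ e u v) \/ (forall x, x \in B -> e x v).
- have [/exists_inP[u uB h]|/exists_inPn h] := boolP [exists u in B, ~~ e u v]; [by left; exists u | right=> x /h].
  by rewrite negbK.
- have [/exists_inP[z zC ezv]|/exists_inPn noC] := boolP [exists z in C, e z v].
    by apply: comp; exact: (component_split se P4 vA pB B0 sep uB nuv zC ezv).
  have [/exists_inP[z zB ezv]|/exists_inPn noB] := boolP [exists z in B, e z v].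
    have [c cC] := finset.set0Pn _ C0.
    by apply: comp; apply: (component_split se P4 vA pC C0 sepC cC (noC _ cC) _ ezv); rewrite CE.
  by apply: (vsplit false) => x /inBC/orP[/noB|/noC] /negbTE.
have [c cB] := finset.set0Pn _ B0.
have [/exists_inP[u uC nuv]|/exists_inPn allC] := boolP [exists u in C, ~~ e u v].
  by apply: comp; apply: (component_split se P4 vA pC C0 sepC uC nuv _ (allB _ cB)); rewrite CE.
by apply: (vsplit true) => x /inBC/orP[/allB//|/allC]; rewrite negbK.
Qed.

(** [b] distinguishes a disconnected graph from one with disconnected complement. Complementation
    exchanges the two, so that [seinsche_step] has to add a vertex in the first case only. *)
Lemma seinsche e A : symmetric e -> irreflexive e -> P4_free e -> 1 < #|A| ->
  exists (D : {set V}) b, (D != finset.set0) && (D \proper A) /\ forall x y, x \in D -> y \in A :\: D -> e x y = b.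
Proof.
have [n] := ubnP #|A|; elim: n A => // n IH A hn se ie P4 cA.
have /finset.set0Pn[v vA] : A != finset.set0 by rewrite -finset.card_gt0; move: cA; clear; lia.
have cAv : #|A| = #|(A :\ v)%SET|.+1 by rewrite (cardsD1 v) vA.
have [c1|c1] := ltnP 1 #|(A :\ v)%SET|; last first.
  have /eqP/cards1P[u eu] : #|(A :\ v)%SET| = 1 by move: cAv cA c1; clear; lia.
  have : u \in (A :\ v)%SET by rewrite eu inE.
  rewrite !inE => /andP[uv uA]; exists [set v]%SET, (e v u); split.
    rewrite -finset.card_gt0 cards1 /=; apply/properP; split; first by rewrite finset.sub1set.
    by exists u; rewrite ?inE.
  move=> x y; rewrite inE => /eqP->; have -> : (A :\: [set v])%SET = [set u]%SET by rewrite -eu; apply/setP => w; rewrite !inE.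
  by rewrite inE => /eqP->.
have [|B [b [/andP[B0 pB] sep]]] := IH (A :\ v)%SET _ se ie P4 c1; first by move: cAv hn; clear; lia.
case: b sep => sep; last by apply: (seinsche_step se ie P4 vA pB B0) => x y xB yB; rewrite sep.
have [|D [b [pD h]]] := seinsche_step (compl_sym se) (compl_irr e) (compl_P4 se P4) vA pB B0.
  by move=> x y xB yB; rewrite /compl_rel /= sep // andbF.
exists D, (~~ b); split=> // x y xD yD; have := h x y xD yD; rewrite /compl_rel /=.
have -> : x != y by apply: contraTneq yD => <-; rewrite inE xD.
by move=> <-; rewrite negbK.
Qed.

End Cographs.

(** * Convex hulls of arbitrary sets *)

Section Hull.
Variables (R : realType) (k n : nat).
Implicit Types (A : set 'rV[R]_k) (B : set 'rV[R]_n).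

(** The points of the finitely many combinations involved are collected into one family over a
    tagged finite type. *)
Lemma convex_hull_idem B : convex_hull (convex_hull B) `<=` convex_hull B.
Proof.
move=> x [m [p [w [hp w0 w1 ->]]]].
have H i : exists r : {c & 'I_c -> 'rV[R]_n},
    (forall j, B (projT2 r j)) /\ convex_hull (range (projT2 r)) (p i).
  have [c [u [v [hu v0 v1 e]]]] := hp i.
  by exists (existT _ c u); split=> //; exists c, u, v; split=> // j; exists j.
have [r hr] := boolp.choice H.
pose s (t : {i : 'I_m & 'I_(projT1 (r i))}) := projT2 (r (tag t)) (tagged t).
have: conv s [set: _]%SET (\sum_i w i *: p i).
  apply: (@convex_hull_conv _ _ _ s (range p)); last by exists m, p, w; split=> // i; exists i.
  move=> _ [i _ <-]; have [_] := hr i; apply: convex_hullS => _ [j _ <-].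
  by exists (Tagged (fun i => 'I_(projT1 (r i))) j) => //=; rewrite finset.in_setT.
by apply: convex_hullS => _ [t _ <-]; have [h _] := hr (tag t); exact: h.
Qed.

Lemma convex_hull_map A B (h : {linear 'rV[R]_k -> 'rV[R]_n}) u x :
  (forall y, A y -> B (u + h y)) -> convex_hull A x -> convex_hull B (u + h x).
Proof.
move=> hB [m [p [w [hp w0 w1 ->]]]]; exists m, (fun i => u + h (p i)), w; split=> // [i|]; first exact: hB.
rewrite (eq_bigr (fun i => w i *: u + w i *: h (p i))) => [|i _]; last by rewrite scalerDr.
by rewrite big_split -scaler_suml w1 scale1r linear_sum; congr (_ + _); apply: eq_bigr => i _; rewrite linearZ.
Qed.

End Hull.

(** * From graphs without induced paths to Hanner polytopes *)

Section StableHanner.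
Variable R : realType.

(** The two statements are proved together: the one on the polar is what allows passing to the
    complement graph in the disconnected case. *)
Definition dual_hanner n (e : rel 'I_n) := hanner (@stable_polytope R n e) /\
  polar (@stable_polytope R n e) = stable_polytope (compl_rel e).

Lemma dual_hanner1 (e : rel 'I_1) : irreflexive e -> dual_hanner e.
Proof.
have seg (e' : rel 'I_1) : irreflexive e' -> @stable_polytope R 1 e' = [set x | -1 <= x 0 0 <= 1].
  move=> ie; rewrite -conv_segment; apply/seteqP; split.
    apply: convex_hull_conv => x [h _]; rewrite conv_segment /=.
    by case: (h 0) => ->; apply/andP; split; lra.
  apply: convex_hullS => _ [b _ <-]; split=> [i|i j]; last by rewrite !ord1 ie.
  by rewrite mxE; case: b; [constructor 3 | constructor 2].
move=> ie; split; rewrite !seg //; first exact: hanner_segment.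
  by rewrite -conv_segment; exact: dual_polar (dual_segment R).
exact: compl_irr.
Qed.

Lemma bipolar_hanner n (P : set 'rV[R]_n) : hanner P -> polar (polar P) = P.
Proof. by case/hanner_lists => S [T [s [t [-> [c0 _] _]]]]; exact: bipolar. Qed.

Section Step.
Variables (k l : nat) (e : rel 'I_(k + l)) (p : 'I_k -> 'I_(k + l)) (q : 'I_l -> 'I_(k + l)).
Hypotheses (se : symmetric e) (ie : irreflexive e) (pI : injective p) (qI : injective q).
Hypothesis epq : forall i j, e (p i) (q j).
Hypothesis pq_ex : forall m, (exists i, m = p i) \/ (exists j, m = q j).

Let el : rel 'I_k := relpre p e.
Let er : rel 'I_l := relpre q e.

Let embl : {linear 'rV[R]_k -> 'rV[R]_(k + l)} := mulmxr (\matrix_(i, m) (m == p i)%:R).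
Let embr : {linear 'rV[R]_l -> 'rV[R]_(k + l)} := mulmxr (\matrix_(j, m) (m == q j)%:R).

Lemma pq_neq i j : p i == q j = false.
Proof. by apply/negbTE; apply: contraTneq (epq i j) => ->; rewrite ie. Qed.

Lemma embl_in x i : embl x 0 (p i) = x 0 i.
Proof.
rewrite [LHS]mxE (bigD1 i) //= mxE eqxx mulr1 big1 ?addr0 // => m nm.
by rewrite mxE (inj_eq pI) eq_sym (negbTE nm) mulr0.
Qed.
Lemma embl_out x j : embl x 0 (q j) = 0.
Proof. by rewrite [LHS]mxE big1 // => m _; rewrite mxE eq_sym pq_neq mulr0. Qed.
Lemma embr_in y j : embr y 0 (q j) = y 0 j.
Proof.
rewrite [LHS]mxE (bigD1 j) //= mxE eqxx mulr1 big1 ?addr0 // => m nm.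
by rewrite mxE (inj_eq qI) eq_sym (negbTE nm) mulr0.
Qed.
Lemma embr_out y i : embr y 0 (p i) = 0.
Proof. by rewrite [LHS]mxE big1 // => m _; rewrite mxE pq_neq mulr0. Qed.

Lemma pq_sum (F : 'I_(k + l) -> R) : \sum_m F m = \sum_i F (p i) + \sum_j F (q j).
Proof.
rewrite (bigID [pred m | [exists i, m == p i]]) /=; congr (_ + _).
  rewrite -(big_imset _ (in2W pI)) /=; apply: eq_bigl => m.
  apply/existsP/imsetP => [[i /eqP->]|[i _ ->]]; by exists i.
rewrite -(big_imset _ (in2W qI)) /=; apply: eq_bigl => m.
apply/existsPn/imsetP => [h|[j _ ->] i]; last by rewrite eq_sym pq_neq.
by have [[i em]|[j ->]] := pq_ex m; [have := h i; rewrite em eqxx | exists j].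
Qed.

Lemma embl_isom x y : dotp (embl x) (embl y) = dotp x y.
Proof.
rewrite /dotp pq_sum [X in _ + X]big1 ?addr0 => [|j _]; last by rewrite embl_out mul0r.
by apply: eq_bigr => i _; rewrite !embl_in.
Qed.
Lemma embr_isom x y : dotp (embr x) (embr y) = dotp x y.
Proof.
rewrite /dotp pq_sum big1 ?add0r => [|j _]; last by rewrite embr_out mul0r.
by apply: eq_bigr => i _; rewrite !embr_in.
Qed.
Lemma emb_orth x y : dotp (embl x) (embr y) = 0.
Proof. by rewrite /dotp pq_sum !big1 ?addr0 // => m _; rewrite ?embl_out ?embr_out ?mul0r ?mulr0. Qed.

(** All edges between the two sides are present, so a stable vector is supported on one side. *)
Lemma stable_join : stable_polytope e = convex_hull (embl @` stable_polytope el `|` embr @` stable_polytope er).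
Proof.
apply/seteqP; split.
  apply: convex_hullS => x [xv xs].
  have [[j nj]|all0] : (exists j, x 0 (q j) != 0) \/ (forall j, x 0 (q j) = 0).
    have [/existsP|/existsPn h] := boolP [exists j, x 0 (q j) != 0]; first by left.
    by right=> j; apply/eqP; have := h j; rewrite negbK.
    right; exists (\row_j x 0 (q j)).
      apply: sub_convex_hull; split=> [m|m m' emm]; rewrite !mxE; [exact: xv | exact: xs].
    apply/rowP => m; have [[i ->]|[j' ->]] := pq_ex m; last by rewrite embr_in mxE.
    rewrite embr_out; case: (xs _ _ (epq i j)) => // h; by rewrite h eqxx in nj.
  left; exists (\row_j x 0 (p j)).
    apply: sub_convex_hull; split=> [m|m m' emm]; rewrite !mxE; [exact: xv | exact: xs].
  by apply/rowP => m; have [[i ->]|[j' ->]] := pq_ex m; [rewrite embl_in mxE | rewrite embl_out all0].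
apply: subset_trans (@convex_hull_idem _ _ _); apply: convex_hullS => _ [[x cx <-]|[x cx <-]].
  rewrite -[embl x]add0r; apply: convex_hull_map cx => y [yv ys]; rewrite add0r; split=> [m|m m' em].
    by have [[i ->]|[j ->]] := pq_ex m; [rewrite embl_in; exact: yv | rewrite embl_out; constructor 1].
  have [[i mi]|[j ->]] := pq_ex m; last by left; rewrite embl_out.
  have [[i' mi']|[j ->]] := pq_ex m'; last by right; rewrite embl_out.
  by rewrite mi mi' !embl_in; apply: ys; rewrite /el /= -mi -mi'.
rewrite -[embr x]add0r; apply: convex_hull_map cx => y [yv ys]; rewrite add0r; split=> [m|m m' em].
  by have [[i ->]|[j ->]] := pq_ex m; [rewrite embr_out; constructor 1 | rewrite embr_in; exact: yv].
have [[j ->]|[i mi]] := pq_ex m; first by left; rewrite embr_out.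
have [[j ->]|[i' mi']] := pq_ex m'; first by right; rewrite embr_out.
by rewrite mi mi' !embr_in; apply: ys; rewrite /er /= -mi -mi'.
Qed.

Lemma compl_p i i' : compl_rel el i i' = compl_rel e (p i) (p i').
Proof. by rewrite /compl_rel /= (inj_eq pI). Qed.
Lemma compl_q i i' : compl_rel er i i' = compl_rel e (q i) (q i').
Proof. by rewrite /compl_rel /= (inj_eq qI). Qed.

(** The complement has no edges between the sides, so its stable vectors are the sums of stable
    vectors of both sides, just as the polar of a join is the sum of the polars. *)
Lemma dual_hanner_join : dual_hanner el -> dual_hanner er -> dual_hanner e.
Proof.
move=> [hp dp] [hq dq]; split.
  by rewrite stable_join; exact: hanner_join hp hq embl_isom embr_isom emb_orth.
have val x y m : [\/ (exists i, m = p i /\ (embl x + embr y) 0 m = x 0 i) | (exists j, m = q j /\ (embl x + embr y) 0 m = y 0 j)].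
  have [[i ->]|[j ->]] := pq_ex m; [left; exists i | right; exists j]; split=> //; rewrite mxE.
    by rewrite embl_in embr_out addr0.
  by rewrite embl_out embr_in add0r.
apply/seteqP; split=> z.
  rewrite {1}stable_join => /(polar_join embl_isom embr_isom emb_orth)[x [y []]]; rewrite dp dq => cx cy ->.
  apply: (@convex_hull_idem _ _ _); apply: convex_hull_map cy => y' [y'v y's].
  rewrite addrC; apply: convex_hull_map cx => x' [x'v x's]; rewrite addrC; split=> [m|m m' em].
    by case: (val x' y' m) => -[i [_ ->]].
  case: (val x' y' m) => -[i [mi ->]]; case: (val x' y' m') => -[i' [mi' ->]]; rewrite mi mi' in em.
  - by apply: x's; rewrite compl_p.
  - by move: em; rewrite /compl_rel /= epq andbF.
  - by move: em; rewrite /compl_rel /= se epq andbF.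
  - by apply: y's; rewrite compl_q.
move: z; have sub v : @stable_vectors R _ (compl_rel e) v -> polar (stable_polytope e) v.
  move=> [vv vs]; rewrite stable_join; apply/(polar_join embl_isom embr_isom emb_orth).
  exists (\row_i v 0 (p i)), (\row_j v 0 (q j)); rewrite dp dq; split.
  - by apply: sub_convex_hull; split=> [m|m m' em]; rewrite !mxE; [exact: vv | apply: vs; rewrite -compl_p].
  - by apply: sub_convex_hull; split=> [m|m m' em]; rewrite !mxE; [exact: vv | apply: vs; rewrite -compl_q].
  by apply/rowP => m; case: (val (\row_i v 0 (p i)) (\row_j v 0 (q j)) m) => -[i [-> ->]]; rewrite mxE.
move=> z cz y cy; rewrite dotpC; move: z cz; rewrite -/(polar _ _).
have : polar (@stable_vectors R _ (compl_rel e)) y by move=> v /sub h; rewrite dotpC; exact: h.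
by rewrite -polar_hull => h z /h.
Qed.

End Step.

(** The type of [hanner_join] demands dimension k + l literally; the equation transports the result
    to [n]. *)
Lemma dual_hanner_split k l n (e : rel 'I_n) (p : 'I_k -> 'I_n) (q : 'I_l -> 'I_n) : n = (k + l)%N ->
  symmetric e -> irreflexive e -> injective p -> injective q -> (forall i j, e (p i) (q j)) ->
  (forall m, (exists i, m = p i) \/ (exists j, m = q j)) ->
  dual_hanner (relpre p e) -> dual_hanner (relpre q e) -> dual_hanner e.
Proof. by move=> en; subst n; exact: dual_hanner_join. Qed.

Lemma dual_hanner_compl n (e : rel 'I_n) : irreflexive e -> dual_hanner (compl_rel e) -> dual_hanner e.
Proof.
move=> ie [h p]; have eP : stable_polytope e = polar (@stable_polytope R n (compl_rel e)) by rewrite p compl_relK.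
by split; rewrite eP; [exact: hanner_polar | rewrite bipolar_hanner].
Qed.

Theorem P4_free_hanner n (e : rel 'I_n) : (0 < n)%N -> symmetric e -> irreflexive e -> P4_free e -> dual_hanner e.
Proof.
have [m] := ubnP n; elim: m n e => // m IH n e hm n0 se ie P4.
have [n1|n1] := leqP n 1.
  have en : n = 1%N by move: n0 n1; clear; lia.
  by subst n; exact: dual_hanner1.
have IHp c (p : 'I_c -> 'I_n) (e' : rel 'I_n) : (0 < c < n)%N -> injective p -> symmetric e' -> irreflexive e' -> P4_free e' ->
    dual_hanner (relpre p e').
  move=> /andP[c0 cn] pI se' ie' P4'; apply: IH => //; first by move: cn hm; clear; lia.
  - by move=> i j; exact: se'.
  - by move=> i; exact: ie'.
  by move=> a b x y; exact: P4'.
have := @seinsche _ e [set: 'I_n]%SET se ie P4; rewrite cardsT card_ord => /(_ n1)[S [b [/andP[S0 pS] h]]].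
have cS := cardsC S; rewrite card_ord in cS.
have S1 : (0 < #|S|)%N by rewrite finset.card_gt0.
have S2 : (0 < #|~: S|)%N.
  have := proper_card pS; rewrite cardsT card_ord; move: cS; clear; lia.
have b1 : (0 < #|S| < n)%N by move: S1 S2 cS; clear; lia.
have b2 : (0 < #|~: S| < n)%N by move: S1 S2 cS; clear; lia.
have cases x : (exists i : 'I_#|S|, x = enum_val i) \/ (exists j : 'I_#|~: S|, x = enum_val j).
  have [xS|xS] := boolP (x \in S); [left; exists (enum_rank_in xS x) | right].
    by rewrite enum_rankK_in.
  have xC : x \in ~: S by rewrite inE.
  by exists (enum_rank_in xC x); rewrite enum_rankK_in.
have out (j : 'I_#|~: S|) : enum_val j \in [set: 'I_n] :\: S by rewrite !inE andbT; have := enum_valP j; rewrite inE.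
have main (e' : rel 'I_n) : symmetric e' -> irreflexive e' -> P4_free e' ->
    (forall x y, x \in S -> y \in [set: 'I_n] :\: S -> e' x y) -> dual_hanner e'.
  move=> se' ie' P4' h'; apply: (@dual_hanner_split _ _ n e' (@enum_val _ (mem S)) (@enum_val _ (mem (~: S)))) => //.
  - exact: enum_val_inj.
  - exact: enum_val_inj.
  - by move=> i j; apply: h'; [exact: enum_valP | exact: out].
  - by apply: IHp => //; exact: enum_val_inj.
  - by apply: IHp => //; exact: enum_val_inj.
(* For b = true the graph itself is a join. Otherwise its complement is one, and polarity leads
   back. *)
case: b h => h; first by apply: main => // x y xS yS; rewrite h.
apply: dual_hanner_compl => //; apply: main; [exact: compl_sym | exact: compl_irr | exact: compl_P4 |].
move=> x y xS yS; rewrite /compl_rel /= h // andbT.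
by apply: contraTneq yS => <-; rewrite inE xS.
Qed.

End StableHanner.

Theorem theorem1p5 (R : realType) (d : nat) (hd : (1 <= d)%N)
    (P : set 'rV[R]_d) (hdim : has_dim P d%:Z)
    (hP : locally_anti_blocking P) (hn : normalized P) :
  (`I_(2 ^ d * d`!) #<= flags P)%card /\
  ((flags P #= `I_(2 ^ d * d`!))%card <-> hanner P).
Proof.
rewrite -/(nflags d); have lP := normalized_lab hP hn.
have [T [s eP]] := polytopeP (lab_poly lP); rewrite eP in lP *.
have full := conv_lab_full hd lP.
have [L hL sz] := flag_list_conv full; have [le eq] := lab_flags hd lP hL.
have c := card_flags full; rewrite -sz in c.
split; first by rewrite (card_le_eqr c) card_le_II.
split=> [c'|h].
  have [|e [se ie pe ->]] := eq; last by case: (P4_free_hanner R hd se ie pe).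
  by apply/card_eq_II; rewrite -(card_eql c).
have [S [U [u [v [e' D cu]]]]] := hanner_lists h.
by rewrite e' -cu; apply: card_flags; exact: dual_rk D.
Qed.
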